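(* Let $\{z_n\}$ be a separated sequence of points in the unit disc $\mathbb{D}$. Then $\{z_n\}$ is an interpolating sequence for $h^+$ if and only if there exist constants $M>0$ and $0<\alpha<1$ such that $$\#\{z_j : \beta(z_j,z_n)\le l\}\le M\,2^{\alpha l}$$ for all $n,l=1,2,\dots$.
   Context: $\mathbb{D}$ is the open unit disc of the complex plane, and $h^+=h^+(\mathbb{D})$ is the cone of positive harmonic functions in $\mathbb{D}$. The hyperbolic distance is normalized as $$\beta(z,w)=\log_2\frac{1+\left|\frac{z-w}{1-\bar w z}\right|}{1-\left|\frac{z-w}{1-\bar w z}\right|},\qquad z,w\in\mathbb{D}.$$ A sequence $\{z_n\}\subset\mathbb{D}$ is separated if $\inf_{n\ne m}\beta(z_n,z_m)>0$. A sequence $\{z_n\}\subset\mathbb{D}$ is an interpolating sequence for $h^+$ if there exists a constant $\varepsilon=\varepsilon(\{z_n\})>0$ such that for any sequence of positive values $\{w_n\}$ satisfying $|\log_2 w_n-\log_2 w_m|\le\varepsilon\,\beta(z_n,z_m)$ for all $n,m=1,2,\dots$, there exists $u\in h^+$ with $u(z_n)=w_n$ for all $n=1,2,\dots$. *)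

(* Defs.v *)
From Stdlib Require Import Reals List.
From Coquelicot Require Import Coquelicot.
Open Scope R_scope.

Definition log2 (x : R) : R := ln x / ln 2.

Definition in_disc (z : C) : Prop := Cmod z < 1.

Definition pseudo_dist (z w : C) : R :=
  Cmod (Cdiv (Cminus z w) (Cminus (RtoC 1) (Cmult (Cconj w) z))).

(* Note the base-2 normalization, without a factor 1/2. *)
Definition hyp_dist (z w : C) : R :=
  log2 ((1 + pseudo_dist z w) / (1 - pseudo_dist z w)).

(* Only the values of u on the disc matter: the disc is open, so the derivatives
   below do not see the rest. [ex_diff_n _ 2] at every point of the disc says
   that u is of class C^2 there. *)
Definition harmonic_on_disc (u : C -> R) : Prop :=
  let f := fun x y : R => u (x, y) in
  forall x y : R, in_disc (x, y) ->
    ex_diff_n f 2 x y /\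
    partial_derive 2 0 f x y + partial_derive 0 2 f x y = 0.

Definition positive_harmonic (u : C -> R) : Prop :=
  harmonic_on_disc u /\ forall z : C, in_disc z -> 0 < u z.

(* Sequences are infinite and indexed from 0. *)
Definition separated (z : nat -> C) : Prop :=
  Rbar_lt (Finite 0)
    (Glb_Rbar (fun b : R =>
       exists n m : nat, n <> m /\ b = hyp_dist (z n) (z m))).

Definition interpolating (z : nat -> C) : Prop :=
  exists eps : R, 0 < eps /\
    forall w : nat -> R,
      (forall n : nat, 0 < w n) ->
      (forall n m : nat,
         Rabs (log2 (w n) - log2 (w m)) <= eps * hyp_dist (z n) (z m)) ->
      exists u : C -> R,
        positive_harmonic u /\ forall n : nat, u (z n) = w n.

(* P is a finite set with at most x elements. *)
Definition card_le (P : C -> Prop) (x : R) : Prop :=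
  exists s : list C,
    NoDup s /\ (forall p : C, In p s <-> P p) /\ INR (length s) <= x.

(* Main.v *)
Require Import Defs.
From Stdlib Require Import Reals List Lra Lia Psatz Permutation Sorted Arith ZArith.
From Stdlib Require Import ClassicalEpsilon Classical.
From Coquelicot Require Import Coquelicot.
Open Scope R_scope.

(* Necessity.  The data [(1 - rho(z_j, z_n) ^ 2) ^ (- e)], with [rho] the pseudo-hyperbolic
   distance, are admissible and of size [2 ^ (e * beta)].  Since the [z_j] are separated,
   packing in the half-plane gives, for the Poisson kernels, [sum P_j <= C * 2 ^ l * P_n]
   over the points with [beta(z_j, z_n) <= l]; integrating against the interpolating
   function bounds the number of points at distance about [l] by [C * 2 ^ ((1 - e) * l)].

   Sufficiency.  For finitely many points let [h_n = 1 - |z_n| ^ 2] and [X_n = h_n * P_n].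
   Almost selecting at each boundary point the [z_n] with the largest [h_n ^ (- e) * X_n],
   and giving to the boundary function [g] there the value [w_n], one gets a positive
   function whose Poisson extension at [z_n] is [w_n] up to a small relative error
   proportional to the admissible Lipschitz constant.  The error is removed by an analytic
   function [f = sum c_n phi_n], where [phi_n] is a product of a Blaschke quotient vanishing
   at the other points, a localizing kernel, and factors [1 / (1 + A * H_m)] in the spirit of
   P. Jones that make [phi_n] small on the parts of the circle attached to deeper points.
   Then [|Re f| <= g / 2] on the circle, so [g + Re f] has a positive Poisson extension
   which interpolates exactly.  A cluster point of the Fourier coefficients of these boundary
   functions yields the interpolating function for the whole sequence. *)

(** The density exponent is below 1, so the sums of [hyp_exp ^ (- s0)] are bounded for some
    [s0 < 1], and the room [1 - s0] pays for every small exponent used later. The error of the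
    averaged boundary function may change sign, so it is not admissible data and the averaging
    cannot simply be iterated; a correction that stays below half of the boundary function removes
    the error in one stroke and keeps positivity. Such a correction has to be compared, at each
    boundary point, with the value of the point selected there, while Blaschke quotients and
    localizing kernels only know about profiles. The bias [h ^ (- e)] links the two: a shallow point
    is selected against a deep one only where the profile of the deep one is small, and when a much
    deeper point is selected, its damper supplies the missing smallness. In both cases a small power
    of [hyp_exp] is bounded through the inverse profile. All constants depend on the separation and
    the density alone, never on the number of points, which is what allows the passage to the whole
    sequence. *)

Lemma Cmod_sqr (z : C) : Cmod z ^ 2 = fst z ^ 2 + snd z ^ 2.
Proof. exact (Cmod2_alt z). Qed.

Lemma Cmod_le_abs (z : C) : Cmod z <= Rabs (fst z) + Rabs (snd z).
Proof.
  apply Rsqr_incr_0_var.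
  - rewrite !Rsqr_pow2, Cmod_sqr.
    rewrite <- (pow2_abs (fst z)), <- (pow2_abs (snd z)).
    pose proof (Rabs_pos (fst z)); pose proof (Rabs_pos (snd z)); nra.
  - pose proof (Rabs_pos (fst z)); pose proof (Rabs_pos (snd z)); lra.
Qed.

Lemma fst_le_Cmod (z : C) : Rabs (fst z) <= Cmod z.
Proof. exact (re_le_Cmod z). Qed.

Lemma snd_le_Cmod (z : C) : Rabs (snd z) <= Cmod z.
Proof. eapply Rle_trans; [apply Rmax_r | apply Rmax_Cmod]. Qed.

Lemma Cmod_triangle_minus (x y : C) : Cmod (x - y) <= Cmod x + Cmod y.
Proof. unfold Cminus. rewrite <- (Cmod_opp y). apply Cmod_triangle. Qed.

Lemma Cmod_triangle_rev (x y : C) : Cmod x - Cmod y <= Cmod (x - y).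
Proof.
  pose proof (Cmod_triangle (x - y) y) as H.
  replace ((x - y + y)%C) with x in H by ring. lra.
Qed.

Lemma Cmod_lt_neq (x y : C) : Cmod x < Cmod y -> (y - x)%C <> 0.
Proof.
  intros H E. assert (y = x) as -> by (replace y with (y - x + x)%C by ring; rewrite E; ring).
  lra.
Qed.

Definition cis (t : R) : C := (cos t, sin t).

Lemma Cmod_cis (t : R) : Cmod (cis t) = 1.
Proof.
  unfold Cmod, cis; simpl fst; simpl snd.
  replace (cos t ^ 2 + sin t ^ 2) with 1; [apply sqrt_1|].
  pose proof (sin2_cos2 t). unfold Rsqr in H. lra.
Qed.

Lemma cis_pow (t : R) (n : nat) : (cis t ^ n)%C = cis (INR n * t).
Proof.
  induction n as [|n IH].
  - simpl. unfold cis. rewrite Rmult_0_l, cos_0, sin_0. reflexivity.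
  - rewrite S_INR. simpl. rewrite IH. unfold cis, Cmult; simpl.
    replace ((INR n + 1) * t) with (t + INR n * t) by ring.
    rewrite cos_plus, sin_plus. f_equal; ring.
Qed.

(** * Continuity and mean values on the circle *)

Definition contC {T : UniformSpace} (F : T -> C) (x : T) : Prop :=
  continuous (fun y => fst (F y)) x /\ continuous (fun y => snd (F y)) x.

Lemma contC_fst {T : UniformSpace} (F : T -> C) x :
  contC F x -> continuous (fun y => fst (F y)) x.
Proof. intros H; exact (proj1 H). Qed.

Lemma contC_snd {T : UniformSpace} (F : T -> C) x :
  contC F x -> continuous (fun y => snd (F y)) x.
Proof. intros H; exact (proj2 H). Qed.

Section Continuity.
Context {T : UniformSpace}.

Lemma cont_ext (f g : T -> R) x : (forall y, f y = g y) -> continuous f x -> continuous g x.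
Proof. intros E H. eapply continuous_ext; eauto. Qed.

Lemma cont_plus (f g : T -> R) x :
  continuous f x -> continuous g x -> continuous (fun y => f y + g y) x.
Proof. apply (continuous_plus (V := R_NormedModule) f g). Qed.

Lemma cont_minus (f g : T -> R) x :
  continuous f x -> continuous g x -> continuous (fun y => f y - g y) x.
Proof. apply (continuous_minus (V := R_NormedModule) f g). Qed.

Lemma cont_opp (f : T -> R) x : continuous f x -> continuous (fun y => - f y) x.
Proof. apply (continuous_opp (V := R_NormedModule) f). Qed.

Lemma cont_mult (f g : T -> R) x :
  continuous f x -> continuous g x -> continuous (fun y => f y * g y) x.
Proof. apply (continuous_mult (K := R_AbsRing) f g). Qed.

Lemma cont_const (c : R) (x : T) : continuous (fun _ : T => c) x.
Proof. apply continuous_const. Qed.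

Lemma cont_comp (f : T -> R) (g : R -> R) x :
  continuous f x -> continuous g (f x) -> continuous (fun y => g (f y)) x.
Proof. apply continuous_comp. Qed.

Lemma cont_inv (f : T -> R) x :
  continuous f x -> f x <> 0 -> continuous (fun y => / f y) x.
Proof.
  intros H H0. apply (cont_comp f Rinv); auto. apply continuous_Rinv; auto.
Qed.

Lemma cont_div (f g : T -> R) x :
  continuous f x -> continuous g x -> g x <> 0 -> continuous (fun y => f y / g y) x.
Proof. intros; apply cont_mult; auto. apply cont_inv; auto. Qed.

Lemma cont_abs (f : T -> R) x : continuous f x -> continuous (fun y => Rabs (f y)) x.
Proof. intros; apply (cont_comp f Rabs); auto. apply continuous_Rabs. Qed.

Lemma cont_max (f g : T -> R) x :
  continuous f x -> continuous g x -> continuous (fun y => Rmax (f y) (g y)) x.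
Proof.
  intros Hf Hg.
  apply (cont_ext (fun y => (f y + g y + Rabs (f y - g y)) / 2)).
  - intros y. unfold Rmax, Rabs. destruct (Rle_dec _ _), (Rcase_abs _); lra.
  - apply cont_div; [|apply cont_const|lra].
    apply cont_plus; [apply cont_plus; auto|]. apply cont_abs, cont_minus; auto.
Qed.

Lemma contC_const (c : C) (x : T) : contC (fun _ => c) x.
Proof. split; apply cont_const. Qed.

Lemma contC_ext (f g : T -> C) x : (forall y, f y = g y) -> contC f x -> contC g x.
Proof.
  intros E [H1 H2]; split; [eapply cont_ext; [|apply H1]|eapply cont_ext; [|apply H2]];
    intros; simpl; rewrite E; auto.
Qed.

Lemma contC_plus (f g : T -> C) x : contC f x -> contC g x -> contC (fun y => f y + g y)%C x.
Proof. intros [] []; split; simpl; apply cont_plus; auto. Qed.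

Lemma contC_opp (f : T -> C) x : contC f x -> contC (fun y => - f y)%C x.
Proof. intros []; split; simpl; apply cont_opp; auto. Qed.

Lemma contC_minus (f g : T -> C) x : contC f x -> contC g x -> contC (fun y => f y - g y)%C x.
Proof. intros; apply contC_plus; auto. apply contC_opp; auto. Qed.

Lemma contC_mult (f g : T -> C) x : contC f x -> contC g x -> contC (fun y => f y * g y)%C x.
Proof.
  intros [] []; split; simpl.
  - apply cont_minus; apply cont_mult; auto.
  - apply cont_plus; apply cont_mult; auto.
Qed.

Lemma cont_sqmod (f : T -> C) x : contC f x -> continuous (fun y => Cmod (f y) ^ 2) x.
Proof.
  intros [H1 H2]. apply (cont_ext (fun y => fst (f y) * fst (f y) + snd (f y) * snd (f y))).
  - intros; rewrite Cmod_sqr; ring.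
  - apply cont_plus; apply cont_mult; auto.
Qed.

Lemma contC_inv (f : T -> C) x : contC f x -> f x <> 0 -> contC (fun y => / f y)%C x.
Proof.
  intros [H1 H2] H0.
  assert (fst (f x) ^ 2 + snd (f x) ^ 2 <> 0).
  { intros E. apply H0. apply Cmod_eq_0.
    pose proof (Cmod_sqr (f x)). rewrite E in H. simpl in H.
    pose proof (Cmod_ge_0 (f x)). nra. }
  assert (continuous (fun y => fst (f y) ^ 2 + snd (f y) ^ 2) x).
  { apply (cont_ext (fun y => fst (f y) * fst (f y) + snd (f y) * snd (f y))).
    - intros; ring.
    - apply cont_plus; apply cont_mult; auto. }
  split; simpl; apply cont_div; auto. apply cont_opp; auto.
Qed.

Lemma contC_pow (f : T -> C) n x : contC f x -> contC (fun y => f y ^ n)%C x.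
Proof.
  intros H; induction n as [|n IH]; simpl. apply contC_const. apply contC_mult; auto.
Qed.

Lemma contC_RtoC (f : T -> R) x : continuous f x -> contC (fun y => RtoC (f y)) x.
Proof. intros; split; simpl; auto. apply cont_const. Qed.

Lemma contC_cis (f : T -> R) x : continuous f x -> contC (fun y => cis (f y)) x.
Proof.
  intros; split; simpl; apply cont_comp; auto.
  apply continuous_cos. apply continuous_sin.
Qed.

End Continuity.

Definition mean (f : R -> R) : R := / (2 * PI) * RInt f 0 (2 * PI).

Definition meanC (F : R -> C) : C := (mean (fun t => fst (F t)), mean (fun t => snd (F t))).

Lemma PI2_pos : 0 < 2 * PI.
Proof. pose proof PI_RGT_0; lra. Qed.

Lemma ex_mean (f : R -> R) : (forall t, continuous f t) -> ex_RInt f 0 (2 * PI).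
Proof. intros H. apply (ex_RInt_continuous (V := R_CompleteNormedModule)). auto. Qed.

Lemma mean_ext (f g : R -> R) : (forall t, f t = g t) -> mean f = mean g.
Proof. intros H. unfold mean. f_equal. apply RInt_ext. auto. Qed.

Lemma mean_const (c : R) : mean (fun _ => c) = c.
Proof.
  unfold mean. rewrite RInt_const. unfold scal; simpl; unfold mult; simpl.
  pose proof PI_RGT_0. field. lra.
Qed.

Lemma mean_plus (f g : R -> R) :
  (forall t, continuous f t) -> (forall t, continuous g t) ->
  mean (fun t => f t + g t) = mean f + mean g.
Proof.
  intros Hf Hg. unfold mean. rewrite <- Rmult_plus_distr_l. f_equal.
  apply (RInt_plus (V := R_CompleteNormedModule)); apply ex_mean; auto.
Qed.

Lemma mean_scal (c : R) (f : R -> R) :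
  (forall t, continuous f t) -> mean (fun t => c * f t) = c * mean f.
Proof.
  intros Hf. unfold mean.
  rewrite (RInt_ext _ (fun t => scal c (f t))) by (intros; reflexivity).
  rewrite (RInt_scal (V := R_CompleteNormedModule)) by (apply ex_mean; auto).
  unfold scal; simpl; unfold mult; simpl. ring.
Qed.

Lemma mean_minus (f g : R -> R) :
  (forall t, continuous f t) -> (forall t, continuous g t) ->
  mean (fun t => f t - g t) = mean f - mean g.
Proof.
  intros Hf Hg.
  rewrite (mean_ext _ (fun t => f t + (-1) * g t)) by (intros; ring).
  rewrite mean_plus; auto. rewrite mean_scal; auto. ring.
  intros; apply cont_mult; auto. apply cont_const.
Qed.

Lemma mean_le (f g : R -> R) :
  (forall t, continuous f t) -> (forall t, continuous g t) ->
  (forall t, f t <= g t) -> mean f <= mean g.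
Proof.
  intros Hf Hg H. unfold mean. pose proof PI2_pos.
  apply Rmult_le_compat_l. left; apply Rinv_0_lt_compat; lra.
  apply RInt_le; try lra; auto using ex_mean.
Qed.

Lemma meanC_ext (f g : R -> C) : (forall t, f t = g t) -> meanC f = meanC g.
Proof. intros H. unfold meanC. f_equal; apply mean_ext; intros; rewrite H; auto. Qed.

Lemma meanC_const (c : C) : meanC (fun _ => c) = c.
Proof. unfold meanC. rewrite !mean_const. symmetry; apply surjective_pairing. Qed.

Lemma meanC_plus (f g : R -> C) :
  (forall t, contC f t) -> (forall t, contC g t) ->
  meanC (fun t => f t + g t)%C = (meanC f + meanC g)%C.
Proof.
  intros Hf Hg. unfold meanC, Cplus; simpl.
  f_equal; apply mean_plus; intros t; (apply contC_fst || apply contC_snd); auto.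
Qed.

Lemma meanC_scal (c : C) (f : R -> C) :
  (forall t, contC f t) -> meanC (fun t => c * f t)%C = (c * meanC f)%C.
Proof.
  intros Hf. unfold meanC, Cmult; simpl.
  assert (forall t, continuous (fun y => fst (f y)) t) by apply Hf.
  assert (forall t, continuous (fun y => snd (f y)) t) by apply Hf.
  f_equal.
  - rewrite mean_minus, !mean_scal; auto; intros; apply cont_mult; auto using cont_const.
  - rewrite mean_plus, !mean_scal; auto; intros; apply cont_mult; auto using cont_const.
Qed.

Lemma meanC_minus (f g : R -> C) :
  (forall t, contC f t) -> (forall t, contC g t) ->
  meanC (fun t => f t - g t)%C = (meanC f - meanC g)%C.
Proof.
  intros Hf Hg.
  rewrite (meanC_ext _ (fun t => f t + (- RtoC 1) * g t)%C).
  - rewrite meanC_plus; auto. rewrite meanC_scal; auto.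
    ring.
    intros; apply contC_mult; auto; apply contC_const.
  - intros; ring.
Qed.

Lemma contC_circle (t : R) : contC cis t.
Proof. apply contC_cis. apply continuous_id. Qed.

Lemma meanC_pow (n : nat) : (1 <= n)%nat -> meanC (fun t => cis t ^ n)%C = 0.
Proof.
  intros Hn. assert (0 < INR n) by (apply lt_0_INR; lia).
  rewrite (meanC_ext _ (fun t => cis (INR n * t))) by (intros; apply cis_pow).
  unfold meanC, cis, mean; simpl.
  assert (is_RInt (fun t => cos (INR n * t)) 0 (2 * PI)
            (minus (/ INR n * sin (INR n * (2 * PI))) (/ INR n * sin (INR n * 0)))).
  { apply (is_RInt_derive (V := R_CompleteNormedModule) (fun t => / INR n * sin (INR n * t))).
    - intros x _. auto_derive; auto. field; lra.
    - intros x _. apply cont_comp. apply cont_mult. apply cont_const. apply continuous_id.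
      apply continuous_cos. }
  assert (is_RInt (fun t => sin (INR n * t)) 0 (2 * PI)
            (minus (- / INR n * cos (INR n * (2 * PI))) (- / INR n * cos (INR n * 0)))).
  { apply (is_RInt_derive (V := R_CompleteNormedModule) (fun t => - / INR n * cos (INR n * t))).
    - intros x _. auto_derive; auto. field; lra.
    - intros x _. apply cont_comp. apply cont_mult. apply cont_const. apply continuous_id.
      apply continuous_sin. }
  rewrite (is_RInt_unique (V := R_CompleteNormedModule) _ _ _ _ H0), (is_RInt_unique (V := R_CompleteNormedModule) _ _ _ _ H1).
  replace (INR n * (2 * PI)) with (0 + 2 * INR n * PI) by ring.
  rewrite sin_period, cos_period, Rmult_0_r, sin_0, cos_0.
  unfold minus, plus, opp; simpl. unfold RtoC. f_equal; ring.
Qed.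

(** * The Poisson kernel *)

Definition defect (a : C) : R := 1 - Cmod a ^ 2.

Definition poisson (a : C) (t : R) : R := defect a / Cmod (cis t - a) ^ 2.

Lemma defect_pos (a : C) : Cmod a < 1 -> 0 < defect a.
Proof. intros H. unfold defect. pose proof (Cmod_ge_0 a). nra. Qed.

Lemma one_sub_neq (b z : C) : Cmod b < 1 -> Cmod z <= 1 -> (1 - b * z)%C <> 0.
Proof.
  intros Hb Hz. apply Cmod_lt_neq. rewrite Cmod_mult, Cmod_1.
  pose proof (Cmod_ge_0 b); pose proof (Cmod_ge_0 z); nra.
Qed.

Lemma circle_sub_neq (a : C) (t : R) : Cmod a < 1 -> (cis t - a)%C <> 0.
Proof. intros H. apply Cmod_lt_neq. rewrite Cmod_cis; auto. Qed.

Lemma circle_sub_pos (a : C) (t : R) : Cmod a < 1 -> 0 < Cmod (cis t - a).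
Proof. intros H. apply Cmod_gt_0. apply circle_sub_neq; auto. Qed.

Lemma circle_conj (t : R) : (cis t * Cconj (cis t))%C = 1.
Proof. rewrite <- Cmod2_conj, Cmod_cis. f_equal; ring. Qed.

Lemma Cmod_circle_sub (a : C) (t : R) :
  Cmod (1 - Cconj a * cis t) = Cmod (cis t - a).
Proof.
  transitivity (Cmod (cis t * Cconj (cis t - a))).
  - f_equal. rewrite Cminus_conj, <- (circle_conj t). ring.
  - rewrite Cmod_mult, Cmod_conj, Cmod_cis. ring.
Qed.

Lemma poisson_pos (a : C) (t : R) : Cmod a < 1 -> 0 < poisson a t.
Proof.
  intros H. apply Rdiv_lt_0_compat. apply defect_pos; auto.
  apply pow_lt, circle_sub_pos; auto.
Qed.

Lemma cont_poisson (a : C) (t : R) : Cmod a < 1 -> continuous (poisson a) t.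
Proof.
  intros H. apply cont_div. apply cont_const.
  apply cont_sqmod. apply contC_minus. apply contC_circle. apply contC_const.
  apply pow_nonzero. pose proof (circle_sub_pos a t H). lra.
Qed.

Lemma poisson_mul_sub (a : C) (t : R) : Cmod a < 1 ->
  (RtoC (poisson a t) * (cis t - a))%C = (RtoC (defect a) * (cis t / (1 - Cconj a * cis t)))%C.
Proof.
  intros H. pose proof (circle_sub_neq a t H) as Hn.
  assert (H2 : (1 - Cconj a * cis t)%C <> 0).
  { apply one_sub_neq. rewrite Cmod_conj; auto. rewrite Cmod_cis; lra. }
  assert (H3 : Cconj (cis t - a) <> 0).
  { intros E. apply Hn. apply Cmod_eq_0. rewrite <- Cmod_conj, E. apply Cmod_0. }
  unfold poisson. rewrite RtoC_div, Cmod2_conj.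
  2:{ apply pow_nonzero. pose proof (circle_sub_pos a t H). lra. }
  assert (E : (1 - Cconj a * cis t)%C = (cis t * Cconj (cis t - a))%C).
  { rewrite Cminus_conj, <- (circle_conj t). ring. }
  assert (Hc : cis t <> 0).
  { intros E0. pose proof (Cmod_cis t). rewrite E0, Cmod_0 in H0. lra. }
  rewrite E. field. auto.
Qed.

Lemma fst_Cinv (w : C) : fst (/ w)%C = fst w / Cmod w ^ 2.
Proof. rewrite Cmod_sqr. reflexivity. Qed.

Lemma poisson_split (a : C) (t : R) : Cmod a < 1 ->
  poisson a t = 2 * fst (/ (1 - Cconj a * cis t))%C - 1.
Proof.
  intros H.
  assert (H2 : (1 - Cconj a * cis t)%C <> 0).
  { apply one_sub_neq. rewrite Cmod_conj; auto. rewrite Cmod_cis; lra. }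
  unfold poisson. rewrite <- Cmod_circle_sub, fst_Cinv.
  assert (0 < Cmod (1 - Cconj a * cis t)) by (apply Cmod_gt_0; auto).
  assert (E : defect a = 2 * fst (1 - Cconj a * cis t)%C - Cmod (1 - Cconj a * cis t) ^ 2).
  { unfold defect. rewrite !Cmod_sqr. simpl.
    pose proof (sin2_cos2 t) as Ht. unfold Rsqr in Ht.
    assert (sin t * sin t = 1 - cos t * cos t) by lra. nra. }
  rewrite E. field. lra.
Qed.

(** Iteration gives [e j = b ^ k * e (k + j)], of modulus at most [Cmod b ^ k * B] for every [k].
    This replaces the expansion of [/ (1 - b * z)] in a geometric series, and with it any
    interchange of sums and integrals. *)
Lemma geometric_vanishing (e : nat -> C) (b : C) (B : R) :
  Cmod b < 1 -> (forall j, e j = (b * e (S j))%C) -> (forall j, Cmod (e j) <= B) ->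
  forall j, e j = 0.
Proof.
  intros Hb He HB j. apply Cmod_eq_0.
  assert (H : forall k, e j = (b ^ k * e (k + j)%nat)%C).
  { induction k as [|k IH]. simpl; ring.
    rewrite IH, He. simpl. ring. }
  assert (H1 : forall k, Cmod (e j) <= Cmod b ^ k * B).
  { intros k. rewrite (H k), Cmod_mult, Cmod_pow.
    apply Rmult_le_compat_l; auto. apply pow_le, Cmod_ge_0. }
  apply Rle_antisym; [|apply Cmod_ge_0].
  assert (H2 : is_lim_seq (fun k => Cmod b ^ k * B) 0).
  { replace (Finite 0) with (Rbar_mult 0 B) by (simpl; f_equal; ring).
    apply is_lim_seq_mult'; [|apply is_lim_seq_const].
    apply is_lim_seq_geom. rewrite Rabs_pos_eq; auto. apply Cmod_ge_0. }
  apply (is_lim_seq_le (fun _ => Cmod (e j)) _ _ _ H1 (is_lim_seq_const _) H2).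
Qed.

Lemma mean_abs (f : R -> R) : (forall t, continuous f t) ->
  Rabs (mean f) <= mean (fun t => Rabs (f t)).
Proof.
  intros Hf. assert (Ha : forall t, continuous (fun t => Rabs (f t)) t)
    by (intros; apply cont_abs; auto).
  apply Rabs_le. split.
  - replace (- mean (fun t => Rabs (f t))) with (mean (fun t => (-1) * Rabs (f t)))
      by (rewrite mean_scal; auto; ring).
    apply mean_le; auto. intros; apply cont_mult; auto using cont_const.
    intros t. pose proof (Rabs_maj2 (f t)). lra.
  - apply mean_le; auto. intros; apply Rle_abs.
Qed.

Lemma meanC_mul_pow_bound (G : R -> C) (j : nat) : (forall t, contC G t) ->
  Cmod (meanC (fun t => G t * cis t ^ j)%C)
  <= 2 * mean (fun t => Rabs (fst (G t)) + Rabs (snd (G t))).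
Proof.
  intros HG.
  assert (HGj : forall t, contC (fun t => G t * cis t ^ j)%C t).
  { intros; apply contC_mult; auto. apply contC_pow, contC_circle. }
  assert (Ha : forall t, continuous (fun t => Rabs (fst (G t)) + Rabs (snd (G t))) t).
  { intros; apply cont_plus; apply cont_abs; [apply contC_fst|apply contC_snd]; auto. }
  assert (Hb : forall t, Cmod (G t * cis t ^ j) <= Rabs (fst (G t)) + Rabs (snd (G t))).
  { intros t. rewrite Cmod_mult, Cmod_pow, Cmod_cis, pow1, Rmult_1_r. apply Cmod_le_abs. }
  eapply Rle_trans; [apply Cmod_le_abs|]. unfold meanC; cbn [fst snd].
  set (m := mean (fun t => Rabs (fst (G t)) + Rabs (snd (G t)))).
  assert (Rabs (mean (fun t => fst (G t * cis t ^ j)%C)) <= m).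
  { eapply Rle_trans; [apply mean_abs; intros; apply contC_fst, HGj|].
    apply mean_le; auto. intros; apply cont_abs, contC_fst, HGj.
    intros; eapply Rle_trans; [apply fst_le_Cmod|auto]. }
  assert (Rabs (mean (fun t => snd (G t * cis t ^ j)%C)) <= m).
  { eapply Rle_trans; [apply mean_abs; intros; apply contC_snd, HGj|].
    apply mean_le; auto. intros; apply cont_abs, contC_snd, HGj.
    intros; eapply Rle_trans; [apply snd_le_Cmod|auto]. }
  lra.
Qed.

Lemma contC_geom (b : C) (t : R) : Cmod b < 1 -> contC (fun t => / (1 - b * cis t))%C t.
Proof.
  intros Hb. apply contC_inv.
  - apply contC_minus; [apply contC_const|].
    apply contC_mult; [apply contC_const|apply contC_circle].
  - apply one_sub_neq; auto. rewrite Cmod_cis; lra.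
Qed.

(** Times [1 - b * cis t] the integrand is a pure positive power, of mean zero; this is the
    recursion of [geometric_vanishing]. *)
Lemma meanC_geom_pow (b : C) (j : nat) : Cmod b < 1 ->
  meanC (fun t => / (1 - b * cis t) * cis t ^ S j)%C = 0.
Proof.
  intros Hb. revert j.
  apply (geometric_vanishing _ b
    (2 * mean (fun t => Rabs (fst (/ (1 - b * cis t))%C) + Rabs (snd (/ (1 - b * cis t))%C)))); auto.
  - intros j. rewrite <- meanC_scal.
    2:{ intros; apply contC_mult. apply contC_geom; auto. apply contC_pow, contC_circle. }
    set (A := meanC _). set (B := meanC _).
    replace A with (A - B + B)%C by ring.
    replace (A - B)%C with (RtoC 0); [ring|].
    unfold A, B. rewrite <- meanC_minus.
    + rewrite <- (meanC_pow (S j)) by lia. apply meanC_ext. intros t.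
      simpl. field. apply one_sub_neq; auto. rewrite Cmod_cis; lra.
    + intros; apply contC_mult. apply contC_geom; auto. apply contC_pow, contC_circle.
    + intros; apply contC_mult. apply contC_const.
      apply contC_mult. apply contC_geom; auto. apply contC_pow, contC_circle.
  - intros j. apply (meanC_mul_pow_bound (fun t => / (1 - b * cis t))%C).
    intros; apply contC_geom; auto.
Qed.

Lemma mean_poisson (a : C) : Cmod a < 1 -> mean (poisson a) = 1.
Proof.
  intros Ha. assert (Hb : Cmod (Cconj a) < 1) by (rewrite Cmod_conj; auto).
  rewrite (mean_ext _ _ (fun t => poisson_split a t Ha)).
  assert (Hg : forall t, continuous (fun t => fst (/ (1 - Cconj a * cis t))%C) t)
    by (intros; apply contC_fst, contC_geom; auto).
  rewrite mean_minus, mean_scal, mean_const; auto.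
  2:{ intros; apply cont_mult; auto using cont_const. }
  2:{ intros; apply cont_const. }
  change (mean (fun t => fst (/ (1 - Cconj a * cis t))%C))
    with (fst (meanC (fun t => / (1 - Cconj a * cis t))%C)).
  rewrite (meanC_ext _ (fun t => RtoC 1 + Cconj a * (/ (1 - Cconj a * cis t) * cis t ^ 1)))%C.
  - assert (Hp : forall t, contC (fun t => / (1 - Cconj a * cis t) * cis t ^ 1)%C t).
    { intros; apply contC_mult. apply contC_geom; auto. apply contC_pow, contC_circle. }
    rewrite meanC_plus, meanC_scal, (meanC_geom_pow _ 0), meanC_const; auto.
    + simpl; ring.
    + intros; apply contC_const.
    + intros; apply contC_mult; auto. apply contC_const.
  - intros; simpl. field. apply one_sub_neq; auto. rewrite Cmod_cis; lra.
Qed.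

(* Closed under multiplication by the linear factors [al + be * z] and
   [/ (1 - b * z)] with [Cmod b < 1]; the power of [z] in the definition is what makes the
   second closure property provable. *)
Definition disc_holo (F : C -> C) : Prop :=
  (forall t, contC (fun t => F (cis t)) t) /\
  forall a, Cmod a < 1 -> forall j : nat,
    meanC (fun t => RtoC (poisson a t) * F (cis t) * cis t ^ j)%C = (F a * a ^ j)%C.

Lemma contC_poisson (a : C) (t : R) : Cmod a < 1 -> contC (fun t => RtoC (poisson a t)) t.
Proof. intros; apply contC_RtoC, cont_poisson; auto. Qed.

Lemma disc_holo_cont (F : C -> C) (a : C) (j : nat) : disc_holo F -> Cmod a < 1 ->
  forall t, contC (fun t => RtoC (poisson a t) * F (cis t) * cis t ^ j)%C t.
Proof.
  intros [H _] Ha t. apply contC_mult. apply contC_mult. apply contC_poisson; auto. auto.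
  apply contC_pow, contC_circle.
Qed.

(** By induction on [j]: replacing [cis t ^ S j] by [a * cis t ^ j] costs the mean of
    [poisson a t * (cis t - a) * cis t ^ j], and [poisson_mul_sub] turns this integrand into a
    geometric factor times a positive power. *)
Lemma disc_holo_one : disc_holo (fun _ => RtoC 1).
Proof.
  split. intros; apply contC_const.
  intros a Ha j. induction j as [|j IH].
  - rewrite (meanC_ext _ (fun t => RtoC (poisson a t))) by (intros; simpl; ring).
    unfold meanC; simpl.
    rewrite mean_const. change (mean (fun t => poisson a t)) with (mean (poisson a)).
    rewrite mean_poisson; auto. unfold RtoC, Cmult; simpl; f_equal; ring.
  - simpl pow. transitivity (a * meanC (fun t => RtoC (poisson a t) * 1 * cis t ^ j))%C;
      [|rewrite IH; simpl; ring].
    assert (Hc : forall k t, contC (fun t => RtoC (poisson a t) * 1 * cis t ^ k)%C t).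
    { intros. apply contC_mult. apply contC_mult. apply contC_poisson; auto.
      apply contC_const. apply contC_pow, contC_circle. }
    rewrite <- meanC_scal by auto.
    set (A := meanC _). set (B := meanC _).
    replace A with (A - B + B)%C by ring.
    replace (A - B)%C with (RtoC 0); [ring|].
    unfold A, B. rewrite <- meanC_minus.
    + rewrite (meanC_ext _ (fun t => RtoC (defect a) *
        (/ (1 - Cconj a * cis t) * cis t ^ S j)))%C.
      * rewrite meanC_scal, meanC_geom_pow. ring. rewrite Cmod_conj; auto.
        intros; apply contC_mult. apply contC_geom; rewrite Cmod_conj; auto.
        apply contC_pow, contC_circle.
      * intros t. simpl.
        transitivity ((RtoC (poisson a t) * (cis t - a)) * cis t ^ j)%C; [ring|].
        rewrite poisson_mul_sub by auto. unfold Cdiv. ring.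
    + intros; apply (Hc (S j)).
    + intros; apply contC_mult; auto. apply contC_const.
Qed.

Lemma disc_holo_ext (F G : C -> C) : (forall z, F z = G z) -> disc_holo F -> disc_holo G.
Proof.
  intros E [H1 H2]. split.
  - intros t. eapply contC_ext; [|apply H1]. intros; apply E.
  - intros a Ha j. rewrite <- E, <- H2 by auto. apply meanC_ext. intros; rewrite E; auto.
Qed.

Lemma disc_holo_plus (F G : C -> C) : disc_holo F -> disc_holo G ->
  disc_holo (fun z => F z + G z)%C.
Proof.
  intros HF HG. split.
  - intros; apply contC_plus. apply HF. apply HG.
  - intros a Ha j.
    rewrite (meanC_ext _ (fun t => RtoC (poisson a t) * F (cis t) * cis t ^ j +
      RtoC (poisson a t) * G (cis t) * cis t ^ j)%C) by (intros; ring).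
    rewrite meanC_plus by (apply disc_holo_cont; auto).
    rewrite (proj2 HF), (proj2 HG); auto. ring.
Qed.

Lemma disc_holo_scal (c : C) (F : C -> C) : disc_holo F -> disc_holo (fun z => c * F z)%C.
Proof.
  intros HF. split.
  - intros; apply contC_mult. apply contC_const. apply HF.
  - intros a Ha j.
    rewrite (meanC_ext _ (fun t => c * (RtoC (poisson a t) * F (cis t) * cis t ^ j))%C)
      by (intros; ring).
    rewrite meanC_scal by (apply disc_holo_cont; auto).
    rewrite (proj2 HF); auto. ring.
Qed.

Lemma disc_holo_mul_id (F : C -> C) : disc_holo F -> disc_holo (fun z => z * F z)%C.
Proof.
  intros HF. split.
  - intros; apply contC_mult. apply contC_circle. apply HF.
  - intros a Ha j.
    rewrite (meanC_ext _ (fun t => RtoC (poisson a t) * F (cis t) * cis t ^ S j)%C)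
      by (intros; simpl; ring).
    rewrite (proj2 HF); auto. simpl. ring.
Qed.

Lemma disc_holo_mul_linear (al be : C) (F : C -> C) : disc_holo F ->
  disc_holo (fun z => (al + be * z) * F z)%C.
Proof.
  intros HF. apply (disc_holo_ext (fun z => al * F z + be * (z * F z))%C).
  intros; ring.
  apply disc_holo_plus; apply disc_holo_scal; auto. apply disc_holo_mul_id; auto.
Qed.

(** The discrepancy [e j] between the mean and the expected value is bounded in [j] and satisfies
    [e j = b * e (S j)], because multiplying by [1 - b * z] gives back [F]. *)
Lemma disc_holo_mul_geom (b : C) (F : C -> C) : Cmod b < 1 -> disc_holo F ->
  disc_holo (fun z => / (1 - b * z) * F z)%C.
Proof.
  intros Hb HF.
  assert (Hc : forall t, contC (fun t => / (1 - b * cis t) * F (cis t))%C t).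
  { intros; apply contC_mult. apply contC_geom; auto. apply HF. }
  split; auto.
  intros a Ha j.
  assert (Hq : forall j t,
    contC (fun t => RtoC (poisson a t) * (/ (1 - b * cis t) * F (cis t)) * cis t ^ j)%C t).
  { intros i t. apply contC_mult. apply contC_mult. apply contC_poisson; auto. auto.
    apply contC_pow, contC_circle. }
  set (e := fun j => (meanC (fun t => RtoC (poisson a t) * (/ (1 - b * cis t) * F (cis t)) * cis t ^ j)
     - / (1 - b * a) * F a * a ^ j)%C).
  assert (Hnz : forall z, Cmod z <= 1 -> (1 - b * z)%C <> 0) by (intros; apply one_sub_neq; auto).
  enough (e j = 0) as E.
  { set (m := meanC _) in *. unfold e in E. fold m in E.
    replace m with (m - / (1 - b * a) * F a * a ^ j + / (1 - b * a) * F a * a ^ j)%C by ring.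
    rewrite E. ring. }
  revert j.
  set (G := fun t => (RtoC (poisson a t) * (/ (1 - b * cis t) * F (cis t)))%C).
  apply (geometric_vanishing _ b
    (2 * mean (fun t => Rabs (fst (G t)) + Rabs (snd (G t))) + Cmod (/ (1 - b * a) * F a))); auto.
  - intros j.
    replace (e j) with (e j - b * e (S j) + b * e (S j))%C by ring.
    replace (e j - b * e (S j))%C with (RtoC 0); [ring|].
    unfold e.
    set (A := meanC _). set (B := meanC _).
    enough (A - b * B = F a * a ^ j)%C as E.
    { transitivity (F a * a ^ j - F a * a ^ j)%C; [ring|].
      rewrite <- E at 1. simpl. field. apply Hnz; lra. }
    unfold A, B. rewrite <- meanC_scal by apply Hq. rewrite <- meanC_minus.
    + rewrite <- (proj2 HF) by auto. apply meanC_ext. intros t. simpl. field.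
      apply Hnz. rewrite Cmod_cis; lra.
    + apply Hq.
    + intros; apply contC_mult. apply contC_const. apply Hq.
  - intros j. unfold e. eapply Rle_trans; [apply Cmod_triangle_minus|].
    apply Rplus_le_compat.
    + apply (meanC_mul_pow_bound G). intros.
      apply contC_mult; auto. apply contC_poisson; auto.
    + rewrite Cmod_mult, Cmod_pow. rewrite <- (Rmult_1_r (Cmod (_ * _)%C)) at 2.
      apply Rmult_le_compat_l. apply Cmod_ge_0.
      rewrite <- (pow1 j). apply pow_incr. split. apply Cmod_ge_0. lra.
Qed.

Lemma disc_holo_mean (F : C -> C) (a : C) : disc_holo F -> Cmod a < 1 ->
  mean (fun t => poisson a t * fst (F (cis t))) = fst (F a).
Proof.
  intros HF Ha. pose proof (proj2 HF a Ha 0%nat) as H.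
  apply (f_equal fst) in H. unfold meanC in H. cbn [fst] in H.
  transitivity (fst (F a * a ^ 0)%C); [|simpl; ring].
  rewrite <- H. apply mean_ext. intros; simpl. ring.
Qed.

(** * The hyperbolic metric *)

(* [hyp_exp z w] is [2 ^ hyp_dist z w]. *)
Definition hyp_exp (z w : C) : R := (1 + pseudo_dist z w) / (1 - pseudo_dist z w).

Lemma ln2_pos : 0 < ln 2.
Proof. rewrite <- ln_1. apply ln_increasing; lra. Qed.

Lemma exp_le (x y : R) : x <= y -> exp x <= exp y.
Proof. intros [H| ->]; [left; apply exp_increasing; auto|right; auto]. Qed.

Lemma cross_identity (z w : C) :
  Cmod (1 - Cconj w * z) ^ 2 - Cmod (z - w) ^ 2 = defect z * defect w.
Proof. unfold defect. rewrite !Cmod_sqr. simpl. ring. Qed.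

Lemma cross_neq (z w : C) : in_disc z -> in_disc w -> (1 - Cconj w * z)%C <> 0.
Proof. unfold in_disc. intros. apply one_sub_neq. rewrite Cmod_conj; auto. lra. Qed.

Lemma cross_pos (z w : C) : in_disc z -> in_disc w -> 0 < Cmod (1 - Cconj w * z).
Proof. intros; apply Cmod_gt_0, cross_neq; auto. Qed.

Lemma cross_sym (z w : C) : Cmod (1 - Cconj w * z) = Cmod (1 - Cconj z * w).
Proof.
  rewrite <- Cmod_conj. f_equal. rewrite Cminus_conj, Cmult_conj, Cconj_conj.
  replace (Cconj 1) with (RtoC 1). ring. unfold Cconj, RtoC; simpl; f_equal; ring.
Qed.

Lemma pseudo_dist_eq (z w : C) : in_disc z -> in_disc w ->
  pseudo_dist z w = Cmod (z - w) / Cmod (1 - Cconj w * z).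
Proof. intros. apply Cmod_div, cross_neq; auto. Qed.

Lemma pseudo_dist_sym (z w : C) : in_disc z -> in_disc w -> pseudo_dist z w = pseudo_dist w z.
Proof.
  intros. rewrite !pseudo_dist_eq by auto. rewrite cross_sym. f_equal.
  rewrite <- Cmod_opp. f_equal. ring.
Qed.

Lemma pseudo_dist_ge_0 (z w : C) : 0 <= pseudo_dist z w.
Proof. apply Cmod_ge_0. Qed.

Lemma pseudo_dist_sqr (z w : C) : in_disc z -> in_disc w ->
  1 - pseudo_dist z w ^ 2 = defect z * defect w / Cmod (1 - Cconj w * z) ^ 2.
Proof.
  intros Hz Hw. rewrite pseudo_dist_eq by auto. rewrite <- cross_identity.
  pose proof (cross_pos z w Hz Hw). field. lra.
Qed.

Lemma pseudo_dist_lt_1 (z w : C) : in_disc z -> in_disc w -> pseudo_dist z w < 1.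
Proof.
  intros Hz Hw.
  assert (0 < 1 - pseudo_dist z w ^ 2).
  { rewrite pseudo_dist_sqr by auto. apply Rdiv_lt_0_compat.
    apply Rmult_lt_0_compat; apply defect_pos; auto.
    apply pow_lt, cross_pos; auto. }
  pose proof (pseudo_dist_ge_0 z w). nra.
Qed.

Lemma pseudo_dist_diag (z : C) : in_disc z -> pseudo_dist z z = 0.
Proof.
  intros. rewrite pseudo_dist_eq by auto. replace (z - z)%C with (RtoC 0) by ring.
  rewrite Cmod_0. unfold Rdiv; ring.
Qed.

Lemma hyp_exp_ge_1 (z w : C) : in_disc z -> in_disc w -> 1 <= hyp_exp z w.
Proof.
  intros Hz Hw. pose proof (pseudo_dist_lt_1 z w Hz Hw). pose proof (pseudo_dist_ge_0 z w).
  unfold hyp_exp. apply Rmult_le_reg_r with (1 - pseudo_dist z w); [lra|].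
  unfold Rdiv. rewrite Rmult_assoc, Rinv_l; lra.
Qed.

Lemma hyp_exp_pos (z w : C) : in_disc z -> in_disc w -> 0 < hyp_exp z w.
Proof. intros Hz Hw; pose proof (hyp_exp_ge_1 z w Hz Hw); lra. Qed.

Lemma hyp_exp_sym (z w : C) : in_disc z -> in_disc w -> hyp_exp z w = hyp_exp w z.
Proof. intros. unfold hyp_exp. rewrite pseudo_dist_sym; auto. Qed.

Lemma hyp_exp_diag (z : C) : in_disc z -> hyp_exp z z = 1.
Proof. intros. unfold hyp_exp. rewrite pseudo_dist_diag by auto. field. Qed.

(** Hence [hyp_exp z w] and [/ (1 - pseudo_dist z w ^ 2)] agree up to a factor between 1 and 4; the
    latter is explicit in the defects and carries the estimates. *)
Lemma hyp_exp_mul (z w : C) : in_disc z -> in_disc w ->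
  hyp_exp z w * (1 - pseudo_dist z w ^ 2) = (1 + pseudo_dist z w) ^ 2.
Proof.
  intros Hz Hw. pose proof (pseudo_dist_lt_1 z w Hz Hw). unfold hyp_exp. field. lra.
Qed.

Lemma hyp_exp_mul_le (z w : C) : in_disc z -> in_disc w ->
  hyp_exp z w * (1 - pseudo_dist z w ^ 2) <= 4.
Proof.
  intros Hz Hw. rewrite hyp_exp_mul by auto.
  pose proof (pseudo_dist_lt_1 z w Hz Hw). pose proof (pseudo_dist_ge_0 z w). nra.
Qed.

Lemma hyp_exp_mul_ge (z w : C) : in_disc z -> in_disc w ->
  1 <= hyp_exp z w * (1 - pseudo_dist z w ^ 2).
Proof.
  intros Hz Hw. rewrite hyp_exp_mul by auto. pose proof (pseudo_dist_ge_0 z w). nra.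
Qed.

Lemma hyp_dist_eq (z w : C) : hyp_dist z w = ln (hyp_exp z w) / ln 2.
Proof. reflexivity. Qed.

Lemma hyp_dist_ge_0 (z w : C) : in_disc z -> in_disc w -> 0 <= hyp_dist z w.
Proof.
  intros Hz Hw. rewrite hyp_dist_eq. pose proof ln2_pos.
  apply Rmult_le_pos. 2: left; apply Rinv_0_lt_compat; auto.
  rewrite <- ln_1. apply ln_le. lra. apply hyp_exp_ge_1; auto.
Qed.

Lemma Rpower2_hyp_dist (s : R) (z w : C) :
  Rpower 2 (s * hyp_dist z w) = Rpower (hyp_exp z w) s.
Proof.
  rewrite hyp_dist_eq. unfold Rpower. f_equal. pose proof ln2_pos. field. lra.
Qed.

Lemma hyp_dist_le_iff (z w : C) (x : R) : in_disc z -> in_disc w ->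
  hyp_dist z w <= x <-> hyp_exp z w <= Rpower 2 x.
Proof.
  intros Hz Hw. pose proof ln2_pos. pose proof (hyp_exp_pos z w Hz Hw).
  rewrite hyp_dist_eq. unfold Rpower. split; intros Hx.
  - rewrite <- (exp_ln (hyp_exp z w)) by auto. apply exp_le.
    apply Rmult_le_reg_r with (/ ln 2). apply Rinv_0_lt_compat; auto.
    rewrite Rmult_assoc, Rinv_r; lra.
  - apply Rmult_le_reg_r with (ln 2); auto.
    unfold Rdiv; rewrite Rmult_assoc, Rinv_l, Rmult_1_r by lra.
    rewrite <- (ln_exp (x * ln 2)). apply ln_le; auto.
Qed.

Lemma separated_pseudo_dist (z : nat -> C) : (forall n, in_disc (z n)) -> separated z ->
  exists d, 0 < d < 1 /\ forall n m, n <> m -> d <= pseudo_dist (z n) (z m).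
Proof.
  intros Hz Hs. unfold separated in Hs.
  set (E := fun b => exists n m : nat, n <> m /\ b = hyp_dist (z n) (z m)) in Hs.
  assert (Hb : exists b, 0 < b /\ forall x, E x -> b <= x).
  { pose proof (Glb_Rbar_correct E) as [H1 _].
    destruct (Glb_Rbar E) as [b| |]; simpl in Hs; try tauto.
    - exists b; split; [exact Hs|]. intros x Hx; exact (H1 x Hx).
    - exists 1; split; [lra|]. intros x Hx; specialize (H1 x Hx); simpl in H1; tauto. }
  destruct Hb as (b & Hb & HE).
  assert (H2 : 1 < Rpower 2 b).
  { rewrite <- (Rpower_O 2) by lra. apply Rpower_lt; lra. }
  (* The value of [pseudo_dist] at which [hyp_exp] equals [2 ^ b]. *)
  exists ((Rpower 2 b - 1) / (Rpower 2 b + 1)). split.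
  - split. apply Rdiv_lt_0_compat; lra.
    apply Rmult_lt_reg_r with (Rpower 2 b + 1). lra. unfold Rdiv.
    rewrite Rmult_assoc, Rinv_l; lra.
  - intros n m Hnm. assert (H : b <= hyp_dist (z n) (z m)) by (apply HE; exists n, m; auto).
    assert (H3 : Rpower 2 b <= hyp_exp (z n) (z m)).
    { replace (hyp_exp (z n) (z m)) with (Rpower 2 (1 * hyp_dist (z n) (z m))).
      apply Rle_Rpower; lra. rewrite Rpower2_hyp_dist. apply Rpower_1, hyp_exp_pos; auto. }
    unfold hyp_exp in H3. pose proof (pseudo_dist_lt_1 _ _ (Hz n) (Hz m)).
    set (r := pseudo_dist (z n) (z m)) in *.
    apply Rmult_le_reg_r with (Rpower 2 b + 1). lra. unfold Rdiv.
    rewrite Rmult_assoc, Rinv_l, Rmult_1_r by lra.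
    apply Rmult_le_compat_r with (r := 1 - r) in H3; [|lra].
    unfold Rdiv in H3. rewrite Rmult_assoc, Rinv_l in H3; lra.
Qed.

(** * The boundary profiles of the points *)

(** A rescaled Poisson kernel with values in [(0, 4]]: it is of order 1 on the arc of the circle
    under [a] and decays like the inverse square of the distance in units of [defect a]. *)
Definition profile (a : C) (t : R) : R := defect a * poisson a t.

Lemma Rpower_pos (x y : R) : 0 < Rpower x y.
Proof. apply exp_pos. Qed.

Lemma Rpower_ge_1 (x y : R) : 1 <= x -> 0 <= y -> 1 <= Rpower x y.
Proof. intros. rewrite <- (Rpower_O x) by lra. apply Rle_Rpower; lra. Qed.

Lemma Rpower_inv_base (x y : R) : 0 < x -> Rpower (/ x) y = / Rpower x y.
Proof. intros. unfold Rpower. rewrite ln_Rinv, <- exp_Ropp by auto. f_equal; ring. Qed.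

Lemma Rpower_div (x x' y : R) : 0 < x -> 0 < x' -> Rpower (x / x') y = Rpower x y / Rpower x' y.
Proof.
  intros. unfold Rdiv. rewrite <- Rpower_inv_base by auto.
  symmetry; apply Rpower_mult_distr; auto. apply Rinv_0_lt_compat; auto.
Qed.

Lemma div_le_of_mul (x y c : R) : 0 < y -> x <= c * y -> x / y <= c.
Proof.
  intros. apply Rmult_le_reg_r with y; auto. unfold Rdiv. rewrite Rmult_assoc, Rinv_l; lra.
Qed.

Lemma le_div_of_mul (x y c : R) : 0 < y -> c * y <= x -> c <= x / y.
Proof.
  intros. apply Rmult_le_reg_r with y; auto. unfold Rdiv. rewrite Rmult_assoc, Rinv_l; lra.
Qed.

Lemma profile_eq (a : C) (t : R) : profile a t = defect a ^ 2 / Cmod (cis t - a) ^ 2.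
Proof. unfold profile, poisson, Rdiv. ring. Qed.

Lemma profile_pos (a : C) (t : R) : in_disc a -> 0 < profile a t.
Proof. intros. apply Rmult_lt_0_compat. apply defect_pos; auto. apply poisson_pos; auto. Qed.

Lemma cont_profile (a : C) (t : R) : in_disc a -> continuous (profile a) t.
Proof. intros. apply cont_mult. apply cont_const. apply cont_poisson; auto. Qed.

Lemma circle_sub_ge (a : C) (t : R) : 1 - Cmod a <= Cmod (cis t - a).
Proof. rewrite <- (Cmod_cis t). apply Cmod_triangle_rev. Qed.

Lemma profile_le_4 (a : C) (t : R) : in_disc a -> profile a t <= 4.
Proof.
  intros H. rewrite profile_eq. pose proof (circle_sub_pos a t H).
  pose proof (circle_sub_ge a t). pose proof (defect_pos a H).
  apply div_le_of_mul. apply pow_lt; auto.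
  assert (defect a <= 2 * Cmod (cis t - a)).
  { unfold defect in *. red in H. pose proof (Cmod_ge_0 a). nra. }
  replace (4 * Cmod (cis t - a) ^ 2) with ((2 * Cmod (cis t - a)) ^ 2) by ring.
  apply pow_incr. lra.
Qed.

Lemma cross_le_circle (a b : C) (t : R) : in_disc b ->
  Cmod (1 - Cconj b * a) <= Cmod (cis t - a) + Cmod (cis t - b).
Proof.
  intros Hb.
  replace (1 - Cconj b * a)%C
    with (cis t * Cconj (cis t - b) + Cconj b * (cis t - a))%C.
  2:{ rewrite Cminus_conj. rewrite <- (circle_conj t). ring. }
  eapply Rle_trans; [apply Cmod_triangle|].
  rewrite !Cmod_mult, !Cmod_conj, Cmod_cis.
  pose proof (Cmod_ge_0 (cis t - a)). red in Hb. pose proof (Cmod_ge_0 b). nra.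
Qed.

(** The cross term is at most [|cis t - a| + |cis t - b|], so the way from [a] to [b] through the
    boundary point splits into one leg for each point; [|cis t - a| ^ 2] is
    [defect a ^ 2 / profile a t]. *)
Lemma hyp_exp_le_profile (a b : C) (t : R) : in_disc a -> in_disc b ->
  hyp_exp a b <= 8 * (defect a / (defect b * profile a t) + defect b / (defect a * profile b t)).
Proof.
  intros Ha Hb.
  pose proof (defect_pos a Ha) as Da. pose proof (defect_pos b Hb) as Db.
  pose proof (circle_sub_pos a t Ha) as Pa. pose proof (circle_sub_pos b t Hb) as Pb.
  pose proof (hyp_exp_mul_le a b Ha Hb) as H. rewrite pseudo_dist_sqr in H by auto.
  pose proof (cross_le_circle a b t Hb) as Hc. pose proof (cross_pos a b Ha Hb) as Pc.
  rewrite !profile_eq.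
  set (u := Cmod (cis t - a)) in *. set (v := Cmod (cis t - b)) in *.
  set (c := Cmod (1 - Cconj b * a)) in *.
  replace (8 * _) with (8 * (u ^ 2 + v ^ 2) / (defect a * defect b)) by (field; repeat split; lra).
  apply le_div_of_mul. apply Rmult_lt_0_compat; auto.
  apply Rmult_le_compat_r with (r := c ^ 2) in H; [|apply pow2_ge_0].
  replace (hyp_exp a b * (defect a * defect b / c ^ 2) * c ^ 2)
    with (hyp_exp a b * (defect a * defect b)) in H by (field; lra).
  assert (c ^ 2 <= (u + v) ^ 2) by (apply pow_incr; lra). pose proof (pow2_ge_0 (u - v)). nra.
Qed.

(** * Points selected at a boundary point *)

(* The selection rule at a boundary point prefers the point [a] with the largest [height e a].
   A point [a] is selected, up to a factor 2, against [b] in the lemmas below. *)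
Definition height (e : R) (a : C) (t : R) : R := Rpower (defect a) (- e) * profile a t.

Definition gap (a b : C) : R := Rmax (defect a / defect b) (defect b / defect a).

Lemma height_pos (e : R) (a : C) (t : R) : in_disc a -> 0 < height e a t.
Proof. intros. apply Rmult_lt_0_compat. apply Rpower_pos. apply profile_pos; auto. Qed.

Lemma height_cmp (e : R) (a b : C) (t : R) : in_disc a -> in_disc b ->
  height e b t <= 2 * height e a t ->
  profile b t * Rpower (defect a / defect b) e <= 2 * profile a t.
Proof.
  intros Ha Hb H. unfold height in H. rewrite !Rpower_Ropp in H.
  pose proof (defect_pos a Ha) as Da. pose proof (defect_pos b Hb) as Db.
  rewrite Rpower_div by auto.
  pose proof (Rpower_pos (defect a) e) as Pa. pose proof (Rpower_pos (defect b) e) as Pb.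
  set (A := Rpower (defect a) e) in *. set (B := Rpower (defect b) e) in *.
  apply Rmult_le_compat_r with (r := A) in H; [|lra].
  replace (2 * (/ A * profile a t) * A) with (2 * profile a t) in H by (field; lra).
  replace (profile b t * (A / B)) with (/ B * profile b t * A) by (field; lra). auto.
Qed.

Lemma gap_ge_1 (a b : C) : in_disc a -> in_disc b -> 1 <= gap a b.
Proof.
  intros Ha Hb. pose proof (defect_pos a Ha) as Da. pose proof (defect_pos b Hb) as Db.
  unfold gap. destruct (Rle_dec (defect a) (defect b)).
  - eapply Rle_trans; [|apply Rmax_r]. apply le_div_of_mul; lra.
  - eapply Rle_trans; [|apply Rmax_l]. apply le_div_of_mul; lra.
Qed.

Lemma gap_eq_l (a b : C) : in_disc a -> in_disc b -> defect b <= defect a ->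
  gap a b = defect a / defect b.
Proof.
  intros Ha Hb H. pose proof (defect_pos a Ha) as Da. pose proof (defect_pos b Hb) as Db.
  unfold gap. apply Rmax_left. transitivity 1.
  apply div_le_of_mul; lra. apply le_div_of_mul; lra.
Qed.

Lemma gap_eq_r (a b : C) : in_disc a -> in_disc b -> defect a <= defect b ->
  gap a b = defect b / defect a.
Proof.
  intros Ha Hb H. pose proof (defect_pos a Ha) as Da. pose proof (defect_pos b Hb) as Db.
  unfold gap. apply Rmax_right. transitivity 1.
  apply div_le_of_mul; lra. apply le_div_of_mul; lra.
Qed.

(** Selection gives [/ profile a t <= 2 * (defect a / defect b) ^ (- e) / profile b t]. As [e < 1],
    the leg of [a] is then at most [2 * gap a b / profile b t], whichever point is deeper; the
    constant is [8 * (2 + 1)]. *)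
Lemma hyp_exp_selected (e : R) (a b : C) (t : R) : 0 < e < 1 -> in_disc a -> in_disc b ->
  height e b t <= 2 * height e a t ->
  hyp_exp a b <= 24 * gap a b / profile b t.
Proof.
  intros He Ha Hb H. apply height_cmp in H; auto.
  pose proof (defect_pos a Ha) as Da. pose proof (defect_pos b Hb) as Db.
  pose proof (profile_pos a t Ha) as Xa. pose proof (profile_pos b t Hb) as Xb.
  pose proof (gap_ge_1 a b Ha Hb) as Hg.
  eapply Rle_trans; [apply (hyp_exp_le_profile a b t); auto|].
  enough (defect a / (defect b * profile a t) <= 2 * gap a b / profile b t /\
          defect b / (defect a * profile b t) <= gap a b / profile b t) as [E1 E2].
  { unfold Rdiv in *. nra. }
  split.
  - replace (defect a / (defect b * profile a t)) with ((defect a / defect b) / profile a t)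
      by (field; lra).
    apply div_le_of_mul; auto.
    replace (2 * gap a b / profile b t * profile a t)
      with (gap a b * (2 * profile a t / profile b t)) by (field; lra).
    apply Rle_trans with (gap a b * Rpower (defect a / defect b) e).
    + destruct (Rle_dec (defect b) (defect a)) as [L|L].
      * rewrite (gap_eq_l a b) by auto. set (T := defect a / defect b).
        assert (1 <= T) by (apply le_div_of_mul; lra).
        pose proof (Rpower_ge_1 T e). nra.
      * rewrite (gap_eq_r a b) by (auto; lra).
        set (T := defect b / defect a).
        assert (1 <= T) by (apply le_div_of_mul; lra).
        replace (defect a / defect b) with (/ T) by (unfold T; field; lra).
        rewrite Rpower_inv_base by lra.
        assert (Rpower T e <= T) by (rewrite <- (Rpower_1 T) at 2 by lra; apply Rle_Rpower; lra).
        pose proof (Rpower_pos T e).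
        transitivity 1.
        { rewrite <- Rinv_1. apply Rinv_le_contravar; lra. }
        apply le_div_of_mul; lra.
    + apply Rmult_le_compat_l; [lra|]. apply le_div_of_mul; auto. lra.
  - replace (defect b / (defect a * profile b t)) with ((defect b / defect a) / profile b t)
      by (field; lra).
    apply Rmult_le_compat_r. left; apply Rinv_0_lt_compat; auto. apply Rmax_r.
Qed.

(** Here the bias in [height] acts: a point [a] farther from the circle is handicapped by [gap ^ e]
    against [b], and since [profile a t <= 4] it can only be selected where [profile b t] is
    small. *)
Lemma gap_selected_above (e : R) (a b : C) (t : R) : 0 < e < 1 -> in_disc a -> in_disc b ->
  height e b t <= 2 * height e a t -> defect b <= defect a ->
  Rpower (gap a b) e <= 8 / profile b t.
Proof.
  intros He Ha Hb H L. apply height_cmp in H; auto.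
  pose proof (profile_le_4 a t Ha). pose proof (profile_pos b t Hb) as Xb.
  rewrite (gap_eq_l a b) by auto. apply le_div_of_mul; auto. lra.
Qed.

(** Since [T <= V ^ (/ e)], [x] is bounded by a fixed power of [V], and the small power [e0] brings
    the exponent under [q]. It is used with [q = / 4], where harmonic measure has a finite moment,
    and with [q = 1] for the basis functions. *)
Lemma Rpower_le_of_gap (x T V e e0 q : R) :
  0 < e -> 0 < e0 <= 1 -> e0 * (1 + / e) <= q -> 0 < x -> 0 < T -> 1 <= V ->
  x <= 24 * T * V -> Rpower T e <= V ->
  Rpower x e0 <= 24 * Rpower V q.
Proof.
  intros He He0 Hq Hx HT HV H1 H2.
  assert (HT2 : T <= Rpower V (/ e)).
  { rewrite <- (Rpower_1 T) by lra. replace 1 with (e * / e) by (field; lra).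
    rewrite <- Rpower_mult. apply Rle_Rpower_l. left; apply Rinv_0_lt_compat; auto.
    split; auto. apply Rpower_pos. }
  assert (HX : x <= 24 * Rpower V (1 + / e)).
  { rewrite Rpower_plus, Rpower_1 by lra. nra. }
  apply Rle_trans with (Rpower (24 * Rpower V (1 + / e)) e0).
  { apply Rle_Rpower_l; lra. }
  rewrite <- Rpower_mult_distr by (try lra; apply Rpower_pos).
  rewrite Rpower_mult.
  apply Rmult_le_compat; try (left; apply Rpower_pos).
  - rewrite <- (Rpower_1 24) at 2 by lra. apply Rle_Rpower; lra.
  - apply Rle_Rpower; lra.
Qed.

(** * Finite sums and products *)

Fixpoint bsum (f : nat -> R) (N : nat) : R :=
  match N with O => 0 | S n => bsum f n + f n end.

Fixpoint bprod (f : nat -> R) (N : nat) : R :=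
  match N with O => 1 | S n => bprod f n * f n end.

Lemma bsum_le f g N : (forall i, (i < N)%nat -> f i <= g i) -> bsum f N <= bsum g N.
Proof.
  induction N as [|N IH]; intros H; simpl; [lra|].
  apply Rplus_le_compat; auto.
Qed.

Lemma bsum_ext f g N : (forall i, (i < N)%nat -> f i = g i) -> bsum f N = bsum g N.
Proof.
  induction N as [|N IH]; intros H; simpl; auto. rewrite IH, H; auto.
Qed.

Lemma bsum_scal c f N : bsum (fun i => c * f i) N = c * bsum f N.
Proof. induction N as [|N IH]; simpl; [ring|]. rewrite IH; ring. Qed.

Lemma bsum_plus f g N : bsum (fun i => f i + g i) N = bsum f N + bsum g N.
Proof. induction N as [|N IH]; simpl; [ring|]. rewrite IH; ring. Qed.

Lemma bsum_ge_0 f N : (forall i, (i < N)%nat -> 0 <= f i) -> 0 <= bsum f N.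
Proof.
  induction N as [|N IH]; intros H; simpl; [lra|].
  pose proof (H N). assert (0 <= bsum f N) by auto. assert (0 <= f N) by auto. lra.
Qed.

Lemma bsum_ge_term f N k : (forall i, (i < N)%nat -> 0 <= f i) -> (k < N)%nat -> f k <= bsum f N.
Proof.
  induction N as [|N IH]; intros H Hk; simpl; [lia|].
  destruct (Nat.eq_dec k N) as [->|].
  - assert (0 <= bsum f N) by (apply bsum_ge_0; auto). lra.
  - assert (f k <= bsum f N) by (apply IH; auto; lia). assert (0 <= f N) by auto. lra.
Qed.

Lemma bsum_abs f N : Rabs (bsum f N) <= bsum (fun i => Rabs (f i)) N.
Proof.
  induction N as [|N IH]; simpl. rewrite Rabs_R0; lra.
  eapply Rle_trans; [apply Rabs_triang|]. lra.
Qed.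

Lemma bprod_pos f N : (forall i, (i < N)%nat -> 0 < f i) -> 0 < bprod f N.
Proof.
  induction N as [|N IH]; intros H; simpl; [lra|]. apply Rmult_lt_0_compat; auto.
Qed.

Lemma bprod_le f g N : (forall i, (i < N)%nat -> 0 <= f i <= g i) -> bprod f N <= bprod g N.
Proof.
  intros H. assert (0 <= bprod f N <= bprod g N); [|lra].
  induction N as [|N IH]; simpl; [lra|].
  destruct IH as [I1 I2]; auto. destruct (H N) as [J1 J2]; auto. split.
  apply Rmult_le_pos; auto. apply Rmult_le_compat; auto.
Qed.

Lemma bprod_mult f g N : bprod (fun i => f i * g i) N = bprod f N * bprod g N.
Proof. induction N as [|N IH]; simpl; [ring|]. rewrite IH; ring. Qed.

Lemma bprod_exp f N : bprod (fun i => exp (f i)) N = exp (bsum f N).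
Proof. induction N as [|N IH]; simpl. rewrite exp_0; auto. rewrite IH, exp_plus; auto. Qed.

Lemma bprod_ext f g N : (forall i, (i < N)%nat -> f i = g i) -> bprod f N = bprod g N.
Proof.
  induction N as [|N IH]; intros H; simpl; auto. rewrite IH, H; auto.
Qed.

Lemma cont_bsum {T : UniformSpace} (f : nat -> T -> R) N x :
  (forall i, (i < N)%nat -> continuous (f i) x) -> continuous (fun y => bsum (fun i => f i y) N) x.
Proof.
  induction N as [|N IH]; intros H; simpl. apply cont_const.
  apply cont_plus; auto.
Qed.

Lemma mean_bsum (f : nat -> R -> R) N :
  (forall i, (i < N)%nat -> forall t, continuous (f i) t) ->
  mean (fun t => bsum (fun i => f i t) N) = bsum (fun i => mean (f i)) N.
Proof.
  induction N as [|N IH]; intros H; simpl. apply mean_const.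
  rewrite mean_plus; auto. rewrite IH; auto.
  intros; apply cont_bsum; auto.
Qed.

Lemma bsum_geom_half (c : R) N : 0 <= c -> bsum (fun i => c * (/ 2) ^ i) N <= 2 * c.
Proof.
  intros Hc. rewrite (bsum_scal c (fun i => (/ 2) ^ i)).
  enough (bsum (fun i => (/ 2) ^ i) N = 2 - 2 * (/ 2) ^ N) as ->.
  { pose proof (pow_lt (/ 2) N). nra. }
  induction N as [|N IH]; simpl; [ring|]. rewrite IH. field.
Qed.

(** * A fractional moment of the harmonic measure *)

(** If [16 ^ i <= V < 16 ^ (i + 1)], the term of index [i] alone is at least [2 ^ (i + 1)], which
    exceeds the fourth root of [V]. The Poisson kernel is a multiple of [/ V], so times such a term
    it becomes a multiple of [/ (V + 16 ^ i)], whose mean is under control. *)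
Lemma quarter_power_sum (V : R) (I : nat) : 1 <= V < 16 ^ I ->
  Rpower V (/ 4) <= bsum (fun i => 2 ^ (i + 1) * (2 * V / (V + 16 ^ i))) I.
Proof.
  induction I as [|I IH]; intros [H1 H2]. simpl in H2; lra.
  simpl bsum. pose proof (pow_lt 16 I ltac:(lra)) as P16.
  pose proof (pow_lt 2 (I + 1) ltac:(lra)) as P2.
  assert (Hpos : forall i, 0 <= 2 ^ (i + 1) * (2 * V / (V + 16 ^ i))).
  { intros i. pose proof (pow_lt 16 i ltac:(lra)). pose proof (pow_lt 2 (i+1) ltac:(lra)).
    apply Rmult_le_pos; [lra|]. left; apply Rdiv_lt_0_compat; lra. }
  destruct (Rlt_dec V (16 ^ I)) as [L|L].
  - pose proof (IH (conj H1 L)). specialize (Hpos I). lra.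
  - assert (0 <= bsum (fun i => 2 ^ (i + 1) * (2 * V / (V + 16 ^ i))) I)
      by (apply bsum_ge_0; auto).
    assert (1 <= 2 * V / (V + 16 ^ I)) by (apply le_div_of_mul; lra).
    assert (Rpower V (/ 4) <= 2 ^ (I + 1)); [|nra].
    replace (2 ^ (I + 1)) with (Rpower (16 ^ S I) (/ 4)).
    { apply Rle_Rpower_l; lra. }
    rewrite Nat.add_1_r. rewrite <- !Rpower_pow by lra.
    replace 16 with (Rpower 2 4).
    2:{ replace 4 with (INR 4) by (simpl; ring). rewrite Rpower_pow by lra. ring. }
    rewrite !Rpower_mult. f_equal. field.
Qed.

Lemma pow16_unbounded (x : R) : exists I, x < 16 ^ I.
Proof.
  destruct (INR_unbounded x) as [n Hn]. exists n. apply Rlt_le_trans with (INR n); auto.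
  clear. induction n as [|n IH]. simpl; lra. rewrite S_INR. simpl.
  pose proof (pow_R1_Rle 16 n). lra.
Qed.

(** For [mu <= 1] the integrand is dominated by [2 / mu] times the Poisson kernel of the retracted
    point [(1 - mu) * z], which is displaced from [z] by at most [mu] and has defect at least [mu].
    For [mu > 1] the bound [/ mu ^ 2] suffices. *)
Lemma mean_regularized_kernel (z : C) (mu : R) : in_disc z -> 0 < mu ->
  mean (fun t => / (Cmod (cis t - z) ^ 2 + mu ^ 2)) <= 2 / mu.
Proof.
  intros Hz Hmu.
  assert (Hc : forall t, continuous (fun t => / (Cmod (cis t - z) ^ 2 + mu ^ 2)) t).
  { intros t. pose proof (circle_sub_pos z t Hz). apply cont_inv.
    - apply cont_plus; [|apply cont_const]. apply cont_sqmod, contC_minus.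
      apply contC_circle. apply contC_const.
    - nra. }
  destruct (Rle_dec mu 1) as [L|L].
  - set (w := (RtoC (1 - mu) * z)%C).
    assert (Hw1 : Cmod w = (1 - mu) * Cmod z).
    { unfold w. rewrite Cmod_mult, Cmod_R, Rabs_pos_eq; lra. }
    assert (Hw : in_disc w).
    { red. rewrite Hw1. red in Hz. pose proof (Cmod_ge_0 z). nra. }
    assert (Hd : mu <= defect w).
    { unfold defect. rewrite Hw1. red in Hz. pose proof (Cmod_ge_0 z).
      assert ((1 - mu) * Cmod z <= 1 - mu) by nra.
      assert (0 <= (1 - mu) * Cmod z) by nra. nra. }
    assert (Hp : forall t, continuous (fun t => 2 / mu * poisson w t) t).
    { intros; apply cont_mult. apply cont_const. apply cont_poisson; auto. }
    apply Rle_trans with (mean (fun t => 2 / mu * poisson w t)).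
    + apply mean_le; auto. intros t. unfold poisson.
      pose proof (circle_sub_pos z t Hz) as Pz. pose proof (circle_sub_pos w t Hw) as Pw.
      assert (Cmod (cis t - w) <= Cmod (cis t - z) + mu).
      { replace (cis t - w)%C with ((cis t - z) + RtoC mu * z)%C
          by (unfold w; rewrite RtoC_minus; ring).
        eapply Rle_trans; [apply Cmod_triangle|].
        rewrite Cmod_mult, Cmod_R, Rabs_pos_eq by lra. red in Hz. pose proof (Cmod_ge_0 z). nra. }
      assert (Cmod (cis t - w) ^ 2 <= (Cmod (cis t - z) + mu) ^ 2) by (apply pow_incr; lra).
      set (u := Cmod (cis t - z)) in *. set (v := Cmod (cis t - w)) in *.
      assert (v ^ 2 <= 2 * (u ^ 2 + mu ^ 2)) by (pose proof (pow2_ge_0 (u - mu)); nra).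
      assert (0 < v ^ 2) by (apply pow_lt; auto).
      apply Rle_trans with (2 / v ^ 2).
      * replace (2 / v ^ 2) with (/ (v ^ 2 / 2)) by (field; lra).
        apply Rinv_le_contravar; lra.
      * replace (2 / mu * (defect w / v ^ 2)) with ((2 * defect w / mu) / v ^ 2) by (field; lra).
        apply Rmult_le_compat_r. left; apply Rinv_0_lt_compat; auto.
        apply le_div_of_mul; lra.
    + rewrite mean_scal, mean_poisson by (auto; intros; apply cont_poisson; auto). lra.
  - apply Rle_trans with (mean (fun _ => / mu)).
    + apply mean_le; auto. intros; apply cont_const.
      intros t. apply Rinv_le_contravar; auto. pose proof (pow2_ge_0 (Cmod (cis t - z))). nra.
    + rewrite mean_const. unfold Rdiv. pose proof (Rinv_0_lt_compat mu Hmu). lra.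
Qed.

(** Eight times the squared distance from [cis t] to [z] in units of [defect z]; the 8 is that of
    [gap_selected_above]. *)
Definition deviation (z : C) (t : R) : R := 8 / profile z t.

Lemma cont_Rpower {T : UniformSpace} (f : T -> R) (q : R) x :
  continuous f x -> 0 < f x -> continuous (fun y => Rpower (f y) q) x.
Proof.
  intros Hf H. apply (cont_comp f (fun r => Rpower r q)); auto.
  apply (ex_derive_continuous (V := R_NormedModule)). unfold Rpower. auto_derive. auto.
Qed.

Lemma deviation_ge_1 (z : C) (t : R) : in_disc z -> 1 <= deviation z t.
Proof.
  intros Hz. pose proof (profile_le_4 z t Hz). pose proof (profile_pos z t Hz).
  apply le_div_of_mul; lra.
Qed.

(** The quarter power grows like the square root of the distance while the kernel decays like its
    inverse square, so the moment is bounded uniformly in [z]: the scale [4 ^ i * defect z]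
    contributes [32 / 2 ^ i]. *)
Lemma mean_deviation_quarter (z : C) : in_disc z ->
  mean (fun t => poisson z t * Rpower (deviation z t) (/ 4)) <= 64.
Proof.
  intros Hz. pose proof (defect_pos z Hz) as Dz.
  (* [deviation z t] is at most [8 * 2 ^ 2 / defect z ^ 2], so [I] scales cover the whole circle. *)
  destruct (pow16_unbounded (32 / defect z ^ 2)) as [I HI].
  set (k := fun i t => 2 ^ (i + 2) * defect z *
                       / (Cmod (cis t - z) ^ 2 + (defect z * 4 ^ i / 4) ^ 2)).
  assert (Hmu : forall i, 0 < defect z * 4 ^ i / 4).
  { intros i. pose proof (pow_lt 4 i ltac:(lra)). nra. }
  assert (Hker : forall i t, continuous
     (fun t => / (Cmod (cis t - z) ^ 2 + (defect z * 4 ^ i / 4) ^ 2)) t).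
  { intros i t. pose proof (circle_sub_pos z t Hz). apply cont_inv.
    - apply cont_plus; [|apply cont_const]. apply cont_sqmod, contC_minus.
      apply contC_circle. apply contC_const.
    - pose proof (pow2_ge_0 (defect z * 4 ^ i / 4)). nra. }
  assert (Hk : forall i t, continuous (k i) t).
  { intros i t. apply cont_mult; auto. apply cont_const. }
  apply Rle_trans with (mean (fun t => bsum (fun i => k i t) I)).
  - apply mean_le.
    + intros. apply cont_mult. apply cont_poisson; auto.
      pose proof (deviation_ge_1 z t Hz). pose proof (profile_pos z t Hz).
      apply cont_Rpower; [|lra]. apply cont_div. apply cont_const.
      apply cont_profile; auto. lra.
    + intros; apply cont_bsum; auto.
    + intros t. pose proof (deviation_ge_1 z t Hz) as HV.
      pose proof (circle_sub_pos z t Hz) as Pz. pose proof (poisson_pos z t Hz) as HP.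
      assert (EV : deviation z t = 8 * Cmod (cis t - z) ^ 2 / defect z ^ 2).
      { unfold deviation. rewrite profile_eq. field. lra. }
      assert (Cmod (cis t - z) <= 2).
      { eapply Rle_trans; [apply Cmod_triangle_minus|]. rewrite Cmod_cis. red in Hz. lra. }
      assert (HV2 : deviation z t < 16 ^ I).
      { eapply Rle_lt_trans; [|apply HI]. rewrite EV.
        apply Rmult_le_compat_r. left; apply Rinv_0_lt_compat, pow_lt; auto. nra. }
      eapply Rle_trans.
      { apply Rmult_le_compat_l; [lra|]. apply (quarter_power_sum _ I); auto. }
      rewrite <- bsum_scal. apply bsum_le. intros i _. unfold k.
      pose proof (pow_lt 4 i ltac:(lra)) as P4.
      assert (E16 : 16 ^ i = 4 ^ i * 4 ^ i).
      { rewrite <- Rpow_mult_distr. f_equal. ring. }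
      rewrite EV, E16. unfold poisson.
      set (u := Cmod (cis t - z)) in *. set (h := defect z) in *. set (q := 4 ^ i) in *.
      replace (2 ^ (i + 2)) with (2 * 2 ^ (i + 1)) by (rewrite !pow_add; simpl; ring).
      pose proof (pow_lt 2 (i + 1) ltac:(lra)) as P2.
      set (c := 2 ^ (i + 1)) in *.
      replace (h / u ^ 2 * (c * (2 * (8 * u ^ 2 / h ^ 2) / (8 * u ^ 2 / h ^ 2 + q * q))))
        with (2 * c * h * / (u ^ 2 + (h * q) ^ 2 / 8)).
      2:{ field. repeat split; nra. }
      apply Rmult_le_compat_l. nra. apply Rinv_le_contravar; nra.
  - rewrite mean_bsum by auto.
    apply Rle_trans with (bsum (fun i => 32 * (/ 2) ^ i) I); [|pose proof (bsum_geom_half 32 I); lra].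
    apply bsum_le. intros i _. unfold k. rewrite mean_scal by auto.
    pose proof (mean_regularized_kernel z _ Hz (Hmu i)) as Hm.
    pose proof (pow_lt 4 i ltac:(lra)) as P4. pose proof (pow_lt 2 i ltac:(lra)) as P2.
    apply Rmult_le_compat_l with (r := 2 ^ (i + 2) * defect z) in Hm.
    2:{ rewrite pow_add. simpl. nra. }
    eapply Rle_trans; [apply Hm|]. right.
    rewrite pow_add, pow_inv.
    replace (4 ^ i) with (2 ^ i * 2 ^ i) by (rewrite <- Rpow_mult_distr; f_equal; ring).
    simpl. field. split; lra.
Qed.

(** * Summability from the density condition *)

Definition ind (x y : R) : R := if Rle_dec x y then 1 else 0.

Lemma ind_ge_0 (x y : R) : 0 <= ind x y.
Proof. unfold ind; destruct (Rle_dec x y); lra. Qed.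

Lemma bsum_swap (f : nat -> nat -> R) N L :
  bsum (fun i => bsum (f i) L) N = bsum (fun l => bsum (fun i => f i l) N) L.
Proof.
  induction N as [|N IH]; simpl.
  - induction L as [|L IHL]; simpl; auto. rewrite <- IHL; ring.
  - rewrite IH, <- bsum_plus. reflexivity.
Qed.

Lemma bsum_geom (r : R) N : 0 <= r < 1 -> bsum (fun i => r ^ i) N <= / (1 - r).
Proof.
  intros Hr. apply Rmult_le_reg_r with (1 - r); [lra|]. rewrite Rinv_l by lra.
  enough (bsum (fun i => r ^ i) N * (1 - r) = 1 - r ^ N) as ->.
  { pose proof (pow_le r N). lra. }
  induction N as [|N IH]; simpl; [ring|]. rewrite Rmult_plus_distr_r, IH. ring.
Qed.

Lemma bsum_ind_count (x : nat -> R) (y : R) N :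
  bsum (fun i => ind (x i) y) N =
  INR (length (filter (fun i => if Rle_dec (x i) y then true else false) (seq 0 N))).
Proof.
  induction N as [|N IH]; simpl bsum; auto.
  rewrite seq_S, filter_app, length_app, plus_INR, <- IH. f_equal. simpl.
  unfold ind. destruct (Rle_dec (x N) y); simpl; auto.
Qed.

(** The first positive integer that is at least [x] exceeds it by at most 1, which costs the factor
    [Rpower 2 s]. Layers start at 1 because the counting condition does. *)
Lemma exp_decay_layers (s x : R) (L : nat) : 0 < s -> 0 <= x <= INR (S L) ->
  Rpower 2 (- s * x) <= Rpower 2 s *
    bsum (fun l => Rpower 2 (- s * INR (S l)) * ind x (INR (S l))) (S L).
Proof.
  intros Hs. induction L as [|L IH]; intros [H1 H2].
  - simpl bsum. unfold ind. change (INR 1) with 1 in *.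
    destruct (Rle_dec x 1); [|lra].
    rewrite Rplus_0_l, Rmult_1_r, <- Rpower_plus. apply Rle_Rpower; nra.
  - change (bsum ?f (S (S L))) with (bsum f (S L) + f (S L)).
    pose proof (Rpower_pos 2 s) as P.
    destruct (Rle_dec x (INR (S L))) as [L1|L1].
    + eapply Rle_trans; [apply IH; auto|]. apply Rmult_le_compat_l; [lra|].
      pose proof (Rpower_pos 2 (- s * INR (S (S L)))).
      pose proof (ind_ge_0 x (INR (S (S L)))). nra.
    + assert (0 <= bsum (fun l => Rpower 2 (- s * INR (S l)) * ind x (INR (S l))) (S L)).
      { apply bsum_ge_0. intros. apply Rmult_le_pos. left; apply Rpower_pos. apply ind_ge_0. }
      assert (Rpower 2 (- s * x) <= Rpower 2 s *
        (Rpower 2 (- s * INR (S (S L))) * ind x (INR (S (S L))))); [|nra].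
      unfold ind. destruct (Rle_dec x (INR (S (S L)))); [|lra].
      rewrite Rmult_1_r, <- Rpower_plus. apply Rle_Rpower; [lra|].
      rewrite (S_INR (S L)). nra.
Qed.

(** Layer [l] contributes a multiple of [2 ^ ((al - s) * l)], a geometric series. The injective
    reindexing [sg] and the arbitrary [N] make the bound independent of the order and of the number
    of points, which are later sorted by depth. *)
Lemma decay_of_density (z : nat -> C) (M al s : R) :
  (forall n, in_disc (z n)) -> (forall n m, z n = z m -> n = m) -> 0 < M -> 0 < al < s ->
  (forall n l : nat, (1 <= l)%nat ->
      card_le (fun p : C => exists j : nat, p = z j /\ hyp_dist (z j) (z n) <= INR l)
              (M * Rpower 2 (al * INR l))) ->
  exists C0, 0 < C0 /\ forall (sg : nat -> nat) N k,
    (forall i j, (i < N)%nat -> (j < N)%nat -> sg i = sg j -> i = j) ->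
    bsum (fun i => Rpower (hyp_exp (z (sg i)) (z k)) (- s)) N <= C0.
Proof.
  intros Hz Hinj HM Hal Hd.
  set (r := Rpower 2 (al - s)).
  assert (Hr : 0 <= r < 1).
  { split. left; apply Rpower_pos. rewrite <- (Rpower_O 2) by lra. apply Rpower_lt; lra. }
  exists (Rpower 2 s * (M * / (1 - r))). split.
  { apply Rmult_lt_0_compat. apply Rpower_pos. apply Rmult_lt_0_compat; auto.
    apply Rinv_0_lt_compat; lra. }
  intros sg N k Hsg.
  assert (HL : exists L, forall i, (i < N)%nat -> hyp_dist (z (sg i)) (z k) <= INR (S L)).
  { clear Hsg. induction N as [|N [L IH]]. exists O; intros; lia.
    destruct (INR_unbounded (hyp_dist (z (sg N)) (z k))) as [n Hn].
    exists (L + n)%nat. intros i Hi. rewrite S_INR, plus_INR.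
    pose proof (pos_INR n). pose proof (pos_INR L).
    destruct (Nat.eq_dec i N) as [->|]. lra.
    specialize (IH i). rewrite S_INR in IH. apply Rle_trans with (INR L + 1); [apply IH; lia|lra]. }
  destruct HL as [L HL].
  eapply Rle_trans.
  { apply (bsum_le _ (fun i => Rpower 2 s *
     bsum (fun l => Rpower 2 (- s * INR (S l)) * ind (hyp_dist (z (sg i)) (z k)) (INR (S l))) (S L))).
    intros i Hi. rewrite <- Rpower2_hyp_dist. apply exp_decay_layers. lra.
    split; auto. apply hyp_dist_ge_0; auto. }
  rewrite bsum_scal. apply Rmult_le_compat_l. left; apply Rpower_pos.
  rewrite bsum_swap.
  eapply Rle_trans; [|apply Rmult_le_compat_l; [lra|apply (bsum_geom r (S L)); auto]].
  rewrite <- bsum_scal. apply bsum_le. intros l _.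
  rewrite bsum_scal, bsum_ind_count.
  destruct (Hd k (S l) ltac:(lia)) as (lst & Hnd & Hin & Hlen).
  set (fl := filter _ _).
  (* [card_le] counts points of the plane; injectivity of [z] and of [sg] turns distinct indices
     into distinct points. *)
  assert (Hle : (length fl <= length lst)%nat).
  { rewrite <- (length_map (fun i => z (sg i)) fl). apply NoDup_incl_length.
    - assert (Hfl : NoDup fl) by (apply NoDup_filter, seq_NoDup).
      assert (Hb : forall i, In i fl -> (i < N)%nat).
      { intros i Hi. apply filter_In in Hi. destruct Hi as [Hi _]. apply in_seq in Hi. lia. }
      clear Hin Hlen. induction fl as [|i fl IH]; simpl; constructor.
      + inversion Hfl; subst. rewrite in_map_iff. intros (j & E & Hj).
        apply Hinj in E. apply Hsg in E; try (apply Hb; simpl; auto). subst; auto.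
      + inversion Hfl; subst. apply IH; auto. intros; apply Hb; simpl; auto.
    - intros p Hp. apply in_map_iff in Hp. destruct Hp as (i & <- & Hi).
      apply filter_In in Hi. destruct Hi as [_ Hi]. apply Hin. exists (sg i). split; auto.
      destruct (Rle_dec _ _); auto; discriminate. }
  apply le_INR in Hle.
  apply Rle_trans with (Rpower 2 (- s * INR (S l)) * (M * Rpower 2 (al * INR (S l)))).
  { apply Rmult_le_compat_l. left; apply Rpower_pos. lra. }
  replace (Rpower 2 (- s * INR (S l)) * (M * Rpower 2 (al * INR (S l))))
    with (M * (Rpower 2 (- s * INR (S l)) * Rpower 2 (al * INR (S l)))) by ring.
  rewrite <- Rpower_plus. apply Rmult_le_compat_l; [lra|].
  rewrite <- (Rpower_pow l) by apply Rpower_pos. unfold r. rewrite Rpower_mult.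
  apply Rle_Rpower; [lra|]. rewrite S_INR. nra.
Qed.

(** * Approximation of the data by a positive boundary function *)

Fixpoint bmax (f : nat -> R) (n : nat) : R :=
  match n with O => 0 | S n => Rmax (bmax f n) (f n) end.

Lemma bmax_ge (f : nat -> R) n i : (i < n)%nat -> f i <= bmax f n.
Proof.
  induction n as [|n IH]; intros Hi; [lia|]. simpl.
  destruct (Nat.eq_dec i n) as [->|]; [apply Rmax_r|].
  eapply Rle_trans; [apply IH; lia|apply Rmax_l].
Qed.

Lemma bmax_attained (f : nat -> R) n : (forall i, 0 < f i) -> (0 < n)%nat ->
  exists i, (i < n)%nat /\ bmax f n = f i.
Proof.
  intros Hf. induction n as [|n IH]; intros Hn; [lia|]. simpl.
  destruct (Nat.eq_dec n 0) as [->|Hn0].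
  - exists O. split; auto. simpl. apply Rmax_right. specialize (Hf O); lra.
  - destruct IH as (i & Hi & E); [lia|].
    destruct (Rle_dec (bmax f n) (f n)).
    + exists n. split; auto. apply Rmax_right; auto.
    + exists i. split; auto. rewrite <- E. apply Rmax_left; lra.
Qed.

Section Selection.

Variables (z : nat -> C) (N : nat) (e : R).
Hypothesis z_disc : forall i, in_disc (z i).
Hypothesis N_pos : (0 < N)%nat.

Definition top (t : R) : R := bmax (fun i => height e (z i) t) N.
(** Positive exactly where twice the height of [z n] exceeds the maximal one. The tolerance 2
    replaces the discontinuous choice of a maximizer by continuous weights. *)
Definition sel (n : nat) (t : R) : R := Rmax 0 (2 * height e (z n) t - top t).
Definition wt (n : nat) (t : R) : R := sel n t / bsum (fun i => sel i t) N.

Lemma sel_ge_0 n t : 0 <= sel n t.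
Proof. apply Rmax_l. Qed.

Lemma sel_sum_pos t : 0 < bsum (fun i => sel i t) N.
Proof.
  destruct (bmax_attained (fun i => height e (z i) t) N) as (i & Hi & E); auto.
  { intros; apply height_pos; auto. }
  apply Rlt_le_trans with (sel i t).
  - unfold sel, top. rewrite E. eapply Rlt_le_trans; [|apply Rmax_r].
    pose proof (height_pos e (z i) t (z_disc i)). lra.
  - apply (bsum_ge_term (fun i => sel i t)); auto. intros; apply sel_ge_0.
Qed.

Lemma cont_height n t : continuous (height e (z n)) t.
Proof. apply cont_mult. apply cont_const. apply cont_profile; auto. Qed.

Lemma cont_top t : continuous top t.
Proof.
  unfold top. clear N_pos. induction N as [|m IH]; simpl. apply cont_const.
  apply cont_max. apply IH. apply cont_height.
Qed.

Lemma cont_sel n t : continuous (sel n) t.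
Proof.
  apply (cont_max (fun _ => 0) (fun t => 2 * height e (z n) t - top t)).
  apply cont_const. apply cont_minus. apply cont_mult. apply cont_const. apply cont_height.
  apply cont_top.
Qed.

Lemma cont_wt n t : continuous (wt n) t.
Proof.
  apply cont_div. apply cont_sel. apply (cont_bsum sel). intros; apply cont_sel.
  pose proof (sel_sum_pos t). lra.
Qed.

Lemma wt_ge_0 n t : 0 <= wt n t.
Proof.
  unfold wt. apply Rmult_le_pos. apply sel_ge_0.
  left; apply Rinv_0_lt_compat, sel_sum_pos.
Qed.

Lemma wt_sum t : bsum (fun n => wt n t) N = 1.
Proof.
  unfold wt. pose proof (sel_sum_pos t).
  rewrite (bsum_ext _ (fun n => / bsum (fun i => sel i t) N * sel n t)).
  2:{ intros; unfold Rdiv; ring. }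
  rewrite bsum_scal. apply Rinv_l. lra.
Qed.

Lemma wt_le_1 n t : (n < N)%nat -> wt n t <= 1.
Proof.
  intros Hn. rewrite <- (wt_sum t). apply (bsum_ge_term (fun n => wt n t)); auto.
  intros; apply wt_ge_0.
Qed.

Lemma wt_selected n t m : 0 < wt n t -> (m < N)%nat ->
  height e (z m) t <= 2 * height e (z n) t.
Proof.
  intros Hw Hm.
  assert (Hs : 0 < sel n t).
  { destruct (sel_ge_0 n t) as [|E]; auto. unfold wt in Hw. rewrite <- E in Hw.
    unfold Rdiv in Hw. lra. }
  pose proof (bmax_ge (fun i => height e (z i) t) N m Hm) as H. fold (top t) in H.
  cbv beta in H.
  unfold sel, Rmax in Hs. destruct (Rle_dec _ _); lra.
Qed.

Variables (s0 e0 C0 : R).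
Hypothesis e_range : 0 < e < 1.
Hypothesis e0_pos : 0 < e0 <= 1.
Hypothesis e0_quarter : e0 * (1 + / e) <= / 4.
Hypothesis e0_decay : e0 + s0 <= 1 - 2 * e.
Hypothesis decay : forall k, (k < N)%nat ->
  bsum (fun m => Rpower (hyp_exp (z m) (z k)) (- s0)) N <= C0.

(** The troublesome case is [gap ^ e > deviation]. There selection forces [z n] to be the deeper
    point with [hyp_exp <= 3 * gap ^ (1 + e)], where [3 = 24 / 8], and also gives [poisson (z k) t
    <= 2 * gap ^ e * profile (z n) t / defect (z k)]. The coefficient records this bound, whose mean
    can be summed over [n]. *)
Definition bad_coef (k n : nat) : R :=
  if Rle_dec (hyp_exp (z n) (z k)) (3 * Rpower (gap (z n) (z k)) (1 + e)) then
    if Rle_dec (defect (z n)) (defect (z k)) then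
      2 * Rpower (hyp_exp (z n) (z k)) e0 * Rpower (gap (z n) (z k)) e / defect (z k)
    else 0
  else 0.

Lemma bad_coef_ge_0 k n : 0 <= bad_coef k n.
Proof.
  unfold bad_coef. repeat destruct (Rle_dec _ _); try lra.
  pose proof (defect_pos (z k) (z_disc k)).
  pose proof (Rpower_pos (hyp_exp (z n) (z k)) e0). pose proof (Rpower_pos (gap (z n) (z k)) e).
  left. apply Rdiv_lt_0_compat; auto. nra.
Qed.

(* Either the boundary point is far from [z k], or [z n] lies so much closer to the circle
   that its selection is exceptional. *)
Lemma wt_moment_pointwise k n t : (k < N)%nat -> (n < N)%nat ->
  poisson (z k) t * (wt n t * Rpower (hyp_exp (z n) (z k)) e0) <=
  24 * (poisson (z k) t * Rpower (deviation (z k) t) (/ 4)) * wt n t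
  + bad_coef k n * profile (z n) t.
Proof.
  intros Hk Hn.
  pose proof (poisson_pos (z k) t (z_disc k)) as HP.
  pose proof (profile_pos (z k) t (z_disc k)) as HXk.
  pose proof (profile_pos (z n) t (z_disc n)) as HXn.
  pose proof (bad_coef_ge_0 k n) as HB.
  pose proof (Rpower_pos (hyp_exp (z n) (z k)) e0) as HH.
  pose proof (Rpower_pos (deviation (z k) t) (/ 4)) as HV.
  pose proof (wt_ge_0 n t) as [Hw|Hw].
  2:{ rewrite <- Hw. rewrite Rmult_0_l, !Rmult_0_r, Rplus_0_l. apply Rmult_le_pos; lra. }
  pose proof (wt_selected n t k Hw Hk) as Hsel.
  pose proof (hyp_exp_selected e (z n) (z k) t e_range (z_disc n) (z_disc k) Hsel) as H1.
  pose proof (gap_ge_1 (z n) (z k) (z_disc n) (z_disc k)) as Hg.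
  pose proof (deviation_ge_1 (z k) t (z_disc k)) as HV1.
  pose proof (hyp_exp_pos (z n) (z k) (z_disc n) (z_disc k)) as HHp.
  destruct (Rle_dec (Rpower (gap (z n) (z k)) e) (deviation (z k) t)) as [L|L].
  - assert (Rpower (hyp_exp (z n) (z k)) e0 <= 24 * Rpower (deviation (z k) t) (/ 4)).
    { apply (Rpower_le_of_gap _ (gap (z n) (z k)) _ e); auto; try lra.
      eapply Rle_trans; [apply H1|].
      replace (24 * gap (z n) (z k) / profile (z k) t)
        with (24 * gap (z n) (z k) * / profile (z k) t) by (unfold Rdiv; ring).
      apply Rmult_le_compat_l. lra. unfold deviation.
      unfold Rdiv. pose proof (Rinv_0_lt_compat _ HXk). lra. }
    assert (0 <= bad_coef k n * profile (z n) t) by (apply Rmult_le_pos; lra).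
    assert (poisson (z k) t * wt n t * Rpower (hyp_exp (z n) (z k)) e0 <=
      poisson (z k) t * wt n t * (24 * Rpower (deviation (z k) t) (/ 4))).
    { apply Rmult_le_compat_l; auto. apply Rmult_le_pos; lra. }
    nra.
  - assert (Hlow : defect (z n) <= defect (z k)).
    { destruct (Rle_dec (defect (z n)) (defect (z k))); auto. exfalso. apply L.
      apply gap_selected_above; auto. lra. }
    apply Rnot_le_lt in L.
    assert (Hbad : hyp_exp (z n) (z k) <= 3 * Rpower (gap (z n) (z k)) (1 + e)).
    { eapply Rle_trans; [apply H1|]. rewrite Rpower_plus, Rpower_1 by lra.
      unfold deviation in L.
      replace (24 * gap (z n) (z k) / profile (z k) t)
        with (3 * gap (z n) (z k) * (8 / profile (z k) t)) by (unfold Rdiv; ring).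
      nra. }
    assert (EB : bad_coef k n =
      2 * Rpower (hyp_exp (z n) (z k)) e0 * Rpower (gap (z n) (z k)) e / defect (z k)).
    { unfold bad_coef. destruct (Rle_dec _ _); [|lra]. destruct (Rle_dec _ _); lra. }
    assert (0 <= 24 * (poisson (z k) t * Rpower (deviation (z k) t) (/ 4)) * wt n t).
    { apply Rmult_le_pos; [|lra]. apply Rmult_le_pos; [lra|]. apply Rmult_le_pos; lra. }
    rewrite EB.
    enough (poisson (z k) t * wt n t <=
      2 * Rpower (gap (z n) (z k)) e / defect (z k) * profile (z n) t).
    { apply Rmult_le_compat_r with (r := Rpower (hyp_exp (z n) (z k)) e0) in H0; [|lra].
      unfold Rdiv in *. nra. }
    apply Rle_trans with (poisson (z k) t).
    { pose proof (wt_le_1 n t Hn). nra. }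
    apply height_cmp in Hsel; auto.
    rewrite gap_eq_r by auto.
    pose proof (defect_pos (z k) (z_disc k)) as Dk. pose proof (defect_pos (z n) (z_disc n)) as Dn.
    replace (defect (z n) / defect (z k)) with (/ (defect (z k) / defect (z n))) in Hsel
      by (field; lra).
    rewrite Rpower_inv_base in Hsel by (apply Rdiv_lt_0_compat; auto).
    set (Te := Rpower (defect (z k) / defect (z n)) e) in *.
    assert (0 < Te) by apply Rpower_pos.
    apply Rmult_le_compat_r with (r := Te) in Hsel; [|lra].
    rewrite Rmult_assoc, Rinv_l, Rmult_1_r in Hsel by lra.
    unfold profile in Hsel at 1.
    apply Rmult_le_reg_l with (defect (z k)); auto.
    replace (defect (z k) * (2 * Te / defect (z k) * profile (z n) t))
      with (2 * profile (z n) t * Te) by (field; lra). auto.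
Qed.

(** Inverting [hyp_exp <= 3 * gap ^ (1 + e)] bounds [gap ^ (e - 1)] by 3 times the power of
    [hyp_exp] with exponent [- (1 - e) / (1 + e)], and [(1 - e) / (1 + e) >= 1 - 2 * e]. The
    condition [e0 + s0 <= 1 - 2 * e] then leaves the summable exponent [- s0]. *)
Lemma bad_coef_bound k n : bad_coef k n * defect (z n) <= 6 * Rpower (hyp_exp (z n) (z k)) (- s0).
Proof.
  pose proof (Rpower_pos (hyp_exp (z n) (z k)) (- s0)) as Hs.
  pose proof (defect_pos (z k) (z_disc k)) as Dk. pose proof (defect_pos (z n) (z_disc n)) as Dn.
  unfold bad_coef. destruct (Rle_dec _ _) as [L1|]; [|lra].
  destruct (Rle_dec _ _) as [L2|]; [|lra].
  pose proof (gap_ge_1 (z n) (z k) (z_disc n) (z_disc k)) as Hg.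
  pose proof (hyp_exp_ge_1 (z n) (z k) (z_disc n) (z_disc k)) as HH.
  set (x := hyp_exp (z n) (z k)) in *.
  assert (E : 2 * Rpower x e0 * Rpower (gap (z n) (z k)) e / defect (z k) * defect (z n)
     = 2 * Rpower x e0 * Rpower (gap (z n) (z k)) (e - 1)).
  { unfold Rminus. rewrite Rpower_plus, Rpower_Ropp, Rpower_1 by lra.
    rewrite (gap_eq_r (z n) (z k)) at 3 by auto. field. lra. }
  rewrite E. set (T := gap (z n) (z k)) in *.
  assert (HT : Rpower T (e - 1) <= 3 * Rpower x (- (1 - 2 * e))).
  { replace (e - 1) with (- (1 - e)) by ring. rewrite !Rpower_Ropp.
    assert (Hx : Rpower x (1 - 2 * e) <= 3 * Rpower T (1 - e)).
    { apply Rle_trans with (Rpower x ((1 - e) / (1 + e))).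
      { apply Rle_Rpower; auto. apply le_div_of_mul; nra. }
      apply Rle_trans with (Rpower (3 * Rpower T (1 + e)) ((1 - e) / (1 + e))).
      { apply Rle_Rpower_l. left; apply Rdiv_lt_0_compat; lra. lra. }
      rewrite <- Rpower_mult_distr, Rpower_mult by (try lra; apply Rpower_pos).
      replace ((1 + e) * ((1 - e) / (1 + e))) with (1 - e) by (field; lra).
      apply Rmult_le_compat_r. left; apply Rpower_pos.
      rewrite <- (Rpower_1 3) at 2 by lra. apply Rle_Rpower; [lra|]. apply div_le_of_mul; lra. }
    pose proof (Rpower_pos x (1 - 2 * e)). pose proof (Rpower_pos T (1 - e)).
    replace (3 * / Rpower x (1 - 2 * e)) with (3 / Rpower x (1 - 2 * e)) by (unfold Rdiv; ring).
    apply le_div_of_mul; auto.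
    apply Rmult_le_reg_l with (Rpower T (1 - e)); auto.
    rewrite <- Rmult_assoc, Rinv_r; lra. }
  apply Rle_trans with (2 * Rpower x e0 * (3 * Rpower x (- (1 - 2 * e)))).
  { apply Rmult_le_compat_l; auto. pose proof (Rpower_pos x e0). lra. }
  replace (2 * Rpower x e0 * (3 * Rpower x (- (1 - 2 * e))))
    with (6 * (Rpower x e0 * Rpower x (- (1 - 2 * e)))) by ring.
  rewrite <- Rpower_plus. apply Rmult_le_compat_l; [lra|]. apply Rle_Rpower; lra.
Qed.

Lemma cont_poisson_deviation k t :
  continuous (fun t => poisson (z k) t * Rpower (deviation (z k) t) (/ 4)) t.
Proof.
  pose proof (deviation_ge_1 (z k) t (z_disc k)). pose proof (profile_pos (z k) t (z_disc k)).
  apply cont_mult. apply cont_poisson; apply z_disc.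
  apply cont_Rpower; [|lra]. apply cont_div. apply cont_const.
  apply cont_profile; auto. lra.
Qed.

(** Seen from [z k], the selected point has a bounded small exponential moment of its distance; this
    is what makes the averaged data close to [w k]. The regular part gives [24 * 64]; in the
    exceptional part the mean of [profile (z n)] is [defect (z n)]. *)
Lemma wt_moment k : (k < N)%nat ->
  mean (fun t => poisson (z k) t *
    bsum (fun n => wt n t * Rpower (hyp_exp (z n) (z k)) e0) N) <= 1536 + 6 * C0.
Proof.
  intros Hk.
  assert (Hc1 : forall t, continuous (fun t => 24 *
     (poisson (z k) t * Rpower (deviation (z k) t) (/ 4))) t).
  { intros. apply cont_mult. apply cont_const. apply cont_poisson_deviation. }
  assert (Hc2 : forall n t, continuous (fun t => bad_coef k n * profile (z n) t) t).
  { intros. apply cont_mult. apply cont_const. apply cont_profile; auto. }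
  assert (Hc3 : forall t, continuous
     (fun t => bsum (fun n => bad_coef k n * profile (z n) t) N) t).
  { intros. apply (cont_bsum (fun n t => bad_coef k n * profile (z n) t)). intros; apply Hc2. }
  apply Rle_trans with (mean (fun t => 24 * (poisson (z k) t * Rpower (deviation (z k) t) (/ 4))
     + bsum (fun n => bad_coef k n * profile (z n) t) N)).
  - apply mean_le.
    + intros. apply cont_mult. apply cont_poisson; apply z_disc.
      apply (cont_bsum (fun n t => wt n t * Rpower (hyp_exp (z n) (z k)) e0)).
      intros. apply cont_mult. apply cont_wt. apply cont_const.
    + intros. apply cont_plus; auto.
    + intros t. rewrite <- bsum_scal.
      eapply Rle_trans.
      { apply bsum_le. intros n Hn. apply wt_moment_pointwise; auto. }
      rewrite bsum_plus, bsum_scal, wt_sum. lra.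
  - rewrite mean_plus, mean_scal by (auto; intros; apply cont_poisson_deviation).
    rewrite mean_bsum by auto.
    pose proof (mean_deviation_quarter (z k) (z_disc k)).
    enough (bsum (fun i => mean (fun t => bad_coef k i * profile (z i) t)) N <= 6 * C0) by lra.
    apply Rle_trans with (6 * bsum (fun m => Rpower (hyp_exp (z m) (z k)) (- s0)) N).
    2:{ apply Rmult_le_compat_l; [lra|]. apply decay; auto. }
    rewrite <- bsum_scal. apply bsum_le. intros n Hn.
    rewrite mean_scal by (intros; apply cont_profile; auto).
    unfold profile at 1. rewrite mean_scal by (intros; apply cont_poisson; apply z_disc).
    change (mean (fun t => poisson (z n) t)) with (mean (poisson (z n))).
    rewrite mean_poisson by apply z_disc. rewrite Rmult_1_r.
    apply bad_coef_bound.
Qed.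

End Selection.

(** * Interpolating basis functions *)

Fixpoint cprod (f : nat -> C) (N : nat) : C :=
  match N with O => RtoC 1 | S n => (cprod f n * f n)%C end.

Lemma Cmod_cprod (f : nat -> C) N : Cmod (cprod f N) = bprod (fun i => Cmod (f i)) N.
Proof. induction N as [|N IH]; simpl. apply Cmod_1. rewrite Cmod_mult, IH; auto. Qed.

Lemma cprod_one (f : nat -> C) N : (forall i, (i < N)%nat -> f i = 1) -> cprod f N = 1.
Proof.
  induction N as [|N IH]; intros H; simpl; auto. rewrite IH, H; auto. ring.
Qed.

Lemma cprod_zero (f : nat -> C) N k : (k < N)%nat -> f k = 0 -> cprod f N = 0.
Proof.
  induction N as [|N IH]; intros Hk H; simpl; [lia|].
  destruct (Nat.eq_dec k N) as [->|]. rewrite H; ring. rewrite IH by (auto; lia). ring.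
Qed.

(** Multipliers rather than members of [disc_holo]: the mean property does not visibly pass to a
    product of two members, whereas multipliers compose. *)
Definition holo_factor (f : C -> C) : Prop :=
  forall F, disc_holo F -> disc_holo (fun z => f z * F z)%C.

Lemma holo_factor_mult f g : holo_factor f -> holo_factor g -> holo_factor (fun z => f z * g z)%C.
Proof.
  intros Hf Hg F HF. apply (disc_holo_ext (fun z => f z * (g z * F z))%C).
  intros; ring. apply Hf, Hg, HF.
Qed.

Lemma holo_factor_const c : holo_factor (fun _ => c).
Proof. intros F HF; apply disc_holo_scal; auto. Qed.

Lemma holo_factor_linear al be : holo_factor (fun z => al + be * z)%C.
Proof. intros F HF; apply disc_holo_mul_linear; auto. Qed.

Lemma holo_factor_geom b : Cmod b < 1 -> holo_factor (fun z => / (1 - b * z))%C.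
Proof. intros Hb F HF; apply disc_holo_mul_geom; auto. Qed.

Lemma holo_factor_cprod f N : (forall i, holo_factor (f i)) ->
  holo_factor (fun z => cprod (fun i => f i z) N).
Proof.
  intros H; induction N as [|N IH]; simpl. apply holo_factor_const.
  apply holo_factor_mult; auto.
Qed.

Lemma holo_factor_pow f n : holo_factor f -> holo_factor (fun z => f z ^ n)%C.
Proof.
  intros H; induction n as [|n IH]; simpl. apply holo_factor_const.
  apply holo_factor_mult; auto.
Qed.

Lemma disc_holo_of_factor f : holo_factor f -> disc_holo f.
Proof.
  intros H. apply (disc_holo_ext (fun z => f z * 1)%C). intros; ring. apply H, disc_holo_one.
Qed.

Definition blaschke (a z : C) : C := ((- a + 1 * z) * / (1 - Cconj a * z))%C.

Lemma holo_factor_blaschke a : in_disc a -> holo_factor (blaschke a).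
Proof.
  intros Ha. apply holo_factor_mult. apply holo_factor_linear.
  apply holo_factor_geom. rewrite Cmod_conj; auto.
Qed.

Lemma blaschke_eq a z : blaschke a z = ((z - a) / (1 - Cconj a * z))%C.
Proof. unfold blaschke, Cdiv. f_equal. ring. Qed.

Lemma Cmod_blaschke_circle a t : in_disc a -> Cmod (blaschke a (cis t)) = 1.
Proof.
  intros Ha. rewrite blaschke_eq, Cmod_div.
  - rewrite Cmod_circle_sub. apply Rinv_r. pose proof (circle_sub_pos a t Ha). lra.
  - apply one_sub_neq. rewrite Cmod_conj; auto. rewrite Cmod_cis; lra.
Qed.

Lemma Cmod_blaschke a z : Cmod (blaschke a z) = pseudo_dist z a.
Proof. rewrite blaschke_eq. reflexivity. Qed.

Definition localizer (a z : C) : C := (RtoC (defect a) * / (1 - Cconj a * z))%C.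

Lemma Cmod_localizer_circle a t : in_disc a -> Cmod (localizer a (cis t)) ^ 2 = profile a t.
Proof.
  intros Ha. unfold localizer.
  assert (Hn : (1 - Cconj a * cis t)%C <> 0)
    by (apply one_sub_neq; [rewrite Cmod_conj; auto|rewrite Cmod_cis; lra]).
  rewrite Cmod_mult, Cmod_R, Cmod_inv, Cmod_circle_sub by auto.
  rewrite profile_eq, Rabs_pos_eq by (left; apply defect_pos; auto).
  field. pose proof (circle_sub_pos a t Ha). lra.
Qed.

Lemma localizer_diag a : in_disc a -> localizer a a = 1.
Proof.
  intros Ha. unfold localizer. pose proof (cross_neq a a Ha Ha) as Hn.
  replace (RtoC (defect a)) with (1 - Cconj a * a)%C. field; auto.
  unfold defect. rewrite RtoC_minus, Cmod2_conj. ring.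
Qed.

(** [defect a] times the Herglotz kernel: its real part is positive in the closed disc and equals
    [profile a] on the circle, which is why the damper below has modulus at most
    [/ (1 + A * profile a t)] there. *)
Definition herglotz (a z : C) : C := (RtoC (defect a) * ((1 + Cconj a * z) / (1 - Cconj a * z)))%C.

(* [damper A a z] is [/ (1 + A * herglotz a z)], written as a product of admissible factors. *)
Definition damper (A : R) (a z : C) : C :=
  (RtoC (/ (1 + A * defect a)) * ((1 + (- Cconj a) * z) *
    / (1 - (RtoC ((1 - A * defect a) / (1 + A * defect a)) * Cconj a) * z)))%C.

Lemma damper_coef_lt A a : 0 < A -> in_disc a ->
  Cmod (RtoC ((1 - A * defect a) / (1 + A * defect a)) * Cconj a) < 1.
Proof.
  intros HA Ha. rewrite Cmod_mult, Cmod_conj, Cmod_R.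
  pose proof (defect_pos a Ha) as Da. assert (0 < A * defect a) by nra.
  assert (Rabs ((1 - A * defect a) / (1 + A * defect a)) <= 1).
  { apply Rabs_le. split; [apply le_div_of_mul|apply div_le_of_mul]; lra. }
  red in Ha. pose proof (Cmod_ge_0 a).
  pose proof (Rabs_pos ((1 - A * defect a) / (1 + A * defect a))). nra.
Qed.

Lemma holo_factor_damper A a : 0 < A -> in_disc a -> holo_factor (damper A a).
Proof.
  intros HA Ha. apply holo_factor_mult. apply holo_factor_const.
  apply holo_factor_mult. apply holo_factor_linear.
  apply holo_factor_geom. apply damper_coef_lt; auto.
Qed.

Lemma damper_herglotz A a z : 0 < A -> in_disc a -> Cmod z <= 1 ->
  (damper A a z * (1 + RtoC A * herglotz a z))%C = 1.
Proof.
  intros HA Ha Hz.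
  pose proof (defect_pos a Ha) as Da. assert (0 < A * defect a) by nra.
  assert (H1 : (1 - Cconj a * z)%C <> 0) by (apply one_sub_neq; auto; rewrite Cmod_conj; auto).
  assert (H2 : (1 - RtoC ((1 - A * defect a) / (1 + A * defect a)) * Cconj a * z)%C <> 0)
    by (apply one_sub_neq; auto; apply damper_coef_lt; auto).
  unfold damper, herglotz.
  assert (H3 : (RtoC (1 + A * defect a)) <> 0).
  { intros E. apply RtoC_inj in E. lra. }
  rewrite RtoC_div in * by lra. rewrite RtoC_inv by lra.
  set (D := RtoC (1 + A * defect a)) in *.
  assert (E1 : RtoC (1 - A * defect a) = (2 - D)%C).
  { unfold D. rewrite RtoC_minus, !RtoC_plus, !RtoC_mult. ring. }
  rewrite E1 in *.
  assert (E2 : (RtoC A * RtoC (defect a))%C = (D - 1)%C).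
  { unfold D. rewrite RtoC_plus, RtoC_mult. ring. }
  transitivity ((/ D * ((1 + - Cconj a * z) * / (1 - (2 - D) / D * Cconj a * z)) *
     (1 + (RtoC A * RtoC (defect a)) * ((1 + Cconj a * z) / (1 - Cconj a * z))))%C); [ring|].
  rewrite E2.
  set (w := (Cconj a * z)%C) in *.
  replace ((2 - D) / D * Cconj a * z)%C with ((2 - D) / D * w)%C in * by (unfold w; ring).
  replace (- Cconj a * z)%C with (- w)%C by (unfold w; ring).
  field. repeat split; auto.
  intros E. apply H2. transitivity ((D - (2 - D) * w) / D)%C. field; auto. rewrite E. field; auto.
Qed.

Lemma Cmod_damper A a z : 0 < A -> in_disc a -> Cmod z <= 1 ->
  Cmod (damper A a z) * Cmod (1 + RtoC A * herglotz a z) = 1.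
Proof. intros. rewrite <- Cmod_mult, damper_herglotz by auto. apply Cmod_1. Qed.

Lemma herglotz_re a z : in_disc a -> Cmod z <= 1 ->
  fst (herglotz a z) = defect a * (1 - (Cmod a * Cmod z) ^ 2) / Cmod (1 - Cconj a * z) ^ 2.
Proof.
  intros Ha Hz.
  assert (H1 : (1 - Cconj a * z)%C <> 0) by (apply one_sub_neq; auto; rewrite Cmod_conj; auto).
  assert (H2 : Cmod (1 - Cconj a * z) ^ 2 <> 0).
  { apply pow_nonzero. intros E. apply H1, Cmod_eq_0; auto. }
  unfold herglotz. set (w := (Cconj a * z)%C) in *.
  assert (E : Cmod a * Cmod z = Cmod w) by (unfold w; rewrite Cmod_mult, Cmod_conj; auto).
  rewrite E. rewrite !Cmod_sqr in *. simpl in *. field. intros E0; apply H2. etransitivity; [|exact E0]. ring.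
Qed.

Lemma herglotz_re_circle a t : in_disc a -> fst (herglotz a (cis t)) = profile a t.
Proof.
  intros Ha. rewrite herglotz_re, Cmod_circle_sub, Cmod_cis, profile_eq by (auto; rewrite Cmod_cis; lra).
  unfold defect. f_equal. ring.
Qed.

Lemma Cmod_damper_circle A a t : 0 < A -> in_disc a ->
  Cmod (damper A a (cis t)) <= / (1 + A * profile a t).
Proof.
  intros HA Ha.
  pose proof (Cmod_damper A a (cis t) HA Ha ltac:(rewrite Cmod_cis; lra)) as H.
  pose proof (profile_pos a t Ha) as Xa.
  assert (H1 : 1 + A * profile a t <= Cmod (1 + RtoC A * herglotz a (cis t))).
  { eapply Rle_trans; [|apply fst_le_Cmod]. eapply Rle_trans; [|apply Rle_abs].
    rewrite <- herglotz_re_circle by auto. simpl. lra. }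
  assert (0 < 1 + A * profile a t) by nra.
  apply Rmult_le_reg_r with (1 + A * profile a t); auto. rewrite Rinv_l by lra.
  eapply Rle_trans; [|right; exact H]. apply Rmult_le_compat_l; auto. apply Cmod_ge_0.
Qed.

Lemma exp_ge_1_plus (x : R) : 1 + x <= exp x.
Proof.
  destruct (Req_dec x 0) as [->|H]. rewrite exp_0; lra. left; apply exp_ineq1; auto.
Qed.

(** Only the real part of [q] enters to first order. For the dampers this is essential: the bound on
    [Cmod q] itself is only of the order of the square root of a summable quantity. *)
Lemma Cmod_one_plus_le (q : C) (s : R) : 2 * fst q + Cmod q ^ 2 <= 2 * s -> Cmod (1 + q) <= exp s.
Proof.
  intros H. apply Rsqr_incr_0_var; [|left; apply exp_pos].
  rewrite Rsqr_pow2, Cmod_sqr. replace (Rsqr (exp s)) with (exp (2 * s)).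
  2:{ replace (2 * s) with (s + s) by ring. rewrite exp_plus. reflexivity. }
  eapply Rle_trans; [|apply exp_ge_1_plus]. rewrite Cmod_sqr in H. simpl in *. lra.
Qed.

Lemma pseudo_defect_le (a b : C) : in_disc a -> in_disc b ->
  1 - pseudo_dist a b ^ 2 <= 4 / hyp_exp a b.
Proof.
  intros Ha Hb. pose proof (hyp_exp_mul_le a b Ha Hb). pose proof (hyp_exp_pos a b Ha Hb).
  apply le_div_of_mul; lra.
Qed.

Lemma Rpower_neg_le (x s : R) : 1 <= x -> s <= 1 -> / x <= Rpower x (- s).
Proof.
  intros. rewrite <- (Rpower_1 x) at 1 by lra. rewrite <- Rpower_Ropp. apply Rle_Rpower; lra.
Qed.

(** With [s = 1 - pseudo_dist ^ 2] and [T] the ratio of the defects, the Herglotz function has real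
    part at most [2 * s] and squared modulus at most [4 * s / T]. As [T <= 4 / s], the product of
    [A = T ^ kap] and [s] is still at most [4 * hyp_exp ^ (kap - 1)]; the condition [kap <= / 2]
    gives [A ^ 2 <= T], which keeps the quadratic term below [4 * s]. *)
Lemma damper_normalization (a b : C) (kap s0 : R) : in_disc a -> in_disc b ->
  defect a <= defect b -> 0 <= kap <= / 2 -> s0 <= 1 - kap ->
  Cmod (/ damper (Rpower (defect b / defect a) kap) a b) <= exp (16 * Rpower (hyp_exp a b) (- s0)).
Proof.
  intros Ha Hb Hab Hk Hs.
  pose proof (defect_pos a Ha) as Da. pose proof (defect_pos b Hb) as Db.
  set (A := Rpower (defect b / defect a) kap). assert (HA : 0 < A) by apply Rpower_pos.
  assert (Hb1 : Cmod b <= 1) by (red in Hb; lra).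
  pose proof (damper_herglotz A a b HA Ha Hb1) as HD.
  assert (Hd0 : damper A a b <> 0).
  { intros E. rewrite E in HD. apply (f_equal fst) in HD. simpl in HD. lra. }
  assert (E : (/ damper A a b)%C = (1 + RtoC A * herglotz a b)%C).
  { transitivity (/ damper A a b * (damper A a b * (1 + RtoC A * herglotz a b)))%C.
    rewrite HD; ring. field; auto. }
  rewrite E. apply Cmod_one_plus_le.
  set (H := hyp_exp a b). assert (H1 : 1 <= H) by (apply hyp_exp_ge_1; auto).
  pose proof (cross_pos b a Hb Ha) as Pc.
  set (c := Cmod (1 - Cconj a * b)) in *.
  set (s := 1 - pseudo_dist a b ^ 2).
  assert (Es : s = defect a * defect b / c ^ 2).
  { unfold s, c. rewrite pseudo_dist_sqr, cross_sym by auto. reflexivity. }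
  assert (Hs4 : s <= 4 / H) by (apply pseudo_defect_le; auto).
  clearbody H.
  assert (Hsp : 0 < s) by (rewrite Es; apply Rdiv_lt_0_compat; [nra|apply pow_lt; auto]).
  set (T := defect b / defect a).
  assert (HT1 : 1 <= T) by (apply le_div_of_mul; lra).
  assert (HTs : T <= 4 / s).
  { assert (defect b <= 2 * c).
    { assert (1 - Cmod b <= c).
      { unfold c. eapply Rle_trans; [|apply Cmod_triangle_rev]. rewrite Cmod_1, Cmod_mult, Cmod_conj.
        red in Ha. pose proof (Cmod_ge_0 b). pose proof (Cmod_ge_0 a). nra. }
      unfold defect in *. pose proof (Cmod_ge_0 b). nra. }
    rewrite Es. unfold T.
    replace (4 / (defect a * defect b / c ^ 2)) with ((2 * c) ^ 2 / defect b / defect a)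
      by (field; repeat split; lra).
    apply Rmult_le_compat_r. left; apply Rinv_0_lt_compat; auto.
    apply le_div_of_mul; auto. nra. }
  assert (HAs : A * s <= 4 * Rpower H (- s0)).
  { assert (A <= Rpower (4 / s) kap) by (unfold A; fold T; apply Rle_Rpower_l; lra).
    apply Rle_trans with (Rpower (4 / s) kap * s); [apply Rmult_le_compat_r; lra|].
    assert (E2 : Rpower (4 / s) kap * s = 4 * Rpower (4 / s) (kap - 1)).
    { unfold Rminus. rewrite Rpower_plus, Rpower_Ropp, Rpower_1 by (apply Rdiv_lt_0_compat; lra).
      field. lra. }
    rewrite E2. apply Rmult_le_compat_l; [lra|].
    assert (HH : H <= 4 / s).
    { apply le_div_of_mul; auto. apply Rmult_le_compat_r with (r := H) in Hs4; [|lra].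
      replace (4 / H * H) with 4 in Hs4 by (field; lra). lra. }
    replace (kap - 1) with (- (1 - kap)) by ring. rewrite !Rpower_Ropp.
    apply Rinv_le_contravar. apply Rpower_pos.
    apply Rle_trans with (Rpower H (1 - kap)). apply Rle_Rpower; lra.
    apply Rle_Rpower_l; lra. }
  assert (Hre : fst (herglotz a b) <= 2 * s).
  { rewrite herglotz_re by auto. fold c. rewrite Es.
    replace (2 * (defect a * defect b / c ^ 2)) with (defect a * (2 * defect b) / c ^ 2)
      by (field; lra).
    apply Rmult_le_compat_r. left; apply Rinv_0_lt_compat, pow_lt; auto.
    apply Rmult_le_compat_l; [lra|].
    replace (1 - (Cmod a * Cmod b) ^ 2) with (defect a + Cmod a ^ 2 * defect b)
      by (unfold defect; ring).
    assert (Cmod a ^ 2 <= 1) by (unfold defect in Da; lra). nra. }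
  assert (Hmod : Cmod (herglotz a b) ^ 2 <= 4 * s / T).
  { unfold herglotz. rewrite Cmod_mult, Cmod_R, Rabs_pos_eq, Cmod_div by
      (try lra; apply one_sub_neq; auto; rewrite Cmod_conj; auto).
    fold c. rewrite Es. unfold T.
    replace (4 * (defect a * defect b / c ^ 2) / (defect b / defect a))
      with ((defect a * (2 / c)) ^ 2) by (field; lra).
    apply pow_incr. split.
    - apply Rmult_le_pos; [lra|]. apply Rmult_le_pos. apply Cmod_ge_0.
      left; apply Rinv_0_lt_compat; auto.
    - apply Rmult_le_compat_l; [lra|]. apply Rmult_le_compat_r.
      left; apply Rinv_0_lt_compat; auto.
      eapply Rle_trans; [apply Cmod_triangle|]. rewrite Cmod_1, Cmod_mult, Cmod_conj.
      red in Ha. pose proof (Cmod_ge_0 b). pose proof (Cmod_ge_0 a). nra. }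
  assert (HA2 : A ^ 2 <= T).
  { replace (A ^ 2) with (Rpower T (kap + kap)) by (unfold A, T; rewrite Rpower_plus; ring).
    rewrite <- (Rpower_1 T) at 2 by lra. apply Rle_Rpower; lra. }
  assert (Hinv : / H <= Rpower H (- s0)) by (apply Rpower_neg_le; lra).
  assert (Hq : Cmod (RtoC A * herglotz a b) ^ 2 <= 16 * Rpower H (- s0)).
  { rewrite Cmod_mult, Cmod_R, Rabs_pos_eq, Rpow_mult_distr by lra.
    apply Rle_trans with (T * (4 * s / T)).
    - apply Rmult_le_compat; auto; apply pow2_ge_0.
    - replace (T * (4 * s / T)) with (4 * s) by (field; lra). unfold Rdiv in Hs4. lra. }
  assert (Hf : fst (RtoC A * herglotz a b)%C = A * fst (herglotz a b)) by (simpl; ring).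
  rewrite Hf.
  assert (A * fst (herglotz a b) <= A * (2 * s)) by (apply Rmult_le_compat_l; lra).
  lra.
Qed.

(** [/ r ^ 2] is at most [1 + (1 - r ^ 2) / d ^ 2], and [1 - r ^ 2] is at most 4 times a summable
    power of [hyp_exp]; separation keeps [r] away from zero. *)
Lemma blaschke_normalization (a b : C) (d s0 : R) : in_disc a -> in_disc b ->
  0 < d -> d <= pseudo_dist b a -> s0 <= 1 ->
  Cmod (/ blaschke a b) <= exp (2 / d ^ 2 * Rpower (hyp_exp a b) (- s0)).
Proof.
  intros Ha Hb Hd Hr Hs.
  assert (Hn : blaschke a b <> 0).
  { intros E. rewrite <- Cmod_blaschke, E, Cmod_0 in Hr. lra. }
  rewrite Cmod_inv, Cmod_blaschke by auto.
  set (r := pseudo_dist b a) in *.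
  assert (Hs4 : 1 - r ^ 2 <= 4 / hyp_exp a b).
  { unfold r. rewrite pseudo_dist_sym by auto. apply pseudo_defect_le; auto. }
  pose proof (Rpower_neg_le (hyp_exp a b) s0 (hyp_exp_ge_1 a b Ha Hb) Hs) as Hi.
  set (Q := Rpower (hyp_exp a b) (- s0)) in *.
  assert (Hsq : 1 - r ^ 2 <= 4 * Q) by (unfold Rdiv in Hs4; lra).
  assert (Hd2 : 0 < d ^ 2) by (apply pow_lt; auto).
  assert (Hrd : d ^ 2 <= r ^ 2) by (apply pow_incr; lra).
  assert (HQ : 0 < Q) by apply Rpower_pos.
  apply Rsqr_incr_0_var; [|left; apply exp_pos].
  replace (Rsqr (exp (2 / d ^ 2 * Q))) with (exp (4 * Q / d ^ 2)).
  2:{ unfold Rsqr. rewrite <- exp_plus. f_equal. field. lra. }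
  eapply Rle_trans; [|apply exp_ge_1_plus].
  rewrite Rsqr_pow2, pow_inv.
  apply Rmult_le_reg_l with (r ^ 2); [lra|]. rewrite Rinv_r by lra.
  assert (1 <= r ^ 2 / d ^ 2) by (apply le_div_of_mul; lra).
  replace (r ^ 2 * (1 + 4 * Q / d ^ 2)) with (r ^ 2 + r ^ 2 / d ^ 2 * (4 * Q)) by (field; lra).
  nra.
Qed.

(** Each summand is the product over [m > n] minus the product over [m >= n], so the sum is 1 minus
    the full product. Applied to profiles, it shows that arbitrarily many overlapping shadows cost
    nothing. *)
Lemma telescoping_weights (Z : nat -> R) N : (forall i, 0 <= Z i) ->
  bsum (fun n => Z n * bprod (fun m => if le_dec n m then / (1 + Z m) else 1) N) N <= 1.
Proof.
  intros HZ. induction N as [|N IH]; [simpl; lra|].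
  assert (HN : 0 < / (1 + Z N)) by (apply Rinv_0_lt_compat; specialize (HZ N); lra).
  simpl bsum. simpl bprod.
  rewrite (bsum_ext _ (fun n => / (1 + Z N) *
     (Z n * bprod (fun m => if le_dec n m then / (1 + Z m) else 1) N))).
  2:{ intros n Hn. destruct (le_dec n N); [|lia]. ring. }
  rewrite bsum_scal.
  rewrite (bprod_ext _ (fun _ => 1) N).
  2:{ intros m Hm. destruct (le_dec N m); [lia|auto]. }
  assert (E1 : bprod (fun _ => 1) N = 1) by (clear; induction N as [|N IH]; simpl; [|rewrite IH]; ring).
  rewrite E1. destruct (le_dec N N); [|lia].
  apply Rle_trans with (/ (1 + Z N) * 1 + Z N * (1 * / (1 + Z N))).
  - apply Rplus_le_compat_r. apply Rmult_le_compat_l; lra.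
  - right. field. specialize (HZ N). lra.
Qed.

Section Basis.

Variables (z : nat -> C) (N : nat) (e s0 d C0 : R).
Hypothesis z_disc : forall i, in_disc (z i).
Hypothesis sorted : forall i j, (i <= j)%nat -> (j < N)%nat -> defect (z j) <= defect (z i).
Hypothesis d_pos : 0 < d.
Hypothesis sep : forall i j, (i < N)%nat -> (j < N)%nat -> i <> j -> d <= pseudo_dist (z i) (z j).
Hypothesis e_range : 0 < e <= / 4.
Hypothesis s0_le : s0 <= 1 - 2 * e.
Hypothesis decay : forall k, (k < N)%nat ->
  bsum (fun m => Rpower (hyp_exp (z m) (z k)) (- s0)) N <= C0.

(** In the exponent [2 * e], one [e] undoes the loss allowed by the selection rule when [z m] is
    deeper, the other leaves a gain [gap ^ e]. By [e <= / 4] it is an admissible [kap] in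
    [damper_normalization]. *)
Definition strength (m n : nat) : R := Rpower (defect (z n) / defect (z m)) (2 * e).

(** The points are sorted by decreasing defect, so [n <= m] means that [z m] is at least as deep as
    [z n]. The fourth power yields [profile ^ 2] on the circle: one factor enters the telescoping
    sum, the other pays for the denominator in the bound on [hyp_exp]. *)
Definition basis (n : nat) (w : C) : C :=
  (cprod (fun m => if Nat.eq_dec m n then RtoC 1
                   else / blaschke (z m) (z n) * blaschke (z m) w) N
   * localizer (z n) w ^ 4
   * cprod (fun m => if le_dec n m
                     then / damper (strength m n) (z m) (z n) * damper (strength m n) (z m) w
                     else RtoC 1) N)%C.

Lemma disc_holo_basis n : disc_holo (basis n).
Proof.
  apply disc_holo_of_factor. unfold basis.
  apply holo_factor_mult; [apply holo_factor_mult|].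
  - apply (holo_factor_cprod (fun m w => if Nat.eq_dec m n then RtoC 1
                   else (/ blaschke (z m) (z n) * blaschke (z m) w)%C)).
    intros m. destruct (Nat.eq_dec m n). apply holo_factor_const.
    apply holo_factor_mult. apply holo_factor_const. apply holo_factor_blaschke; auto.
  - apply (holo_factor_pow (localizer (z n))). apply holo_factor_mult. apply holo_factor_const.
    apply holo_factor_geom. rewrite Cmod_conj. apply z_disc.
  - apply (holo_factor_cprod (fun m w => if le_dec n m
       then (/ damper (strength m n) (z m) (z n) * damper (strength m n) (z m) w)%C
       else RtoC 1)).
    intros m. destruct (le_dec n m); [|apply holo_factor_const].
    apply holo_factor_mult. apply holo_factor_const.
    apply holo_factor_damper; auto. apply Rpower_pos.
Qed.

Lemma basis_diag n : (n < N)%nat -> basis n (z n) = 1.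
Proof.
  intros Hn. unfold basis. rewrite localizer_diag by auto.
  transitivity (1 * 1 ^ 4 * 1)%C; [|simpl; ring].
  f_equal; [f_equal|]; apply cprod_one; intros m Hm.
  2:{ destruct (le_dec n m); auto.
    assert (H : damper (strength m n) (z m) (z n) <> 0); [|field; auto].
    intros E. pose proof (damper_herglotz (strength m n) (z m) (z n)) as H.
    rewrite E in H. assert (Hz : Cmod (z n) <= 1) by (left; apply z_disc).
    specialize (H (Rpower_pos _ _) (z_disc m) Hz). apply (f_equal fst) in H. simpl in H. lra. }
  destruct (Nat.eq_dec m n); auto.
    assert (H : blaschke (z m) (z n) <> 0); [|field; auto].
    intros E. assert (H := Cmod_blaschke (z m) (z n)). rewrite E, Cmod_0 in H.
    pose proof (sep n m Hn Hm ltac:(auto)). lra.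
Qed.

Lemma basis_off n k : (k < N)%nat -> n <> k -> basis n (z k) = 0.
Proof.
  intros Hk Hnk. unfold basis. rewrite (cprod_zero _ N k); [ring|auto|].
  destruct (Nat.eq_dec k n); [congruence|].
  rewrite (blaschke_eq (z k) (z k)). unfold Cdiv. ring.
Qed.

Definition basis_const : R := exp ((2 / d ^ 2 + 16) * C0).

(** On the circle the Blaschke factors have modulus 1, so they enter only through their
    normalization at [z n]. Every normalizing constant is bounded by the exponential of a multiple
    of [hyp_exp ^ (- s0)], and [decay] bounds their product uniformly in [N]. *)
Lemma basis_bound n t : (n < N)%nat ->
  Cmod (basis n (cis t)) <= basis_const * profile (z n) t ^ 2 *
    bprod (fun m => if le_dec n m then / (1 + strength m n * profile (z m) t) else 1) N.
Proof.
  intros Hn. unfold basis. rewrite !Cmod_mult, !Cmod_cprod, Cmod_pow.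
  pose proof (profile_pos (z n) t (z_disc n)) as Xn.
  replace (Cmod (localizer (z n) (cis t)) ^ 4) with (profile (z n) t ^ 2).
  2:{ rewrite <- (Cmod_localizer_circle (z n) t) by auto. ring. }
  assert (Hd2 : 0 < 2 / d ^ 2) by (apply Rdiv_lt_0_compat; [lra|apply pow_lt; auto]).
  assert (H1 : bprod (fun m => Cmod (if Nat.eq_dec m n then RtoC 1
     else / blaschke (z m) (z n) * blaschke (z m) (cis t))) N <= exp (2 / d ^ 2 * C0)).
  { eapply Rle_trans.
    { apply (bprod_le _ (fun m => exp (2 / d ^ 2 * Rpower (hyp_exp (z m) (z n)) (- s0)))).
      intros m Hm. split; [apply Cmod_ge_0|].
      destruct (Nat.eq_dec m n) as [E|E].
      - rewrite Cmod_1, <- exp_0. apply exp_le. apply Rmult_le_pos; [lra|].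
        left; apply Rpower_pos.
      - rewrite Cmod_mult, Cmod_blaschke_circle, Rmult_1_r by auto.
        apply blaschke_normalization; auto. lra. }
    rewrite bprod_exp. apply exp_le. rewrite bsum_scal.
    apply Rmult_le_compat_l; [lra|]. apply decay; auto. }
  assert (H2 : bprod (fun m => Cmod (if le_dec n m
       then / damper (strength m n) (z m) (z n) * damper (strength m n) (z m) (cis t)
       else RtoC 1)) N <= exp (16 * C0) *
     bprod (fun m => if le_dec n m then / (1 + strength m n * profile (z m) t) else 1) N).
  { eapply Rle_trans.
    { apply (bprod_le _ (fun m => exp (16 * Rpower (hyp_exp (z m) (z n)) (- s0)) *
         (if le_dec n m then / (1 + strength m n * profile (z m) t) else 1))).
      intros m Hm. split; [apply Cmod_ge_0|].
      destruct (le_dec n m) as [L|L].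
      - rewrite Cmod_mult. apply Rmult_le_compat; try apply Cmod_ge_0.
        + apply damper_normalization; auto; lra.
        + apply Cmod_damper_circle; auto. apply Rpower_pos.
      - rewrite Cmod_1, Rmult_1_r, <- exp_0. apply exp_le.
        pose proof (Rpower_pos (hyp_exp (z m) (z n)) (- s0)). lra. }
    rewrite bprod_mult, bprod_exp. apply Rmult_le_compat_r.
    - left. apply bprod_pos. intros m Hm. destruct (le_dec n m); [|lra].
      apply Rinv_0_lt_compat. pose proof (profile_pos (z m) t (z_disc m)).
      pose proof (Rpower_pos (defect (z n) / defect (z m)) (2 * e)). unfold strength. nra.
    - apply exp_le. rewrite bsum_scal. apply Rmult_le_compat_l; [lra|]. apply decay; auto. }
  unfold basis_const. rewrite Rmult_plus_distr_r, exp_plus.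
  set (P := bprod (fun m => if le_dec n m then _ else 1) N) in *.
  replace (exp (2 / d ^ 2 * C0) * exp (16 * C0) * profile (z n) t ^ 2 * P)
    with ((exp (2 / d ^ 2 * C0) * profile (z n) t ^ 2) * (exp (16 * C0) * P)) by ring.
  assert (Hb : forall f, 0 <= bprod (fun m => Cmod (f m)) N)
    by (intros f; rewrite <- Cmod_cprod; apply Cmod_ge_0).
  pose proof (pow_lt _ 2 Xn).
  apply Rmult_le_compat; auto.
  - apply Rmult_le_pos; [|lra]. apply Hb.
  - apply Rmult_le_compat_r; lra.
Qed.

Variable e0 : R.
Hypothesis e0_range : 0 < e0 <= 1.
Hypothesis e0_small : e0 * (1 + / e) <= 1.

(** For [n <> s] one has [hyp_exp ^ e0 <= 24 * 8 * D / profile (z n) t], where [/ D] is the damping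
    factor of [s]; this cancels [/ D] and one profile, and [192 * profile * product] telescopes. The
    term [n = s] adds [4 ^ 2], and [192 + 16 = 208]. *)
Lemma basis_sum_selected (s : nat) (t : R) : (s < N)%nat ->
  (forall m, (m < N)%nat -> height e (z m) t <= 2 * height e (z s) t) ->
  bsum (fun n => Cmod (basis n (cis t)) * Rpower (hyp_exp (z s) (z n)) e0) N
  <= 208 * basis_const.
Proof.
  intros Hs Hsel.
  assert (HK : 0 < basis_const) by apply exp_pos.
  assert (HX : forall m, 0 < profile (z m) t) by (intros; apply profile_pos; auto).
  (* The index [s] is left out of the telescoping, because its damping factor is spent separately as
     [/ D]. *)
  set (Z := fun m => if Nat.eq_dec m s then 0 else profile (z m) t).
  assert (HZ : forall m, 0 <= Z m).
  { intros m. unfold Z. destruct (Nat.eq_dec m s); [lra|]. left; auto. }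
  assert (Hst : forall m n, 0 < strength m n) by (intros; apply Rpower_pos).
  assert (Hst1 : forall m n, (n <= m)%nat -> (m < N)%nat -> 1 <= strength m n).
  { intros m n H1 H2. apply Rpower_ge_1; [|lra].
    pose proof (sorted n m H1 H2). pose proof (defect_pos _ (z_disc m)).
    apply le_div_of_mul; lra. }
  apply Rle_trans with (bsum (fun n => 192 * basis_const *
      (Z n * bprod (fun m => if le_dec n m then / (1 + Z m) else 1) N)
      + if Nat.eq_dec n s then 16 * basis_const else 0) N).
  2:{ rewrite bsum_plus, bsum_scal. pose proof (telescoping_weights Z N HZ).
      assert (E : forall k, (k <= N)%nat ->
        bsum (fun n => if Nat.eq_dec n s then 16 * basis_const else 0) k
        <= if lt_dec s k then 16 * basis_const else 0).
      { induction k as [|k IH]; intros Hk; simpl.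
        - destruct (lt_dec s 0); lra.
        - specialize (IH ltac:(lia)).
          destruct (lt_dec s k), (lt_dec s (S k)), (Nat.eq_dec k s); try lia; lra. }
      specialize (E N (le_n N)). destruct (lt_dec s N); [|lia]. nra. }
  apply bsum_le. intros n Hn.
  pose proof (basis_bound n t Hn) as HB.
  set (P := bprod (fun m => if le_dec n m then / (1 + strength m n * profile (z m) t) else 1) N) in *.
  set (Q := bprod (fun m => if le_dec n m then / (1 + Z m) else 1) N).
  assert (Hfac : forall x, 0 <= x -> 0 < / (1 + x) <= 1).
  { intros x Hx. split. apply Rinv_0_lt_compat; lra.
    apply Rle_trans with (/ 1); [apply Rinv_le_contravar; lra|rewrite Rinv_1; lra]. }
  assert (HP : 0 < P).
  { apply bprod_pos. intros m _. destruct (le_dec n m); [|lra]. apply Hfac.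
    specialize (HX m). specialize (Hst m n). nra. }
  assert (HQ : 0 < Q).
  { apply bprod_pos. intros m _. destruct (le_dec n m); [|lra]. apply Hfac. auto. }
  destruct (Nat.eq_dec n s) as [->|Hns].
  - rewrite hyp_exp_diag by auto.
    assert (E1 : Rpower 1 e0 = 1) by (unfold Rpower; rewrite ln_1, Rmult_0_r; apply exp_0).
    rewrite E1, Rmult_1_r.
    assert (HP1 : P <= 1).
    { assert (E2 : bprod (fun _ => 1) N = 1)
        by (clear; induction N as [|k IH]; simpl; [|rewrite IH]; ring).
      rewrite <- E2. apply bprod_le. intros m _. destruct (le_dec s m); [|lra].
      specialize (Hfac (strength m s * profile (z m) t)).
      specialize (HX m). specialize (Hst m s). assert (0 <= strength m s * profile (z m) t) by nra.
      destruct Hfac; auto; split; lra. }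
    pose proof (profile_le_4 (z s) t (z_disc s)). specialize (HX s).
    assert (profile (z s) t ^ 2 <= 16) by nra.
    assert (0 <= 192 * basis_const * (Z s * Q)).
    { apply Rmult_le_pos; [lra|]. apply Rmult_le_pos; auto. lra. }
    assert (basis_const * profile (z s) t ^ 2 * P <= 16 * basis_const); [|lra].
    apply Rle_trans with (basis_const * profile (z s) t ^ 2 * 1).
    + apply Rmult_le_compat_l; auto. apply Rmult_le_pos; [lra|]. apply pow2_ge_0.
    + nra.
  - rewrite Rplus_0_r.
    assert (EZ : Z n = profile (z n) t) by (unfold Z; destruct (Nat.eq_dec n s); congruence).
    set (D := if le_dec n s then 1 + strength s n * profile (z s) t else 1).
    assert (HD : 1 <= D).
    { unfold D. destruct (le_dec n s); [|lra]. specialize (HX s). specialize (Hst s n). nra. }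
    assert (HPQ : P <= / D * Q).
    { assert (Es : forall k, (k <= N)%nat ->
        bprod (fun m => if le_dec n m then / (1 + strength m n * profile (z m) t) else 1) k <=
        (if lt_dec s k then / D else 1) * bprod (fun m => if le_dec n m then / (1 + Z m) else 1) k).
      { induction k as [|k IH]; intros Hk; simpl.
        - destruct (lt_dec s 0); [lia|lra].
        - specialize (IH ltac:(lia)).
          assert (0 < bprod (fun m => if le_dec n m then / (1 + Z m) else 1) k).
          { apply bprod_pos. intros m _. destruct (le_dec n m); [|lra]. apply Hfac. auto. }
          assert (0 <= bprod (fun m => if le_dec n m
                    then / (1 + strength m n * profile (z m) t) else 1) k).
          { left. apply bprod_pos. intros m _. destruct (le_dec n m); [|lra]. apply Hfac.
            specialize (HX m). specialize (Hst m n). nra. }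
          assert (0 < / D) by (apply Rinv_0_lt_compat; lra).
          destruct (Nat.eq_dec k s) as [->|Hks].
          + destruct (lt_dec s s); [lia|]. destruct (lt_dec s (S s)); [|lia].
            unfold D. unfold Z at 2. destruct (Nat.eq_dec s s); [|lia].
            destruct (le_dec n s).
            * rewrite Rplus_0_r, Rinv_1, Rmult_1_r. rewrite Rmult_1_l in IH.
              rewrite Rmult_comm. apply Rmult_le_compat_l; auto.
              left; apply Hfac. specialize (HX s). specialize (Hst s n). nra.
            * rewrite Rinv_1. lra.
          + replace (if lt_dec s (S k) then / D else 1) with (if lt_dec s k then / D else 1)
              by (destruct (lt_dec s k), (lt_dec s (S k)); lia || auto).
            rewrite <- Rmult_assoc. apply Rmult_le_compat; auto.
            * destruct (le_dec n k); [|lra]. left; apply Hfac.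
              specialize (HX k). specialize (Hst k n). nra.
            * destruct (le_dec n k); [|lra]. unfold Z. destruct (Nat.eq_dec k s); [lia|].
              specialize (HX k). specialize (Hst1 k n l ltac:(lia)).
              apply Rinv_le_contravar; nra. }
      specialize (Es N (le_n N)). destruct (lt_dec s N); [|lia]. exact Es. }
    set (V := 8 * D / profile (z n) t).
    pose proof (HX n) as HXn. pose proof (profile_le_4 (z n) t (z_disc n)) as HX4.
    assert (HV : 1 <= V) by (apply le_div_of_mul; nra).
    pose proof (gap_ge_1 (z s) (z n) (z_disc s) (z_disc n)) as Hg.
    assert (HVD : 1 / profile (z n) t <= V).
    { apply Rmult_le_compat_r. left; apply Rinv_0_lt_compat; auto. lra. }
    (* If [z s] is the deeper point, selection gives [profile (z n) t <= 2 * gap ^ e * profile (z s)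
       t], hence [gap ^ e * profile (z n) t] is at most [2 * strength s n * profile (z s) t];
       otherwise the handicap of [z s] suffices. *)
    assert (Hgap : Rpower (gap (z s) (z n)) e <= V).
    { unfold V, D. destruct (le_dec n s) as [L|L].
      - pose proof (sorted n s L Hs) as Hd.
        pose proof (height_cmp e (z s) (z n) t (z_disc s) (z_disc n) (Hsel n Hn)) as Hc.
        rewrite gap_eq_r by auto.
        pose proof (defect_pos _ (z_disc s)) as Ds. pose proof (defect_pos _ (z_disc n)) as Dn.
        unfold strength. set (T := defect (z n) / defect (z s)) in *.
        assert (HT : 0 < T) by (apply Rdiv_lt_0_compat; auto).
        replace (defect (z s) / defect (z n)) with (/ T) in Hc by (unfold T; field; lra).
        rewrite Rpower_inv_base in Hc by auto.
        replace (2 * e) with (e + e) by ring. rewrite Rpower_plus.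
        set (q := Rpower T e) in *. assert (Hq : 0 < q) by apply Rpower_pos.
        apply le_div_of_mul; auto.
        apply Rmult_le_compat_r with (r := q) in Hc; [|lra].
        rewrite Rmult_assoc, Rinv_l, Rmult_1_r in Hc by lra.
        specialize (HX s). nra.
      - rewrite Rmult_1_r. apply gap_selected_above; auto; try lra.
        apply sorted; auto; lia. }
    assert (Hpow : Rpower (hyp_exp (z s) (z n)) e0 <= 24 * V).
    { rewrite <- (Rpower_1 V) by lra.
      apply (Rpower_le_of_gap _ (gap (z s) (z n)) V e); auto; try lra.
      - apply hyp_exp_pos; auto.
      - eapply Rle_trans; [apply (hyp_exp_selected e _ _ t); auto; lra|].
        unfold Rdiv in *. rewrite Rmult_1_l in HVD.
        apply Rmult_le_compat_l; lra. }
    apply Rle_trans with ((basis_const * profile (z n) t ^ 2 * (/ D * Q)) * (24 * V)).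
    + apply Rmult_le_compat; auto. apply Cmod_ge_0. left; apply Rpower_pos.
      eapply Rle_trans; [apply HB|]. apply Rmult_le_compat_l; auto.
      apply Rmult_le_pos; [lra|]. apply pow2_ge_0.
    + right. rewrite EZ. unfold V. field. split; lra.
Qed.

End Basis.

(** * Interpolation at finitely many points *)

Fixpoint csum (f : nat -> C) (N : nat) : C :=
  match N with O => RtoC 0 | S n => (csum f n + f n)%C end.

Lemma disc_holo_csum (f : nat -> C -> C) N : (forall i, disc_holo (f i)) ->
  disc_holo (fun z => csum (fun i => f i z) N).
Proof.
  intros H. induction N as [|N IH]; simpl.
  - apply (disc_holo_ext (fun z => RtoC 0 * 1)%C). intros; ring.
    apply disc_holo_scal, disc_holo_one.
  - apply disc_holo_plus; auto.
Qed.

Lemma csum_single (f : nat -> C) N k : (k < N)%nat ->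
  (forall i, (i < N)%nat -> i <> k -> f i = RtoC 0) -> csum f N = f k.
Proof.
  assert (Hz : forall N, (forall i, (i < N)%nat -> f i = RtoC 0) -> csum f N = RtoC 0).
  { clear. induction N as [|N IH]; intros H; simpl; auto. rewrite IH, H; auto. ring. }
  induction N as [|N IH]; intros Hk H; simpl; [lia|].
  destruct (Nat.eq_dec k N) as [->|].
  - rewrite Hz. ring. intros; apply H; lia.
  - rewrite IH, (H N); auto; try lia. ring.
Qed.

Lemma Cmod_csum (f : nat -> C) N : Cmod (csum f N) <= bsum (fun i => Cmod (f i)) N.
Proof.
  induction N as [|N IH]; simpl. rewrite Cmod_0; lra.
  eapply Rle_trans; [apply Cmod_triangle|]. lra.
Qed.

(** Turns the small exponent [p] into the small factor [2 * p / q] at the price of the exponent [q]: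
    combine [x ^ p - 1 <= p * ln x * x ^ p] with [ln x <= 2 / q * x ^ (q / 2)]. *)
Lemma Rpower_sub_1_le (x p q : R) : 1 <= x -> 0 < q -> 0 < p <= q / 2 ->
  Rpower x p - 1 <= 2 * p / q * Rpower x q.
Proof.
  intros Hx Hq Hp.
  assert (Hl : 0 <= ln x) by (rewrite <- ln_1; apply ln_le; lra).
  assert (H1 : Rpower x p - 1 <= p * ln x * Rpower x p).
  { pose proof (exp_ge_1_plus (- (p * ln x))) as H. rewrite exp_Ropp in H.
    fold (Rpower x p) in H. pose proof (Rpower_pos x p) as P.
    apply Rmult_le_compat_r with (r := Rpower x p) in H; [|lra].
    rewrite Rinv_l in H; lra. }
  assert (H2 : ln x <= 2 / q * Rpower x (q / 2)).
  { pose proof (exp_ge_1_plus (q / 2 * ln x)) as H. fold (Rpower x (q / 2)) in H.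
    apply Rmult_le_reg_l with (q / 2); [lra|].
    replace (q / 2 * (2 / q * Rpower x (q / 2))) with (Rpower x (q / 2)) by (field; lra). lra. }
  assert (H3 : Rpower x p <= Rpower x (q / 2)) by (apply Rle_Rpower; lra).
  pose proof (Rpower_pos x p). pose proof (Rpower_pos x (q / 2)).
  eapply Rle_trans; [apply H1|].
  apply Rle_trans with (p * (2 / q * Rpower x (q / 2)) * Rpower x (q / 2)).
  - apply Rmult_le_compat; try lra. apply Rmult_le_pos; lra. apply Rmult_le_compat_l; lra.
  - right. replace (Rpower x q) with (Rpower x (q / 2) * Rpower x (q / 2)).
    field; lra. rewrite <- Rpower_plus. f_equal. lra.
Qed.

Lemma ratio_deviation (a b H p : R) : 0 < a -> 0 < b -> 1 <= H -> 0 <= p ->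
  a <= b * Rpower H p -> b <= a * Rpower H p -> Rabs (a - b) <= b * (Rpower H p - 1).
Proof.
  intros Ha Hb HH Hp H1 H2. pose proof (Rpower_ge_1 H p HH Hp).
  apply Rabs_le. split; [|lra].
  set (y := Rpower H p) in *. clearbody y.
  assert (b / y <= a) by (apply div_le_of_mul; lra).
  assert (b * (2 - y) <= b / y).
  { apply le_div_of_mul; [lra|]. assert (0 <= b * (y - 1) ^ 2) by (apply Rmult_le_pos; [lra|apply pow2_ge_0]). nra. }
  lra.
Qed.

Lemma finite_interpolation_sorted (s0 d C0 : R) : 0 < s0 < 1 -> 0 < d -> 0 < C0 ->
  exists eps, 0 < eps /\ forall (z : nat -> C) (N : nat) (w : nat -> R),
    (0 < N)%nat -> (forall i, in_disc (z i)) ->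
    (forall i j, (i <= j)%nat -> (j < N)%nat -> defect (z j) <= defect (z i)) ->
    (forall i j, (i < N)%nat -> (j < N)%nat -> i <> j -> d <= pseudo_dist (z i) (z j)) ->
    (forall k, (k < N)%nat ->
      bsum (fun m => Rpower (hyp_exp (z m) (z k)) (- s0)) N <= C0) ->
    (forall i, 0 < w i) ->
    (forall i j, (i < N)%nat -> (j < N)%nat -> w i <= w j * Rpower (hyp_exp (z i) (z j)) eps) ->
    exists v : R -> R, (forall t, continuous v t) /\ (forall t, 0 < v t) /\
      forall k, (k < N)%nat -> mean (fun t => poisson (z k) t * v t) = w k.
Proof.
  intros Hs0 Hd HC0.
  (* [1 - s0 = 4 * e] leaves room both for [e0 + s0 <= 1 - 2 * e] and for the strength exponent
     [2 * e]; [e0 = e / 8] keeps [e0 * (1 + / e)] below [/ 4]. *)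
  set (e := (1 - s0) / 4). set (e0 := e / 8).
  assert (He : 0 < e <= / 4) by (unfold e; lra).
  set (CA := 1536 + 6 * C0). set (K2 := 208 * basis_const d C0).
  assert (HK2 : 208 <= K2).
  { unfold K2, basis_const. pose proof (exp_ge_1_plus ((2 / d ^ 2 + 16) * C0)).
    assert (0 < (2 / d ^ 2 + 16) * C0).
    { apply Rmult_lt_0_compat; auto. pose proof (Rdiv_lt_0_compat 2 (d ^ 2) ltac:(lra) (pow_lt d 2 Hd)). lra. }
    lra. }
  assert (HCA : 1536 <= CA) by (unfold CA; lra).
  (* With this value [eta * K2 = / 2], where [eta] bounds the relative error of the averaged data
     and [K2] the basis sums; it does not depend on [N]. *)
  exists (e0 / (4 * CA * K2)).
  assert (Hden : 1 <= 4 * CA * K2) by nra.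
  assert (He0 : 0 < e0 <= / 32) by (unfold e0; lra).
  set (eps := e0 / (4 * CA * K2)).
  assert (Heps : 0 < eps) by (apply Rdiv_lt_0_compat; lra).
  split; auto.
  intros z N w HN Hz Hsort Hsep Hdec Hw Hlip.
  assert (Heps2 : eps <= e0 / 2).
  { unfold eps. apply Rmult_le_compat_l; [lra|]. apply Rinv_le_contravar; [lra|]. nra. }
  set (wt := wt z N e).
  set (g := fun t => bsum (fun n => wt n t * w n) N).
  assert (Hcwt : forall n t, continuous (wt n) t) by (intros; apply cont_wt; auto).
  assert (Hwt0 : forall n t, 0 <= wt n t) by (intros; apply wt_ge_0; auto).
  assert (Hcg : forall t, continuous g t).
  { intros. apply (cont_bsum (fun n t => wt n t * w n)). intros. apply cont_mult; auto.
    apply cont_const. }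
  assert (Hg : forall t, 0 < g t).
  { intros t. assert (Hs1 := wt_sum z N e Hz HN t). fold wt in Hs1.
    assert (H0 : 0 <= g t).
    { apply bsum_ge_0. intros. apply Rmult_le_pos; auto. left; auto. }
    destruct H0 as [|H0]; auto. exfalso.
    assert (E : bsum (fun n => wt n t) N = bsum (fun n => 0 * 0) N).
    { apply bsum_ext. intros n Hn.
      assert (wt n t * w n <= g t).
      { apply (bsum_ge_term (fun n => wt n t * w n)); auto. intros.
        apply Rmult_le_pos; auto. left; auto. }
      specialize (Hwt0 n t). specialize (Hw n). nra. }
    rewrite bsum_scal in E. lra. }
  assert (Hcp : forall k t, continuous (poisson (z k)) t) by (intros; apply cont_poisson, Hz).
  set (u0 := fun k => mean (fun t => poisson (z k) t * g t)).
  set (eta := 2 * eps / e0 * CA).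
  assert (Heta : 0 < eta).
  { unfold eta. apply Rmult_lt_0_compat; [|lra]. apply Rdiv_lt_0_compat; lra. }
  assert (Herr : forall k, (k < N)%nat -> Rabs (w k - u0 k) <= eta * w k).
  { intros k Hk.
    assert (E : w k - u0 k = mean (fun t => poisson (z k) t *
                bsum (fun n => wt n t * (w k - w n)) N)).
    { unfold u0. transitivity (w k * mean (poisson (z k)) - mean (fun t => poisson (z k) t * g t)).
      { rewrite mean_poisson by apply Hz. ring. }
      rewrite <- mean_scal, <- mean_minus; auto.
      - apply mean_ext. intros t. unfold g.
        rewrite (bsum_ext (fun n => wt n t * (w k - w n))
           (fun n => w k * wt n t + (-1) * (wt n t * w n))) by (intros; ring).
        rewrite bsum_plus, !bsum_scal.
        assert (Hs1 := wt_sum z N e Hz HN t). fold wt in Hs1. rewrite Hs1. ring.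
      - intros; apply cont_mult; auto. apply cont_const.
      - intros; apply cont_mult; auto. }
    rewrite E.
    assert (Hc1 : forall t, continuous (fun t => poisson (z k) t *
                bsum (fun n => wt n t * (w k - w n)) N) t).
    { intros. apply cont_mult; auto. apply (cont_bsum (fun n t => wt n t * (w k - w n))).
      intros. apply cont_mult; auto. apply cont_const. }
    assert (Hc2 : forall t, continuous (fun t => poisson (z k) t *
                bsum (fun n => wt n t * Rpower (hyp_exp (z n) (z k)) e0) N) t).
    { intros. apply cont_mult; auto.
      apply (cont_bsum (fun n t => wt n t * Rpower (hyp_exp (z n) (z k)) e0)).
      intros. apply cont_mult; auto. apply cont_const. }
    eapply Rle_trans; [apply mean_abs; auto|].
    apply Rle_trans with (mean (fun t => (w k * (2 * eps / e0)) * (poisson (z k) t *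
                bsum (fun n => wt n t * Rpower (hyp_exp (z n) (z k)) e0) N))).
    - apply mean_le; auto.
      + intros; apply cont_abs; auto.
      + intros; apply cont_mult; auto. apply cont_const.
      + intros t. pose proof (poisson_pos (z k) t (Hz k)) as HP.
        rewrite Rabs_mult, Rabs_pos_eq by lra.
        transitivity (poisson (z k) t * (w k * (2 * eps / e0) *
          bsum (fun n => wt n t * Rpower (hyp_exp (z n) (z k)) e0) N)); [|right; ring].
        apply Rmult_le_compat_l; [lra|].
        eapply Rle_trans; [apply bsum_abs|]. rewrite <- bsum_scal. apply bsum_le.
        intros n Hn. rewrite Rabs_mult, Rabs_pos_eq by auto.
        transitivity (wt n t * (w k * (2 * eps / e0 * Rpower (hyp_exp (z n) (z k)) e0)));
          [|right; ring].
        apply Rmult_le_compat_l; auto.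
        rewrite Rabs_minus_sym.
        eapply Rle_trans; [apply (ratio_deviation _ _ (hyp_exp (z n) (z k)) eps)|]; auto.
        * apply hyp_exp_ge_1; auto.
        * lra.
        * rewrite hyp_exp_sym by auto. auto.
        * apply Rmult_le_compat_l. left; auto.
          apply Rpower_sub_1_le; try lra. apply hyp_exp_ge_1; auto.
    - rewrite mean_scal by auto.
      assert (HM : mean (fun t => poisson (z k) t *
         bsum (fun n => wt n t * Rpower (hyp_exp (z n) (z k)) e0) N) <= CA).
      { apply (wt_moment z N e Hz HN s0 e0 C0); auto; try lra.
        - unfold e0. replace (e / 8 * (1 + / e)) with (e / 8 + / 8) by (field; lra). lra.
        - unfold e0, e. lra. }
      unfold eta. specialize (Hw k).
      assert (0 < 2 * eps / e0) by (apply Rdiv_lt_0_compat; lra).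
      transitivity (w k * (2 * eps / e0) * CA); [|right; ring].
      apply Rmult_le_compat_l; auto. left; apply Rmult_lt_0_compat; auto. }
  set (c := fun n => w n - u0 n).
  set (phi := basis z N e).
  set (F := fun x => csum (fun n => RtoC (c n) * phi n x)%C N).
  assert (HF : disc_holo F).
  { apply (disc_holo_csum (fun n x => RtoC (c n) * phi n x)%C). intros.
    apply disc_holo_scal. apply disc_holo_basis; auto. }
  assert (HFk : forall k, (k < N)%nat -> fst (F (z k)) = c k).
  { intros k Hk. unfold F. rewrite (csum_single _ N k); auto.
    - unfold phi. rewrite (basis_diag z N e d); auto. simpl. ring.
    - intros i Hi Hik. unfold phi. rewrite basis_off; auto. ring. }
  (* Only indices [s] almost selected at [t] carry weight; the Lipschitz condition gives
     [w n <= w s * hyp_exp ^ e0], the growth that [basis_sum_selected] absorbs. *)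
  assert (Hphi : forall t, bsum (fun n => w n * Cmod (phi n (cis t))) N <= K2 * g t).
  { intros t. assert (Hs1 := wt_sum z N e Hz HN t). fold wt in Hs1.
    set (A := bsum (fun n => w n * Cmod (phi n (cis t))) N).
    transitivity (A * bsum (fun s => wt s t) N); [rewrite Hs1; lra|].
    unfold g. rewrite <- !bsum_scal. apply bsum_le. intros s Hs.
    destruct (Hwt0 s t) as [Hp|Hp]; [|rewrite <- Hp; right; ring].
    transitivity (wt s t * (w s * K2)); [|right; ring].
    rewrite Rmult_comm. apply Rmult_le_compat_l; auto.
    apply Rle_trans with (w s *
      bsum (fun n => Cmod (phi n (cis t)) * Rpower (hyp_exp (z s) (z n)) e0) N).
    - rewrite <- bsum_scal. apply bsum_le. intros n Hn.
      assert (w n <= w s * Rpower (hyp_exp (z s) (z n)) e0).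
      { eapply Rle_trans; [apply (Hlip n s); auto|]. rewrite hyp_exp_sym by auto.
        apply Rmult_le_compat_l. left; auto. apply Rle_Rpower; [|lra]. apply hyp_exp_ge_1; auto. }
      pose proof (Cmod_ge_0 (phi n (cis t))). nra.
    - apply Rmult_le_compat_l. left; auto.
      apply (basis_sum_selected z N e s0 d C0); auto.
      + unfold e. lra.
      + lra.
      + unfold e0. replace (e / 8 * (1 + / e)) with (e / 8 + / 8) by (field; lra). lra.
      + intros m Hm. apply (wt_selected z N e s t m); auto. }
  assert (Heta2 : eta * K2 <= / 2).
  { unfold eta, eps.
    replace (2 * (e0 / (4 * CA * K2)) / e0 * CA * K2) with (/ 2) by (field; repeat split; lra). lra. }
  assert (HFb : forall t, Rabs (fst (F (cis t))) <= / 2 * g t).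
  { intros t. eapply Rle_trans; [apply fst_le_Cmod|]. unfold F.
    eapply Rle_trans; [apply Cmod_csum|].
    apply Rle_trans with (eta * bsum (fun n => w n * Cmod (phi n (cis t))) N).
    - rewrite <- bsum_scal. apply bsum_le. intros n Hn.
      rewrite Cmod_mult, Cmod_R. specialize (Herr n Hn). fold (c n) in Herr.
      pose proof (Cmod_ge_0 (phi n (cis t))). nra.
    - specialize (Hphi t). specialize (Hg t).
      apply Rle_trans with (eta * (K2 * g t)); [apply Rmult_le_compat_l; lra|]. nra. }
  assert (HcF : forall t, continuous (fun t => fst (F (cis t))) t) by (intros; apply HF).
  exists (fun t => g t + fst (F (cis t))). repeat split.
  - intros; apply cont_plus; auto.
  - intros t. specialize (HFb t). specialize (Hg t). apply Rabs_le_between in HFb. lra.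
  - intros k Hk.
    rewrite (mean_ext _ (fun t => poisson (z k) t * g t + poisson (z k) t * fst (F (cis t))))
      by (intros; ring).
    rewrite mean_plus, disc_holo_mean, HFk; auto.
    + unfold c, u0. ring.
    + apply Hz.
    + intros; apply cont_mult; auto.
    + intros; apply cont_mult; auto.
Qed.

(** * Real parts of power series *)

(** Radius of convergence at least 1, expressed by boundedness so that it passes easily to formal
    derivatives. *)
Definition tame (m : nat -> R) : Prop :=
  forall r, 0 < r < 1 -> exists K, forall j, m j * r ^ j <= K.

Lemma mul_pow_bounded (q : R) (j : nat) : 0 <= q < 1 -> INR j * q ^ j <= / (1 - q).
Proof.
  intros Hq. assert (H : INR j * q ^ j * (1 - q) <= 1 - q ^ j).
  { induction j as [|j IH]. simpl; lra.
    rewrite S_INR. simpl.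
    pose proof (pow_le q j ltac:(lra)). pose proof (pow_incr q 1 j ltac:(lra)) as H1.
    rewrite pow1 in H1. pose proof (pos_INR j).
    assert ((INR j + 1) * (q * q ^ j) * (1 - q)
      = q * (INR j * q ^ j * (1 - q)) + q * q ^ j * (1 - q)) by ring.
    assert (q * (INR j * q ^ j * (1 - q)) <= q * (1 - q ^ j)) by (apply Rmult_le_compat_l; lra).
    assert (0 <= (1 - q) * (1 - q * q ^ j)).
    { apply Rmult_le_pos; [lra|]. nra. }
    nra. }
  apply Rmult_le_reg_r with (1 - q); [lra|]. rewrite Rinv_l by lra.
  pose proof (pow_le q j ltac:(lra)). lra.
Qed.

Lemma tame_mul_index (m : nat -> R) : (forall j, 0 <= m j) -> tame m -> tame (fun j => INR j * m j).
Proof.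
  intros H0 H r Hr. set (r' := (1 + r) / 2). destruct (H r') as [K HK]; [unfold r'; lra|].
  assert (Hr' : 0 < r' < 1) by (unfold r'; lra).
  assert (Hq : 0 <= r / r' < 1).
  { split. left; apply Rdiv_lt_0_compat; lra. apply Rmult_lt_reg_r with r'; [lra|].
    unfold Rdiv. rewrite Rmult_assoc, Rinv_l; unfold r' in *; lra. }
  exists (K * / (1 - r / r')). intros j.
  replace (INR j * m j * r ^ j) with ((m j * r' ^ j) * (INR j * (r / r') ^ j)).
  - pose proof (H0 j). pose proof (pow_lt r' j ltac:(lra)).
    apply Rmult_le_compat; auto. nra. apply Rmult_le_pos. apply pos_INR. apply pow_le; lra.
    apply mul_pow_bounded; auto.
  - unfold Rdiv. rewrite Rpow_mult_distr, pow_inv. field. apply pow_nonzero; lra.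
Qed.

Lemma tame_shift (m : nat -> R) : (forall j, 0 <= m j) -> tame m -> tame (fun j => m (S j)).
Proof.
  intros H0 H r Hr. destruct (H r Hr) as [K HK]. exists (K / r). intros j.
  specialize (HK (S j)). simpl in HK.
  apply Rmult_le_reg_r with r; [lra|]. unfold Rdiv. rewrite (Rmult_assoc K), Rinv_l; lra.
Qed.

Lemma tame_series (m : nat -> R) (R0 : R) : (forall j, 0 <= m j) -> tame m -> 0 <= R0 < 1 ->
  ex_series (fun j => m j * R0 ^ j).
Proof.
  intros H0 H HR. set (r := (1 + R0) / 2). destruct (H r) as [K HK]; [unfold r; lra|].
  assert (Hr : 0 < r < 1) by (unfold r; lra).
  assert (Hq : 0 <= R0 / r < 1).
  { split. apply Rmult_le_pos. lra. left; apply Rinv_0_lt_compat; lra.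
    apply Rmult_lt_reg_r with r; [lra|].
    unfold Rdiv. rewrite Rmult_assoc, Rinv_l; unfold r in *; lra. }
  apply (ex_series_le (V := R_CompleteNormedModule) _ (fun j => K * (R0 / r) ^ j)).
  - intros j. pose proof (pow_le R0 j ltac:(lra)). pose proof (pow_lt r j ltac:(lra)).
    change (norm (m j * R0 ^ j)) with (Rabs (m j * R0 ^ j)).
    rewrite Rabs_pos_eq by (apply Rmult_le_pos; auto).
    unfold Rdiv. rewrite Rpow_mult_distr, pow_inv.
    apply Rle_trans with ((m j * r ^ j) * (R0 ^ j * / r ^ j)). right; field; lra.
    apply Rmult_le_compat_r; auto. apply Rmult_le_pos; auto. left; apply Rinv_0_lt_compat; auto.
  - apply (ex_series_scal_l (K := R_AbsRing) (V := R_NormedModule) K). apply ex_series_geom. rewrite Rabs_pos_eq; lra.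
Qed.

Definition CSeries (a : nat -> C) : C := (Series (fun j => fst (a j)), Series (fun j => snd (a j))).

Definition abs_conv (a : nat -> C) : Prop := ex_series (fun j => Cmod (a j)).

Lemma abs_conv_fst a : abs_conv a -> ex_series (fun j => Rabs (fst (a j))).
Proof.
  apply (ex_series_le (V := R_CompleteNormedModule)). intros j.
  change (norm (Rabs (fst (a j)))) with (Rabs (Rabs (fst (a j)))).
  rewrite Rabs_Rabsolu. apply fst_le_Cmod.
Qed.

Lemma abs_conv_snd a : abs_conv a -> ex_series (fun j => Rabs (snd (a j))).
Proof.
  apply (ex_series_le (V := R_CompleteNormedModule)). intros j.
  change (norm (Rabs (snd (a j)))) with (Rabs (Rabs (snd (a j)))).
  rewrite Rabs_Rabsolu. apply snd_le_Cmod.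
Qed.

Lemma Series_abs_le (f m : nat -> R) : (forall j, Rabs (f j) <= m j) -> ex_series m ->
  Rabs (Series f) <= Series m.
Proof.
  intros H Hm.
  assert (Hf : ex_series (fun j => Rabs (f j))).
  { apply (ex_series_le (V := R_CompleteNormedModule) _ m); auto. intros j.
    change (norm (Rabs (f j))) with (Rabs (Rabs (f j))). rewrite Rabs_Rabsolu; auto. }
  eapply Rle_trans; [apply Series_Rabs; auto|]. apply Series_le; auto.
  intros j; split; auto. apply Rabs_pos.
Qed.

Lemma CSeries_bound (a : nat -> C) (m : nat -> R) : (forall j, Cmod (a j) <= m j) -> ex_series m ->
  Cmod (CSeries a) <= 2 * Series m.
Proof.
  intros H Hm. eapply Rle_trans; [apply Cmod_le_abs|]. unfold CSeries; cbn [fst snd].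
  assert (Rabs (Series (fun j => fst (a j))) <= Series m).
  { apply Series_abs_le; auto. intros; eapply Rle_trans; [apply fst_le_Cmod|auto]. }
  assert (Rabs (Series (fun j => snd (a j))) <= Series m).
  { apply Series_abs_le; auto. intros; eapply Rle_trans; [apply snd_le_Cmod|auto]. }
  lra.
Qed.

Lemma CSeries_ext a b : (forall j, a j = b j) -> CSeries a = CSeries b.
Proof. intros H. unfold CSeries. f_equal; apply Series_ext; intros; rewrite H; auto. Qed.

Lemma CSeries_minus a b : abs_conv a -> abs_conv b ->
  CSeries (fun j => a j - b j)%C = (CSeries a - CSeries b)%C.
Proof.
  intros Ha Hb. unfold CSeries, Cminus, Cplus, Copp; simpl. f_equal.
  - apply (Series_minus (fun j => fst (a j)) (fun j => fst (b j)));
      apply ex_series_Rabs, abs_conv_fst; auto.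
  - apply (Series_minus (fun j => snd (a j)) (fun j => snd (b j)));
      apply ex_series_Rabs, abs_conv_snd; auto.
Qed.

Lemma CSeries_scal c a : abs_conv a -> CSeries (fun j => c * a j)%C = (c * CSeries a)%C.
Proof.
  intros Ha.
  assert (H1 : ex_series (fun j => fst (a j))) by (apply ex_series_Rabs, abs_conv_fst; auto).
  assert (H2 : ex_series (fun j => snd (a j))) by (apply ex_series_Rabs, abs_conv_snd; auto).
  unfold CSeries, Cmult; simpl. f_equal; rewrite <- !Series_scal_l.
  - rewrite <- Series_minus. reflexivity. apply (ex_series_scal_l (K := R_AbsRing) (V := R_NormedModule) (fst c)); auto.
    apply (ex_series_scal_l (K := R_AbsRing) (V := R_NormedModule) (snd c)); auto.
  - rewrite <- Series_plus. reflexivity. apply (ex_series_scal_l (K := R_AbsRing) (V := R_NormedModule) (fst c)); auto.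
    apply (ex_series_scal_l (K := R_AbsRing) (V := R_NormedModule) (snd c)); auto.
Qed.

Lemma CSeries_shift a : abs_conv a -> a O = RtoC 0 -> CSeries a = CSeries (fun j => a (S j)).
Proof.
  intros Ha H0. unfold CSeries. f_equal.
  - rewrite (Series_incr_1 (fun j => fst (a j))). rewrite H0. simpl; ring.
    apply ex_series_Rabs, abs_conv_fst; auto.
  - rewrite (Series_incr_1 (fun j => snd (a j))). rewrite H0. simpl; ring.
    apply ex_series_Rabs, abs_conv_snd; auto.
Qed.

Lemma abs_conv_le a (m : nat -> R) : (forall j, Cmod (a j) <= m j) -> ex_series m -> abs_conv a.
Proof.
  intros H Hm. apply (ex_series_le (V := R_CompleteNormedModule) _ m); auto. intros j.
  change (norm (Cmod (a j))) with (Rabs (Cmod (a j))).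
  rewrite Rabs_pos_eq; auto. apply Cmod_ge_0.
Qed.

Definition ctame (c : nat -> C) : Prop := tame (fun j => Cmod (c j)).

Definition power_series (c : nat -> C) (z : C) : C := CSeries (fun j => c j * z ^ j)%C.

Definition cderive (c : nat -> C) (j : nat) : C := (RtoC (INR (S j)) * c (S j))%C.

Lemma Cmod_INR n : Cmod (RtoC (INR n)) = INR n.
Proof. rewrite Cmod_R, Rabs_pos_eq; auto. apply pos_INR. Qed.

Lemma ctame_cderive c : ctame c -> ctame (cderive c).
Proof.
  intros H. intros r Hr.
  destruct (tame_shift (fun j => INR j * Cmod (c j))) with (r := r) as [K HK]; auto.
  - intros; apply Rmult_le_pos. apply pos_INR. apply Cmod_ge_0.
  - apply tame_mul_index; auto. intros; apply Cmod_ge_0.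
  - exists K. intros j. unfold cderive. rewrite Cmod_mult, Cmod_INR. apply HK.
Qed.

Lemma ctame_scal a c : ctame c -> ctame (fun j => a * c j)%C.
Proof.
  intros H r Hr. destruct (H r Hr) as [K HK]. exists (Cmod a * K). intros j.
  rewrite Cmod_mult, Rmult_assoc. apply Rmult_le_compat_l; auto. apply Cmod_ge_0.
Qed.

Lemma power_series_abs_conv c z : ctame c -> Cmod z < 1 -> abs_conv (fun j => c j * z ^ j)%C.
Proof.
  intros H Hz. apply (abs_conv_le _ (fun j => Cmod (c j) * Cmod z ^ j)).
  - intros; rewrite Cmod_mult, Cmod_pow; lra.
  - apply tame_series; auto. intros; apply Cmod_ge_0. split; auto. apply Cmod_ge_0.
Qed.

Lemma power_series_scal a c z : ctame c -> Cmod z < 1 ->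
  power_series (fun j => a * c j)%C z = (a * power_series c z)%C.
Proof.
  intros H Hz. unfold power_series. rewrite <- CSeries_scal by (apply power_series_abs_conv; auto).
  apply CSeries_ext. intros; ring.
Qed.

(** The hypothesis [/ 2 <= r] trades [r ^ pred j] for [4 * r ^ S j], and the new term, of size
    [4 * j], fits into the step from [4 * j ^ 2] to [4 * (j + 1) ^ 2]. *)
Lemma pow_taylor (z h : C) (r : R) (j : nat) : / 2 <= r -> Cmod z <= r -> Cmod (z + h) <= r ->
  Cmod ((z + h) ^ j - z ^ j - RtoC (INR j) * z ^ pred j * h) <= 4 * INR j ^ 2 * r ^ j * Cmod h ^ 2.
Proof.
  intros Hr Hz Hzh. induction j as [|j IH].
  - simpl. replace (1 - 1 - 0 * 1 * h)%C with (RtoC 0) by ring. rewrite Cmod_0. lra.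
  - set (T := ((z + h) ^ j - z ^ j - RtoC (INR j) * z ^ pred j * h)%C) in *.
    assert (E : ((z + h) ^ S j - z ^ S j - RtoC (INR (S j)) * z ^ pred (S j) * h)%C =
                ((z + h) * T + RtoC (INR j) * z ^ pred j * h ^ 2)%C).
    { unfold T. rewrite S_INR, RtoC_plus. destruct j as [|j]; simpl; ring. }
    rewrite E. eapply Rle_trans; [apply Cmod_triangle|].
    rewrite !Cmod_mult, !Cmod_pow, Cmod_INR.
    assert (H1 : Cmod (z + h) * Cmod T <= r * (4 * INR j ^ 2 * r ^ j * Cmod h ^ 2)).
    { apply Rmult_le_compat; auto; apply Cmod_ge_0. }
    assert (H2 : INR j * Cmod z ^ pred j * Cmod h ^ 2 <= INR j * (4 * r ^ S j) * Cmod h ^ 2).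
    { apply Rmult_le_compat_r. apply pow2_ge_0.
      destruct j as [|j]; [simpl; lra|]. apply Rmult_le_compat_l. apply pos_INR.
      simpl pred. apply Rle_trans with (r ^ j).
      apply pow_incr; split; auto; apply Cmod_ge_0.
      simpl. pose proof (pow_le r j ltac:(lra)).
      assert (1 <= 4 * (r * r)) by nra. nra. }
    eapply Rle_trans; [apply Rplus_le_compat; [apply H1|apply H2]|].
    rewrite S_INR. simpl. pose proof (pow_le r j ltac:(lra)). pose proof (pow2_ge_0 (Cmod h)) as Hh.
    simpl in Hh. pose proof (pos_INR j).
    assert (0 <= r * r ^ j * (Cmod h * (Cmod h * 1))).
    { apply Rmult_le_pos; auto. apply Rmult_le_pos; lra. }
    nra.
Qed.

(** A quadratic remainder that is uniform in the direction of [h] gives at once continuity and both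
    partial derivatives of the real part, along real and along imaginary increments. *)
Lemma power_series_taylor c z r : ctame c -> / 2 <= r < 1 -> Cmod z <= r ->
  exists Q, 0 <= Q /\ forall h, Cmod (z + h) <= r ->
  Cmod (power_series c (z + h) - power_series c z - power_series (cderive c) z * h) <= Q * Cmod h ^ 2.
Proof.
  intros Hc Hr Hz.
  set (m := fun j => INR j * (INR j * Cmod (c j))).
  assert (Hm0 : forall j, 0 <= INR j * Cmod (c j)).
  { intros; apply Rmult_le_pos. apply pos_INR. apply Cmod_ge_0. }
  assert (Hm : ex_series (fun j => m j * r ^ j)).
  { apply tame_series; [| |lra].
    - intros; apply Rmult_le_pos; auto. apply pos_INR.
    - apply tame_mul_index; auto. apply tame_mul_index; auto. intros; apply Cmod_ge_0. }
  exists (2 * (4 * Series (fun j => m j * r ^ j))). split.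
  { apply Rmult_le_pos; [lra|]. apply Rmult_le_pos; [lra|].
    assert (H0 : Series (fun _ => 0) <= Series (fun j => m j * r ^ j)).
    { apply Series_le; auto. intros j; split; [lra|]. apply Rmult_le_pos.
      apply Rmult_le_pos; auto. apply pos_INR. apply pow_le; lra. }
    rewrite (Series_ext _ (fun _ => 0 * 0)) in H0 by (intros; ring).
    rewrite Series_scal_l, Rmult_0_l in H0. auto. }
  intros h Hh.
  assert (A1 : abs_conv (fun j => c j * (z + h) ^ j)%C) by (apply power_series_abs_conv; auto; lra).
  assert (A2 : abs_conv (fun j => c j * z ^ j)%C) by (apply power_series_abs_conv; auto; lra).
  assert (A3 : abs_conv (fun j => RtoC (INR j) * c j * z ^ pred j * h)%C).
  { apply (abs_conv_le _ (fun j => (INR j * Cmod (c j)) * r ^ j * (2 * Cmod h))).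
    - intros j. rewrite !Cmod_mult, Cmod_INR, Cmod_pow.
      assert (INR j * Cmod (c j) * Cmod z ^ pred j <= INR j * Cmod (c j) * r ^ j * 2).
      { rewrite (Rmult_assoc _ (r ^ j)). destruct j as [|j]; [simpl; lra|].
        apply Rmult_le_compat_l; auto. simpl pred. apply Rle_trans with (r ^ j).
        apply pow_incr; split; auto; apply Cmod_ge_0.
        simpl. pose proof (pow_le r j ltac:(lra)). nra. }
      pose proof (Cmod_ge_0 h). nra.
    - apply ex_series_scal_r. apply tame_series; [auto| |lra].
      apply tame_mul_index; auto. intros; apply Cmod_ge_0. }
  assert (E3 : (power_series (cderive c) z * h)%C =
               CSeries (fun j => RtoC (INR j) * c j * z ^ pred j * h)%C).
  { rewrite CSeries_shift; auto. 2: simpl; ring.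
    unfold power_series. rewrite Cmult_comm, <- CSeries_scal.
    - apply CSeries_ext. intros j. unfold cderive. simpl pred. ring.
    - apply power_series_abs_conv. apply ctame_cderive; auto. lra. }
  rewrite E3. unfold power_series.
  rewrite <- CSeries_minus by auto.
  rewrite <- CSeries_minus; auto.
  2:{ apply (abs_conv_le _ (fun j => Cmod (c j * (z + h) ^ j) + Cmod (c j * z ^ j))).
      intros; apply Cmod_triangle_minus. apply (ex_series_plus (V := R_NormedModule)); auto. }
  eapply Rle_trans.
  { apply (CSeries_bound _ (fun j => 4 * (m j * r ^ j) * Cmod h ^ 2)).
    - intros j.
      replace (c j * (z + h) ^ j - c j * z ^ j - RtoC (INR j) * c j * z ^ pred j * h)%C
        with (c j * ((z + h) ^ j - z ^ j - RtoC (INR j) * z ^ pred j * h))%C by ring.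
      rewrite Cmod_mult. unfold m.
      eapply Rle_trans; [apply Rmult_le_compat_l;
        [apply Cmod_ge_0|apply (pow_taylor z h r); auto; lra]|].
      right. ring.
    - apply ex_series_scal_r. apply (ex_series_scal_l (K := R_AbsRing) (V := R_NormedModule) 4). auto. }
  rewrite Series_scal_r, Series_scal_l. right; ring.
Qed.

Lemma is_derive_of_taylor (f : R -> R) (x l Q eta : R) : 0 < eta -> 0 <= Q ->
  (forall h, Rabs h < eta -> Rabs (f (x + h) - f x - l * h) <= Q * h ^ 2) -> is_derive f x l.
Proof.
  intros He HQ H. apply is_derive_Reals. intros eps Heps.
  assert (Hd : 0 < Rmin eta (eps / (Q + 1))).
  { apply Rmin_pos; auto. apply Rdiv_lt_0_compat; lra. }
  exists (mkposreal _ Hd). simpl. intros h Hh Hhd.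
  assert (Rabs h < eta) by (eapply Rlt_le_trans; [apply Hhd|apply Rmin_l]).
  assert (Hh2 : Rabs h < eps / (Q + 1)) by (eapply Rlt_le_trans; [apply Hhd|apply Rmin_r]).
  assert (Hp : 0 < Rabs h) by (apply Rabs_pos_lt; auto).
  replace ((f (x + h) - f x) / h - l) with ((f (x + h) - f x - l * h) / h) by (field; auto).
  unfold Rdiv. rewrite Rabs_mult, Rabs_inv.
  apply Rmult_lt_reg_r with (Rabs h); auto. rewrite Rmult_assoc, Rinv_l, Rmult_1_r by lra.
  eapply Rle_lt_trans; [apply H; auto|].
  rewrite <- (pow2_abs h).
  assert (Rabs h * (Q + 1) < eps).
  { apply Rmult_lt_compat_r with (r := Q + 1) in Hh2; [|lra].
    unfold Rdiv in Hh2. rewrite Rmult_assoc, Rinv_l in Hh2; lra. }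
  nra.
Qed.

Definition re_series (c : nat -> C) (x y : R) : R := fst (power_series c (x, y)).

Lemma disc_room (z : C) : Cmod z < 1 -> exists r eta, / 2 <= r < 1 /\ 0 < eta /\ Cmod z <= r /\
  forall h, Cmod h < eta -> Cmod (z + h) <= r.
Proof.
  intros Hz. pose proof (Cmod_ge_0 z).
  exists ((1 + Cmod z) / 2), ((1 - Cmod z) / 2). repeat split; try lra.
  intros h Hh. eapply Rle_trans; [apply Cmod_triangle|]. lra.
Qed.

Lemma is_derive_re_series_x c x y : ctame c -> in_disc (x, y) ->
  is_derive (fun t => re_series c t y) x (re_series (cderive c) x y).
Proof.
  intros Hc Hz. destruct (disc_room _ Hz) as (r & eta & Hr & He & Hzr & Hh).
  destruct (power_series_taylor c (x, y) r Hc Hr Hzr) as (Q & HQ & HT).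
  apply (is_derive_of_taylor _ _ _ Q eta); auto.
  intros h Hhe.
  assert (E : (((x, y) : C) + RtoC h)%C = (x + h, y)) by (unfold Cplus, RtoC; simpl; f_equal; ring).
  assert (Hm : Cmod (RtoC h) = Rabs h) by apply Cmod_R.
  specialize (HT (RtoC h) (Hh (RtoC h) ltac:(rewrite Hm; auto))).
  rewrite E, Hm, pow2_abs in HT.
  eapply Rle_trans; [|apply HT]. eapply Rle_trans; [|apply fst_le_Cmod].
  right. f_equal. unfold re_series. simpl. ring.
Qed.

Lemma is_derive_re_series_y c x y : ctame c -> in_disc (x, y) ->
  is_derive (fun t => re_series c x t) y (re_series (fun j => Ci * cderive c j)%C x y).
Proof.
  intros Hc Hz. destruct (disc_room _ Hz) as (r & eta & Hr & He & Hzr & Hh).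
  destruct (power_series_taylor c (x, y) r Hc Hr Hzr) as (Q & HQ & HT).
  apply (is_derive_of_taylor _ _ _ Q eta); auto.
  intros h Hhe.
  assert (E : (((x, y) : C) + Ci * RtoC h)%C = (x, y + h))
    by (unfold Cplus, Cmult, Ci, RtoC; simpl; f_equal; ring).
  assert (Hm : Cmod (Ci * RtoC h) = Rabs h) by (rewrite Cmod_mult, Cmod_Ci, Cmod_R; ring).
  specialize (HT (Ci * RtoC h)%C (Hh (Ci * RtoC h)%C ltac:(rewrite Hm; auto))).
  rewrite E, Hm, pow2_abs in HT.
  eapply Rle_trans; [|apply HT]. eapply Rle_trans; [|apply fst_le_Cmod].
  right. f_equal. unfold re_series.
  rewrite power_series_scal by (auto; apply ctame_cderive; auto).
  simpl. ring.
Qed.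

Lemma continuity_re_series c x y : ctame c -> in_disc (x, y) ->
  continuity_2d_pt (re_series c) x y.
Proof.
  intros Hc Hz eps. destruct (disc_room _ Hz) as (r & eta & Hr & He & Hzr & Hh).
  destruct (power_series_taylor c (x, y) r Hc Hr Hzr) as (Q & HQ & HT).
  set (D := Cmod (power_series (cderive c) (x, y))).
  assert (HD : 0 <= D) by apply Cmod_ge_0.
  assert (Hd : 0 < Rmin (eta / 2) (eps / (2 * (Q * eta + D + 1)))).
  { apply Rmin_pos; [lra|]. apply Rdiv_lt_0_compat. apply cond_pos. nra. }
  exists (mkposreal _ Hd). simpl. intros u v Hu Hv.
  set (h := ((u, v) - (x, y))%C).
  set (dl := Rmin (eta / 2) (eps / (2 * (Q * eta + D + 1)))) in *.
  assert (Hmh : Cmod h < 2 * dl).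
  { eapply Rle_lt_trans; [apply Cmod_le_abs|]. unfold h; simpl.
    replace (u + - x) with (u - x) by ring. replace (v + - y) with (v - y) by ring. lra. }
  assert (dl <= eta / 2) by apply Rmin_l.
  assert (Hdl2 : dl <= eps / (2 * (Q * eta + D + 1))) by apply Rmin_r.
  assert (E : ((x, y) + h)%C = (u, v)) by (unfold h; ring).
  specialize (HT h (Hh h ltac:(lra))). rewrite E in HT.
  assert (HF : Cmod (power_series c (u, v) - power_series c (x, y)) <= Q * Cmod h ^ 2 + D * Cmod h).
  { replace (power_series c (u, v) - power_series c (x, y))%C with
     (power_series c (u, v) - power_series c (x, y) - power_series (cderive c) (x, y) * h
      + power_series (cderive c) (x, y) * h)%C by ring.
    eapply Rle_trans; [apply Cmod_triangle|]. rewrite (Cmod_mult _ h). unfold D. lra. }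
  apply Rle_lt_trans with (Cmod (power_series c (u, v) - power_series c (x, y))).
  { eapply Rle_trans; [|apply fst_le_Cmod]. right. unfold re_series. simpl. f_equal; try ring. }
  eapply Rle_lt_trans; [apply HF|].
  pose proof (Cmod_ge_0 h).
  assert (Hqe : 0 <= Q * eta) by nra.
  apply Rle_lt_trans with ((Q * eta + D) * Cmod h).
  { assert (Q * Cmod h ^ 2 <= Q * (eta * Cmod h)); [|nra].
    apply Rmult_le_compat_l; auto. nra. }
  apply Rmult_le_compat_r with (r := 2 * (Q * eta + D + 1)) in Hdl2; [|lra].
  unfold Rdiv in Hdl2. rewrite Rmult_assoc, Rinv_l, Rmult_1_r in Hdl2 by lra.
  pose proof (cond_pos eps). nra.
Qed.

Lemma locally_2d_disc x y : in_disc (x, y) -> locally_2d (fun u v => in_disc (u, v)) x y.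
Proof.
  intros Hz. red in Hz. assert (Hd : 0 < (1 - Cmod (x, y)) / 2) by lra.
  exists (mkposreal _ Hd). simpl. intros u v Hu Hv. red.
  replace ((u, v) : C) with (Cplus (x, y) (u - x, v - y)).
  2:{ unfold Cplus; simpl; f_equal; ring. }
  eapply Rle_lt_trans; [apply Cmod_triangle|].
  pose proof (Cmod_le_abs (u - x, v - y)). simpl in H. lra.
Qed.

Lemma locally_disc_x x y : in_disc (x, y) -> locally x (fun u => in_disc (u, y)).
Proof.
  intros Hz. destruct (locally_2d_disc x y Hz) as [d Hd]. exists d. intros u Hu. apply Hd. apply Hu.
  rewrite Rminus_diag, Rabs_R0. apply cond_pos.
Qed.

Lemma locally_disc_y x y : in_disc (x, y) -> locally y (fun v => in_disc (x, v)).
Proof.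
  intros Hz. destruct (locally_2d_disc x y Hz) as [d Hd]. exists d. intros v Hv. apply Hd; [|apply Hv].
  rewrite Rminus_diag, Rabs_R0. apply cond_pos.
Qed.

Lemma ctame_cderive_i c : ctame c -> ctame (fun j => Ci * cderive c j)%C.
Proof. intros; apply ctame_scal, ctame_cderive; auto. Qed.

(** The partial derivatives of [re_series c] are again real parts of power series, with coefficients
    [cderive c] and [Ci * cderive c], so the induction runs over all [c] at once. *)
Lemma ex_diff_n_re_series n c x y : ctame c -> in_disc (x, y) -> ex_diff_n (re_series c) n x y.
Proof.
  revert c x y. induction n as [|n IH]; intros c x y Hc Hz; simpl.
  - split; auto. apply continuity_re_series; auto.
  - split; [apply continuity_re_series; auto|]. repeat split.
    + eexists; apply is_derive_re_series_x; auto.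
    + eexists; apply is_derive_re_series_y; auto.
    + apply (ex_diff_n_ext_loc (re_series (cderive c))).
      * apply locally_2d_impl with (2 := locally_2d_disc x y Hz). apply locally_2d_forall.
        intros u v Huv. symmetry. apply is_derive_unique, is_derive_re_series_x; auto.
      * apply IH; auto. apply ctame_cderive; auto.
    + apply (ex_diff_n_ext_loc (re_series (fun j => Ci * cderive c j)%C)).
      * apply locally_2d_impl with (2 := locally_2d_disc x y Hz). apply locally_2d_forall.
        intros u v Huv. symmetry. apply is_derive_unique, is_derive_re_series_y; auto.
      * apply IH; auto. apply ctame_cderive_i; auto.
Qed.

Lemma harmonic_re_series c : ctame c -> harmonic_on_disc (fun z => fst (power_series c z)).
Proof.
  intros Hc. unfold harmonic_on_disc. cbv zeta. intros x y Hz. split.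
  - apply (ex_diff_n_re_series 2 c); auto.
  - change (partial_derive 2 0 (re_series c) x y + partial_derive 0 2 (re_series c) x y = 0).
    unfold partial_derive. simpl Derive_n.
    rewrite (Derive_ext_loc (Derive (fun t => re_series c t y)) (fun t => re_series (cderive c) t y)).
    2:{ generalize (locally_disc_x x y Hz). apply filter_imp. intros u Hu.
        apply is_derive_unique, is_derive_re_series_x; auto. }
    rewrite (Derive_ext_loc (Derive (fun t => re_series c x t))
      (fun t => re_series (fun j => Ci * cderive c j)%C x t)).
    2:{ generalize (locally_disc_y x y Hz). apply filter_imp. intros u Hu.
        apply is_derive_unique, is_derive_re_series_y; auto. }
    pose proof (ctame_cderive _ Hc) as Hc1.
    assert (Ex : Derive (fun t => re_series (cderive c) t y) x = re_series (cderive (cderive c)) x y)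
      by (apply is_derive_unique, is_derive_re_series_x; auto).
    assert (Ey : Derive (fun t => re_series (fun j => Ci * cderive c j)%C x t) y =
                 re_series (fun j => Ci * cderive (fun j => Ci * cderive c j) j)%C x y)
      by (apply is_derive_unique, is_derive_re_series_y; auto; apply ctame_cderive_i; auto).
    transitivity (re_series (cderive (cderive c)) x y +
      re_series (fun j => Ci * cderive (fun j => Ci * cderive c j) j)%C x y).
    { f_equal; [exact Ex|exact Ey]. }
    unfold re_series.
    assert (E : power_series (fun j => Ci * cderive (fun j => Ci * cderive c j) j)%C (x, y) =
                power_series (fun j => (- RtoC 1) * cderive (cderive c) j)%C (x, y)).
    { apply CSeries_ext. intros j. unfold cderive at 1.
      unfold cderive at 2. f_equal.
      transitivity (Ci * Ci * (RtoC (INR (S j)) * cderive c (S j)))%C. ring.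
      f_equal. unfold Ci, Cmult, Copp, RtoC; simpl; f_equal; ring. }
    rewrite E, power_series_scal by (auto; apply ctame_cderive; auto).
    simpl. ring.
Qed.

(** * Passage to infinitely many points *)

Lemma sort_decreasing (key : nat -> R) (l : list nat) :
  exists l', Permutation l l' /\ StronglySorted (fun i j => key j <= key i) l'.
Proof.
  induction l as [|a l (l' & HP & HS)].
  - exists nil. split; constructor.
  - assert (Hins : exists l2, Permutation (a :: l') l2 /\
                   StronglySorted (fun i j => key j <= key i) l2).
    { clear HP. induction HS as [|b l' HS IH Hb].
      - exists (a :: nil). split; auto. repeat constructor.
      - destruct (Rle_dec (key b) (key a)) as [L|L].
        + exists (a :: b :: l'). split; auto. constructor. constructor; auto.
          constructor; auto. eapply Forall_impl; [|apply Hb]. simpl. intros; lra.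
        + destruct IH as (l2 & HP2 & HS2). exists (b :: l2). split.
          * eapply perm_trans; [apply perm_swap|]. constructor; auto.
          * constructor; auto. apply (Permutation_Forall HP2). constructor; auto. lra. }
    destruct Hins as (l2 & HP2 & HS2). exists l2. split; auto.
    eapply perm_trans; [|apply HP2]. constructor; auto.
Qed.

Lemma StronglySorted_nth (key : nat -> R) (l : list nat) :
  StronglySorted (fun i j => key j <= key i) l ->
  forall i j, (i <= j)%nat -> (j < length l)%nat -> key (nth j l O) <= key (nth i l O).
Proof.
  induction 1 as [|a l HS IH Ha]; intros i j Hij Hj; simpl in Hj; [lia|].
  destruct i as [|i], j as [|j]; simpl; try lia; try lra.
  - rewrite Forall_forall in Ha. apply Ha. apply nth_In. lia.
  - apply IH; lia.
Qed.

Lemma finite_interpolation (z : nat -> C) (M al d : R) : (forall n, in_disc (z n)) ->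
  0 < d -> (forall n m, n <> m -> d <= pseudo_dist (z n) (z m)) -> 0 < M -> 0 < al < 1 ->
  (forall n l : nat, (1 <= l)%nat ->
      card_le (fun p : C => exists j : nat, p = z j /\ hyp_dist (z j) (z n) <= INR l)
              (M * Rpower 2 (al * INR l))) ->
  exists eps, 0 < eps /\ forall w : nat -> R, (forall n, 0 < w n) ->
    (forall n m, w n <= w m * Rpower (hyp_exp (z n) (z m)) eps) ->
    forall N, (0 < N)%nat -> exists v : R -> R,
      (forall t, continuous v t) /\ (forall t, 0 < v t) /\
      forall k, (k < N)%nat -> mean (fun t => poisson (z k) t * v t) = w k.
Proof.
  intros Hz Hd Hsep HM Hal Hden.
  assert (Hinj : forall n m, z n = z m -> n = m).
  { intros n m E. destruct (Nat.eq_dec n m); auto. exfalso.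
    specialize (Hsep n m n0). rewrite E, pseudo_dist_diag in Hsep by auto. lra. }
  (* Any exponent strictly between [al] and 1 would do: above [al] for the decay, below 1 for the
     construction. *)
  destruct (decay_of_density z M al ((1 + al) / 2)) as (C0 & HC0 & Hdec); auto; try lra.
  destruct (finite_interpolation_sorted ((1 + al) / 2) d C0) as (eps & Heps & Hfin); auto; try lra.
  exists eps. split; auto. intros w Hw Hlip N HN.
  destruct (sort_decreasing (fun i => defect (z i)) (seq 0 N)) as (l & HP & HS).
  assert (Hlen : length l = N) by (rewrite <- (Permutation_length HP); apply length_seq).
  assert (Hnd : NoDup l) by (apply (Permutation_NoDup HP), seq_NoDup).
  set (sg := fun i => nth i l O).
  assert (Hsg : forall i j, (i < N)%nat -> (j < N)%nat -> sg i = sg j -> i = j).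
  { intros i j Hi Hj E. apply (proj1 (NoDup_nth l O) Hnd); auto; lia. }
  destruct (Hfin (fun i => z (sg i)) N (fun i => w (sg i))) as (v & Hv1 & Hv2 & Hv3); auto.
  - intros i j Hij Hj. apply (StronglySorted_nth (fun i => defect (z i)) l HS); auto; lia.
  - exists v. repeat split; auto. intros k Hk.
    assert (Hin : In k l) by (apply (Permutation_in _ HP), in_seq; lia).
    destruct (In_nth l k O Hin) as (i & Hi & E).
    specialize (Hv3 i ltac:(lia)). unfold sg in Hv3. rewrite E in Hv3. auto.
Qed.

(** * Cluster points in countably many coordinates *)

Lemma functional_choice {A B : Type} (P : A -> B -> Prop) :
  (forall a, exists b, P a b) -> exists f, forall a, P a (f a).
Proof.
  intros H. exists (fun a => proj1_sig (constructive_indefinite_description _ (H a))).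
  intros a. apply proj2_sig.
Qed.

(** [l] is a cluster point of [x] in its first [J] coordinates. In this form one coordinate can be
    added at a time without nested subsequences. *)
Definition frequent (x : nat -> nat -> R) (l : nat -> R) (J : nat) : Prop :=
  forall eta, 0 < eta -> forall N0, exists N, (N0 <= N)%nat /\
    forall j, (j < J)%nat -> Rabs (x N j - l j) < eta.

Lemma frequent_extend (x : nat -> nat -> R) (B : R) (l : nat -> R) (J : nat) :
  (forall N j, Rabs (x N j) <= B) -> frequent x l J ->
  exists l', frequent x l' (S J) /\ forall j, (j < J)%nat -> l' j = l j.
Proof.
  intros HB Hf.
  destruct (functional_choice (fun i N => (i <= N)%nat /\
     forall j, (j < J)%nat -> Rabs (x N j - l j) < / INR (S i))) as (f & Hfc).
  { intros i. apply (Hf (/ INR (S i))). apply Rinv_0_lt_compat, lt_0_INR. lia. }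
  (* Along the indices [f i] the first [J] coordinates converge to [l], and coordinate [J] comes
     back infinitely often to its upper limit. *)
  destruct (ex_LimSup_seq (fun i => x (f i) J)) as (y & Hy).
  destruct y as [y| |].
  - exists (fun j => if Nat.eq_dec j J then y else l j). split.
    + intros eta He N0. destruct (Hy (mkposreal eta He)) as [H1 (N1 & H2)]. simpl in H1, H2.
      destruct (INR_unbounded (/ eta)) as (K & HK).
      destruct (H1 (N0 + N1 + K)%nat) as (n & Hn & H3).
      destruct (Hfc n) as [Hfn Hfj].
      exists (f n). split; [lia|]. intros j Hj.
      destruct (Nat.eq_dec j J) as [->|].
      * specialize (H2 n ltac:(lia)). apply Rabs_lt_between. lra.
      * eapply Rlt_trans; [apply Hfj; lia|].
        rewrite <- (Rinv_inv eta). apply Rinv_lt_contravar.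
        -- apply Rmult_lt_0_compat. apply Rinv_0_lt_compat; auto. apply lt_0_INR; lia.
        -- eapply Rlt_le_trans; [apply HK|]. apply le_INR. lia.
    + intros j Hj. destruct (Nat.eq_dec j J); [lia|auto].
  - exfalso. destruct (Hy B O) as (n & _ & Hn). specialize (HB (f n) J).
    apply Rabs_le_between in HB. lra.
  - exfalso. destruct (Hy (- B)) as (N & HN). specialize (HN N (le_n N)). specialize (HB (f N) J).
    apply Rabs_le_between in HB. lra.
Qed.

(** Stage [S J] keeps the first [J] coordinates of stage [J], so coordinate [j] is settled from
    stage [S j] on and the diagonal is a common cluster point. *)
Lemma frequent_limit (x : nat -> nat -> R) (B : R) : (forall N j, Rabs (x N j) <= B) ->
  exists l, forall J, frequent x l J.
Proof.
  intros HB.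
  set (next := fun J (s : {l | frequent x l J}) =>
    constructive_indefinite_description _
      (frequent_extend x B (proj1_sig s) J HB (proj2_sig s))).
  assert (H0 : frequent x (fun _ => 0) O).
  { intros eta He N0. exists N0. split; auto. intros; lia. }
  set (L := fix L J : {l | frequent x l J} :=
    match J with
    | O => exist _ (fun _ => 0) H0
    | S J => exist _ (proj1_sig (next J (L J))) (proj1 (proj2_sig (next J (L J))))
    end).
  assert (Hstep : forall J j, (j < J)%nat -> proj1_sig (L (S J)) j = proj1_sig (L J) j).
  { intros J j Hj. simpl. apply (proj2 (proj2_sig (next J (L J)))). auto. }
  assert (Hag : forall J j, (j < J)%nat -> proj1_sig (L J) j = proj1_sig (L (S j)) j).
  { induction J as [|J IH]; intros j Hj; [lia|].
    destruct (Nat.eq_dec j J) as [->|]; auto. rewrite Hstep by lia. apply IH. lia. }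
  exists (fun j => proj1_sig (L (S j)) j). intros J eta He N0.
  destruct (proj2_sig (L J) eta He N0) as (N & HN & H). exists N. split; auto.
  intros j Hj. rewrite <- (Hag J j Hj). auto.
Qed.

(** * Fourier expansion of Poisson means *)

Definition moment (v : R -> R) (j : nat) : C := meanC (fun t => RtoC (v t) * cis t ^ j)%C.

(** The coefficients in [poisson a t = 1 + 2 * Re (q + q ^ 2 + ...)] with [q = Cconj a * cis t]. *)
Definition mult_factor (j : nat) : R := match j with O => 1 | S _ => 2 end.

Lemma bsum_re_pow (q : C) (J : nat) : q <> 1 -> (1 <= J)%nat ->
  2 * fst (/ (1 - q))%C - 1 =
  bsum (fun j => mult_factor j * fst (q ^ j)%C) J + 2 * fst (q ^ J / (1 - q))%C.
Proof.
  intros Hq HJ. assert (Hn : (1 - q)%C <> 0).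
  { intros E. apply Hq. replace q with (1 - (1 - q))%C by ring. rewrite E. ring. }
  induction J as [|J IH]; [lia|]. destruct J as [|J].
  - simpl bsum. replace (/ (1 - q))%C with (1 + q ^ 1 / (1 - q))%C by (simpl; field; auto).
    simpl. ring.
  - rewrite IH by lia. change (bsum ?f (S (S J))) with (bsum f (S J) + f (S J)).
    cbv beta. simpl mult_factor.
    replace (q ^ S J / (1 - q))%C with (q ^ S J + q ^ S (S J) / (1 - q))%C
      by (simpl; field; auto).
    change (fst (q ^ S J + q ^ S (S J) / (1 - q))%C)
      with (fst (q ^ S J)%C + fst (q ^ S (S J) / (1 - q))%C). ring.
Qed.

(** The remainder after [J] terms is a geometric tail times the mass [mean v], so the truncation is
    uniform over boundary functions of bounded mass. *)
Lemma mean_poisson_expansion (v : R -> R) (a : C) (J : nat) :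
  (forall t, continuous v t) -> (forall t, 0 < v t) -> in_disc a -> (1 <= J)%nat ->
  Rabs (mean (fun t => poisson a t * v t) -
        bsum (fun j => mult_factor j * fst (Cconj a ^ j * moment v j)%C) J)
  <= 2 * Cmod a ^ J / (1 - Cmod a) * mean v.
Proof.
  intros Hc Hv Ha HJ. red in Ha.
  assert (Hq : forall t, Cmod (Cconj a * cis t) = Cmod a).
  { intros; rewrite Cmod_mult, Cmod_conj, Cmod_cis; ring. }
  assert (Hcm : forall j t, contC (fun t => RtoC (v t) * cis t ^ j)%C t).
  { intros; apply contC_mult. apply contC_RtoC; auto. apply contC_pow, contC_circle. }
  assert (Hcj : forall j t, contC (fun t => Cconj a ^ j * (RtoC (v t) * cis t ^ j))%C t).
  { intros; apply contC_mult; auto. apply contC_const. }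
  assert (Hpart : bsum (fun j => mult_factor j * fst (Cconj a ^ j * moment v j)%C) J =
     mean (fun t => v t * bsum (fun j => mult_factor j * fst ((Cconj a * cis t) ^ j)%C) J)).
  { transitivity (mean (fun t => bsum (fun j => mult_factor j *
         fst (Cconj a ^ j * (RtoC (v t) * cis t ^ j))%C) J)).
    - rewrite (mean_bsum (fun j t => mult_factor j *
         fst (Cconj a ^ j * (RtoC (v t) * cis t ^ j))%C)).
      + apply bsum_ext. intros j _. rewrite mean_scal by (intros; exact (proj1 (Hcj _ _))).
        f_equal. unfold moment. rewrite <- meanC_scal by auto. reflexivity.
      + intros; apply cont_mult. apply cont_const. exact (proj1 (Hcj _ _)).
    - apply mean_ext. intros t. rewrite <- bsum_scal. apply bsum_ext. intros j _.
      replace (Cconj a ^ j * (RtoC (v t) * cis t ^ j))%C with (RtoC (v t) * (Cconj a * cis t) ^ j)%C.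
      2:{ rewrite Cpow_mult_l. ring. }
      simpl. ring. }
  assert (Hcp : forall t, continuous (fun t => poisson a t * v t) t).
  { intros; apply cont_mult; auto. apply cont_poisson; auto. }
  assert (Hcs : forall t, continuous (fun t => v t *
      bsum (fun j => mult_factor j * fst ((Cconj a * cis t) ^ j)%C) J) t).
  { intros. apply cont_mult; auto.
    apply (cont_bsum (fun j t => mult_factor j * fst ((Cconj a * cis t) ^ j)%C)).
    intros. apply cont_mult. apply cont_const.
    refine (proj1 (contC_pow (fun t => Cconj a * cis t)%C _ _ _)). apply contC_mult. apply contC_const.
    apply contC_circle. }
  rewrite Hpart, <- mean_minus by auto.
  assert (Hb : forall t, Rabs (poisson a t * v t -
     v t * bsum (fun j => mult_factor j * fst ((Cconj a * cis t) ^ j)%C) J)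
     <= 2 * Cmod a ^ J / (1 - Cmod a) * v t).
  { intros t. specialize (Hq t). set (q := (Cconj a * cis t)%C) in *.
    assert (Hq1 : q <> 1) by (intros E; rewrite E, Cmod_1 in Hq; lra).
    rewrite poisson_split by auto. fold q. rewrite (bsum_re_pow q J Hq1 HJ).
    match goal with |- Rabs ?X <= _ => replace X with (v t * (2 * fst (q ^ J / (1 - q))%C)) by ring end.
    specialize (Hv t). rewrite Rabs_mult, Rabs_pos_eq by lra. rewrite (Rmult_comm _ (v t)).
    apply Rmult_le_compat_l; [lra|]. rewrite Rabs_mult, (Rabs_pos_eq 2) by lra.
    unfold Rdiv. rewrite Rmult_assoc. apply Rmult_le_compat_l; [lra|].
    eapply Rle_trans; [apply fst_le_Cmod|].
    assert (Hn : (1 - q)%C <> 0) by (apply Cmod_lt_neq; rewrite Cmod_1; lra).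
    rewrite Cmod_div, Cmod_pow, Hq by auto.
    apply Rmult_le_compat_l. apply pow_le, Cmod_ge_0.
    apply Rinv_le_contravar; [lra|].
    pose proof (Cmod_triangle_rev 1 q). rewrite Cmod_1 in H. lra. }
  rewrite <- mean_scal by auto.
  eapply Rle_trans; [apply mean_abs|apply mean_le; auto].
  - intros; apply cont_minus; auto.
  - intros; apply cont_abs, cont_minus; auto.
  - intros; apply cont_mult; auto. apply cont_const.
Qed.

Lemma bsum_sum_n (f : nat -> R) n : bsum f (S n) = sum_n f n.
Proof.
  induction n as [|n IH]. rewrite sum_O. simpl; ring.
  rewrite sum_Sn, <- IH. reflexivity.
Qed.

Lemma poisson_bounds (a : C) (t : R) : in_disc a -> defect a / 4 <= poisson a t <= 4 / defect a.
Proof.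
  intros Ha. pose proof (defect_pos a Ha) as D. pose proof (circle_sub_pos a t Ha) as P. split.
  - apply Rmult_le_compat_l; [lra|]. apply Rinv_le_contravar. apply pow_lt; auto.
    assert (Cmod (cis t - a) <= 2); [|nra].
    eapply Rle_trans; [apply Cmod_triangle_minus|]. rewrite Cmod_cis. red in Ha. lra.
  - pose proof (profile_le_4 a t Ha). unfold profile in H.
    apply le_div_of_mul; auto. lra.
Qed.

Lemma sufficiency (z : nat -> C) : (forall n, in_disc (z n)) -> separated z ->
  (exists M alpha : R, 0 < M /\ 0 < alpha < 1 /\
    forall n l : nat, (1 <= l)%nat ->
      card_le (fun p : C => exists j : nat, p = z j /\ hyp_dist (z j) (z n) <= INR l)
              (M * Rpower 2 (alpha * INR l))) ->
  interpolating z.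
Proof.
  intros Hz Hs (M & al & HM & Hal & Hden).
  destruct (separated_pseudo_dist z Hz Hs) as (d & Hd & Hsep).
  destruct (finite_interpolation z M al d Hz (proj1 Hd) Hsep HM Hal Hden) as (eps & Heps & Hfin).
  exists eps. split; auto. intros w Hw Hlog.
  pose proof ln2_pos as L2.
  assert (Hlip : forall n m, w n <= w m * Rpower (hyp_exp (z n) (z m)) eps).
  { intros n m. specialize (Hlog n m). pose proof (Hw n). pose proof (Hw m).
    assert (H1 : log2 (w n) - log2 (w m) <= eps * hyp_dist (z n) (z m))
      by (eapply Rle_trans; [apply Rle_abs|apply Hlog]).
    rewrite <- Rpower2_hyp_dist. unfold log2 in H1.
    rewrite <- (exp_ln (w n)), <- (exp_ln (w m)) by auto.
    unfold Rpower. rewrite <- exp_plus. apply exp_le.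
    apply Rmult_le_compat_r with (r := ln 2) in H1; [|lra].
    replace ((ln (w n) / ln 2 - ln (w m) / ln 2) * ln 2) with (ln (w n) - ln (w m)) in H1
      by (field; lra). lra. }
  (* [S N] points, so that [z O] is always among them. *)
  destruct (functional_choice (fun N v => (forall t, continuous v t) /\ (forall t, 0 < v t) /\
      forall k, (k < S N)%nat -> mean (fun t => poisson (z k) t * v t) = w k)) as (v & Hv).
  { intros N. apply (Hfin w Hw Hlip (S N)). lia. }
  assert (Hvc : forall N t, continuous (v N) t) by (intros; apply Hv).
  assert (Hvp : forall N t, 0 < v N t) by (intros; apply Hv).
  set (h0 := defect (z O)). assert (Hh0 : 0 < h0) by (apply defect_pos, Hz).
  (* The value [w O] at [z O] and the two-sided bound on the Poisson kernel confine all masses: the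
     upper bound gives compactness, the lower one strict positivity of the limit. *)
  assert (Hm : forall N, w O * h0 / 4 <= mean (v N) <= w O * (4 / h0)).
  { intros N. destruct (Hv N) as (_ & _ & E). specialize (E O ltac:(lia)).
    assert (Hc : forall t, continuous (fun t => poisson (z O) t * v N t) t).
    { intros; apply cont_mult; auto. apply cont_poisson, Hz. }
    split.
    - apply Rmult_le_reg_l with (4 / h0). apply Rdiv_lt_0_compat; lra.
      rewrite <- mean_scal by auto. replace (4 / h0 * (w O * h0 / 4)) with (w O) by (field; lra).
      rewrite <- E. apply mean_le; auto. intros; apply cont_mult; auto using cont_const.
      intros t. apply Rmult_le_compat_r. left; auto. apply poisson_bounds; auto.
    - apply Rmult_le_reg_l with (h0 / 4). lra.
      rewrite <- mean_scal by auto. replace (h0 / 4 * (w O * (4 / h0))) with (w O) by (field; lra).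
      rewrite <- E. apply mean_le; auto. intros; apply cont_mult; auto using cont_const.
      intros t. apply Rmult_le_compat_r. left; auto. apply poisson_bounds; auto. }
  set (Up := w O * (4 / h0)).
  assert (HUp : 0 < Up) by (apply Rmult_lt_0_compat; auto; apply Rdiv_lt_0_compat; lra).
  assert (Hmom : forall N j, Rabs (fst (moment (v N) j)) <= Up /\ Rabs (snd (moment (v N) j)) <= Up).
  { intros N j.
    assert (Hcm : forall t, contC (fun t => RtoC (v N t) * cis t ^ j)%C t).
    { intros; apply contC_mult. apply contC_RtoC; auto. apply contC_pow, contC_circle. }
    assert (Hb : forall t, Cmod (RtoC (v N t) * cis t ^ j) <= v N t).
    { intros. rewrite Cmod_mult, Cmod_pow, Cmod_cis, pow1, Cmod_R, Rabs_pos_eq; [lra|left; auto]. }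
    split; (eapply Rle_trans; [|apply (Hm N)]); (eapply Rle_trans; [apply mean_abs; intros; (apply contC_fst || apply contC_snd); apply Hcm|]);
      apply mean_le; auto.
    - intros; apply cont_abs, contC_fst, Hcm.
    - intros; eapply Rle_trans; [apply fst_le_Cmod|apply Hb].
    - intros; apply cont_abs, contC_snd, Hcm.
    - intros; eapply Rle_trans; [apply snd_le_Cmod|apply Hb]. }
  (* Real and imaginary parts of the moments are interleaved into one real sequence. *)
  set (x := fun N i => if Nat.even i then fst (moment (v N) (Nat.div2 i))
                       else snd (moment (v N) (Nat.div2 i))).
  destruct (frequent_limit x Up) as (l & Hl).
  { intros N i. unfold x. destruct (Hmom N (Nat.div2 i)); destruct (Nat.even i); assumption. }
  set (mu := fun j => ((l (2 * j)%nat, l (2 * j + 1)%nat) : C)).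
  assert (Hmu : forall eta, 0 < eta -> forall J N0, exists N, (N0 <= N)%nat /\
     forall j, (j < J)%nat -> Cmod (moment (v N) j - mu j) <= 2 * eta).
  { intros eta He J N0. destruct (Hl (2 * J)%nat eta He N0) as (N & HN & H).
    exists N. split; auto. intros j Hj. eapply Rle_trans; [apply Cmod_le_abs|].
    pose proof (H (2 * j)%nat ltac:(lia)) as H1. pose proof (H (2 * j + 1)%nat ltac:(lia)) as H2.
    unfold x in H1, H2.
    rewrite Nat.even_mul, Nat.div2_double in H1. simpl in H1.
    replace (2 * j + 1)%nat with (S (2 * j))%nat in H2 by lia.
    rewrite Nat.even_succ, Nat.odd_mul, Nat.div2_succ_double in H2. simpl in H2.
    unfold mu. simpl. unfold Rminus in *.
    replace (j + (j + 0) + 1)%nat with (S (j + (j + 0)))%nat by lia. lra. }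
  assert (Hmub : forall j, Cmod (mu j) <= 2 * Up + 2).
  { intros j. destruct (Hmu 1 ltac:(lra) (S j) O) as (N & _ & H). specialize (H j ltac:(lia)).
    destruct (Hmom N j) as [H1 H2]. pose proof (Cmod_le_abs (moment (v N) j)).
    pose proof (Cmod_triangle_rev (mu j) (moment (v N) j)) as H3.
    rewrite <- (Cmod_opp (mu j - moment (v N) j)) in H3.
    replace (- (mu j - moment (v N) j))%C with (moment (v N) j - mu j)%C in H3 by ring. lra. }
  assert (Hmf : forall j, 0 <= mult_factor j <= 2) by (intros [|j]; simpl; lra).
  (* Moving the conjugation from [a] to [mu j] leaves the real parts of the terms unchanged and
     produces a power series in [a]. *)
  set (c := fun j => (RtoC (mult_factor j) * Cconj (mu j))%C).
  assert (Hct : ctame c).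
  { intros r Hr. exists (2 * (2 * Up + 2)). intros j. unfold c.
    rewrite Cmod_mult, Cmod_conj, Cmod_R, Rabs_pos_eq by apply Hmf.
    assert (0 <= r ^ j <= 1).
    { split. apply pow_le; lra. rewrite <- (pow1 j). apply pow_incr; lra. }
    specialize (Hmub j). pose proof (Cmod_ge_0 (mu j)). destruct (Hmf j).
    assert (mult_factor j * Cmod (mu j) <= 2 * (2 * Up + 2)) by (apply Rmult_le_compat; lra).
    assert (0 <= mult_factor j * Cmod (mu j)) by (apply Rmult_le_pos; lra). nra. }
  set (u := fun p => fst (power_series c p)).
  (* The boundary functions need not converge, but their Poisson means at [a] come back close to
     [u a] for arbitrarily large [N]. The three [eta] are for the kernel tail, the moments and the
     tail of the series. *)
  assert (Happ : forall a, in_disc a -> forall eta, 0 < eta -> forall N0, exists N, (N0 <= N)%nat /\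
     Rabs (mean (fun t => poisson a t * v N t) - u a) <= 3 * eta).
  { intros a Ha eta He N0.
    assert (Hser : is_series (fun j => fst (c j * a ^ j)%C) (u a)).
    { apply Series_correct. apply ex_series_Rabs.
      apply (abs_conv_fst (fun j => c j * a ^ j)%C). apply power_series_abs_conv; auto. }
    assert (Hser2 : exists n1, forall n, (n1 <= n)%nat ->
        Rabs (bsum (fun j => fst (c j * a ^ j)%C) (S n) - u a) < eta).
    { assert (Hser3 : is_lim_seq (sum_n (fun j => fst (c j * a ^ j)%C)) (u a)) by exact Hser.
      destruct (proj2 (is_lim_seq_spec _ _) Hser3 (mkposreal eta He)) as (n1 & Hn1).
      exists n1. intros n Hn. rewrite bsum_sum_n. apply Hn1; auto. }
    destruct Hser2 as (n1 & Hn1).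
    assert (Hgeo : exists n2, forall n, (n2 <= n)%nat ->
        2 * Cmod a ^ S n / (1 - Cmod a) * Up < eta).
    { red in Ha. pose proof (Cmod_ge_0 a).
      assert (Hlim : is_lim_seq (fun n => Cmod a ^ n) 0).
      { apply is_lim_seq_geom. rewrite Rabs_pos_eq; auto. }
      set (K := 2 / (1 - Cmod a) * Up).
      assert (HK : 0 < K) by (apply Rmult_lt_0_compat; auto; apply Rdiv_lt_0_compat; lra).
      assert (HeK : 0 < eta / K) by (apply Rdiv_lt_0_compat; lra).
      destruct (proj2 (is_lim_seq_spec _ _) Hlim (mkposreal _ HeK)) as (n2 & Hn2).
      exists n2. intros n Hn. specialize (Hn2 (S n) ltac:(lia)). simpl in Hn2.
      rewrite Rminus_0_r in Hn2. apply Rabs_lt_between in Hn2. destruct Hn2 as [_ Hn2].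
      apply Rmult_lt_compat_r with (r := K) in Hn2; auto.
      replace (eta / K * K) with eta in Hn2 by (field; lra).
      replace (2 * Cmod a ^ S n / (1 - Cmod a) * Up) with (Cmod a * Cmod a ^ n * K); auto.
      unfold K. simpl. field. lra. }
    destruct Hgeo as (n2 & Hn2).
    set (J := S (n1 + n2)).
    assert (HJ : 0 < INR J) by (apply lt_0_INR; unfold J; lia).
    destruct (Hmu (eta / (4 * INR J)) ltac:(apply Rdiv_lt_0_compat; lra) J N0) as (N & HN & HmN).
    exists N. split; auto.
    pose proof (mean_poisson_expansion (v N) a J (Hvc N) (Hvp N) Ha ltac:(unfold J; lia)) as E1.
    assert (E1' : 2 * Cmod a ^ J / (1 - Cmod a) * mean (v N) <= eta).
    { specialize (Hn2 (n1 + n2)%nat ltac:(lia)). fold J in Hn2.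
      eapply Rle_trans; [|left; apply Hn2]. apply Rmult_le_compat_l; [|apply (Hm N)].
      red in Ha. pose proof (Cmod_ge_0 a). apply Rmult_le_pos.
      apply Rmult_le_pos; [lra|]. apply pow_le; auto. left; apply Rinv_0_lt_compat; lra. }
    specialize (Hn1 (n1 + n2)%nat ltac:(lia)). fold J in Hn1.
    assert (E2 : Rabs (bsum (fun j => mult_factor j * fst (Cconj a ^ j * moment (v N) j)%C) J -
                       bsum (fun j => fst (c j * a ^ j)%C) J) <= eta).
    { set (S1 := bsum (fun j => mult_factor j * fst (Cconj a ^ j * moment (v N) j)%C) J).
      replace (S1 - bsum (fun j => fst (c j * a ^ j)%C) J) with
        (bsum (fun j => mult_factor j * fst (Cconj a ^ j * (moment (v N) j - mu j))%C) J).
      - eapply Rle_trans; [apply bsum_abs|].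
        assert (Hk : forall k, (k <= J)%nat -> bsum (fun i => Rabs (mult_factor i *
          fst (Cconj a ^ i * (moment (v N) i - mu i))%C)) k <= INR k * (eta / INR J)).
        { induction k as [|k IH]; intros Hk. simpl; lra.
          change (bsum ?f (S k)) with (bsum f k + f k). cbv beta.
          rewrite S_INR. specialize (IH ltac:(lia)). specialize (HmN k ltac:(lia)).
          rewrite Rabs_mult, (Rabs_pos_eq (mult_factor k)) by apply Hmf.
          assert (Rabs (fst (Cconj a ^ k * (moment (v N) k - mu k))%C) <= eta / INR J / 2).
          { eapply Rle_trans; [apply fst_le_Cmod|]. rewrite Cmod_mult, Cmod_pow, Cmod_conj.
            replace (eta / INR J / 2) with (1 * (2 * (eta / (4 * INR J)))) by (field; lra).
            apply Rmult_le_compat; auto. apply pow_le, Cmod_ge_0. apply Cmod_ge_0.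
            rewrite <- (pow1 k). apply pow_incr. split. apply Cmod_ge_0. left; apply Ha. }
          destruct (Hmf k) as [F1 F2].
          pose proof (Rabs_pos (fst (Cconj a ^ k * (moment (v N) k - mu k))%C)) as HR.
          assert (mult_factor k * Rabs (fst (Cconj a ^ k * (moment (v N) k - mu k))%C)
            <= 2 * (eta / INR J / 2)) by (apply Rmult_le_compat; auto).
          lra. }
        eapply Rle_trans; [apply (Hk J); auto|]. right. field. lra.
      - unfold S1. rewrite (bsum_ext (fun j => mult_factor j * fst (Cconj a ^ j * (moment (v N) j - mu j))%C)
          (fun j => mult_factor j * fst (Cconj a ^ j * moment (v N) j)%C + (-1) * fst (c j * a ^ j)%C)).
        rewrite bsum_plus, bsum_scal. ring.
        intros j _. unfold c.
        assert (E : fst (RtoC (mult_factor j) * Cconj (mu j) * a ^ j)%C =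
                    mult_factor j * fst (Cconj a ^ j * mu j)%C).
        { rewrite <- Cpow_conj. set (q := (a ^ j)%C). simpl. ring. }
        rewrite E. set (q := (Cconj a ^ j)%C). simpl. ring. }
    apply Rabs_le_between in E1. apply Rabs_le_between in E2. apply Rabs_lt_between in Hn1.
    apply Rabs_le. lra. }
  exists u. split; [split|].
  - apply harmonic_re_series; auto.
  - intros a Ha. pose proof (defect_pos a Ha) as Da.
    set (lo := defect a / 4 * (w O * h0 / 4)).
    assert (Hlo : 0 < lo).
    { unfold lo. specialize (Hw O). apply Rmult_lt_0_compat; [lra|]. nra. }
    (* The tolerance [3 * (lo / 6)] is half of the lower bound [lo], which holds for every [N]. *)
    destruct (Happ a Ha (lo / 6) ltac:(lra) O) as (N & _ & H).
    assert (lo <= mean (fun t => poisson a t * v N t)).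
    { apply Rle_trans with (mean (fun t => defect a / 4 * v N t)).
      - rewrite mean_scal by auto. apply Rmult_le_compat_l; [lra|]. apply Hm.
      - apply mean_le.
        + intros; apply cont_mult; auto using cont_const.
        + intros; apply cont_mult; auto. apply cont_poisson; auto.
        + intros t. apply Rmult_le_compat_r. left; auto. apply poisson_bounds; auto. }
    apply Rabs_le_between in H. lra.
  - intros n. apply Rminus_diag_uniq.
    assert (Hall : forall eta, 0 < eta -> Rabs (u (z n) - w n) <= 3 * eta).
    (* Asking for [N >= n] ensures that [z n] is among the points interpolated exactly by [v N]. *)
    { intros eta He. destruct (Happ (z n) (Hz n) eta He n) as (N & HN & H).
      destruct (Hv N) as (_ & _ & E). rewrite (E n) in H by lia.
      rewrite Rabs_minus_sym. auto. }
    destruct (Req_dec (u (z n) - w n) 0) as [|Hne]; auto. exfalso.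
    apply Rabs_pos_lt in Hne. specialize (Hall (Rabs (u (z n) - w n) / 6) ltac:(lra)). lra.
Qed.

(** * The Poisson formula for harmonic functions *)

Definition curve_derive (g : R -> C) (s : R) (v : C) : Prop :=
  is_derive (fun x => fst (g x)) s (fst v) /\ is_derive (fun x => snd (g x)) s (snd v).

Lemma curve_derive_eq g s v w : v = w -> curve_derive g s v -> curve_derive g s w.
Proof. intros ->; auto. Qed.

Lemma is_derive_eq (f : R -> R) (s l l' : R) : l = l' -> is_derive f s l -> is_derive f s l'.
Proof. intros ->; auto. Qed.

Lemma curve_derive_const c s : curve_derive (fun _ => c) s 0.
Proof. split; apply (is_derive_const (V := R_NormedModule)). Qed.

Lemma curve_derive_RtoC s : curve_derive RtoC s 1.
Proof.
  split. exact (is_derive_id (K := R_AbsRing) s).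
  exact (is_derive_const (V := R_NormedModule) 0 s).
Qed.

Lemma curve_derive_plus f g s v w : curve_derive f s v -> curve_derive g s w ->
  curve_derive (fun x => f x + g x)%C s (v + w)%C.
Proof.
  intros [] []; split; simpl;
    apply (is_derive_plus (V := R_NormedModule)); auto.
Qed.

Lemma curve_derive_opp f s v : curve_derive f s v -> curve_derive (fun x => - f x)%C s (- v)%C.
Proof. intros []; split; simpl; apply (is_derive_opp (V := R_NormedModule)); auto. Qed.

Lemma is_derive_Rmult (f g : R -> R) (s a b : R) : is_derive f s a -> is_derive g s b ->
  is_derive (fun x => f x * g x) s (a * g s + f s * b).
Proof.
  intros Hf Hg. apply (is_derive_mult (K := R_AbsRing) f g); auto. intros; apply Rmult_comm.
Qed.

Lemma is_derive_Rminus (f g : R -> R) (s a b : R) : is_derive f s a -> is_derive g s b ->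
  is_derive (fun x => f x - g x) s (a - b).
Proof. apply (is_derive_minus (V := R_NormedModule)). Qed.

Lemma is_derive_Rplus (f g : R -> R) (s a b : R) : is_derive f s a -> is_derive g s b ->
  is_derive (fun x => f x + g x) s (a + b).
Proof. apply (is_derive_plus (V := R_NormedModule)). Qed.

Lemma curve_derive_mult f g s v w : curve_derive f s v -> curve_derive g s w ->
  curve_derive (fun x => f x * g x)%C s (v * g s + f s * w)%C.
Proof.
  intros [F1 F2] [G1 G2]; split; simpl.
  - eapply is_derive_eq; [|apply is_derive_Rminus; apply is_derive_Rmult; eauto]. simpl. ring.
  - eapply is_derive_eq; [|apply is_derive_Rplus; apply is_derive_Rmult; eauto]. simpl. ring.
Qed.

Lemma curve_derive_inv f s v : curve_derive f s v -> f s <> 0 ->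
  curve_derive (fun x => / f x)%C s (- (v / (f s * f s)))%C.
Proof.
  intros [F1 F2] H0.
  assert (Hd : fst (f s) * fst (f s) + snd (f s) * snd (f s) <> 0).
  { intros E. apply H0, Cmod_eq_0. pose proof (Cmod_sqr (f s)) as H.
    replace (fst (f s) ^ 2 + snd (f s) ^ 2)
      with (fst (f s) * fst (f s) + snd (f s) * snd (f s)) in H by ring.
    rewrite E in H. pose proof (Cmod_ge_0 (f s)). nra. }
  assert (HN : is_derive (fun x => fst (f x) * fst (f x) + snd (f x) * snd (f x)) s
     (fst v * fst (f s) + fst (f s) * fst v + (snd v * snd (f s) + snd (f s) * snd v))).
  { apply is_derive_Rplus; apply is_derive_Rmult; auto. }
  assert (HI := is_derive_inv _ _ _ HN Hd).
  split; simpl.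
  - apply (is_derive_ext (fun x => fst (f x) * / (fst (f x) * fst (f x) + snd (f x) * snd (f x)))).
    { intros x. unfold Rdiv. f_equal. f_equal. ring. }
    eapply is_derive_eq; [|apply is_derive_Rmult; [apply F1|apply HI]]. simpl.
    field. split; [|exact Hd].
    intros E; apply (Rmult_integral_contrapositive_currified _ _ Hd Hd).
    etransitivity; [|exact E]. ring.
  - apply (is_derive_ext (fun x => (0 - snd (f x)) * / (fst (f x) * fst (f x) + snd (f x) * snd (f x)))).
    { intros x. unfold Rdiv. f_equal. ring. f_equal. ring. }
    eapply is_derive_eq; [|apply is_derive_Rmult; [apply is_derive_Rminus;
      [apply (is_derive_const (V := R_NormedModule))|apply F2]|apply HI]].
    unfold zero; simpl.
    field. split; [|exact Hd].
    intros E; apply (Rmult_integral_contrapositive_currified _ _ Hd Hd).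
    etransitivity; [|exact E]. ring.
Qed.

(* [Q] is holomorphic on [Om] with derivative [D], tested along differentiable curves. *)
Definition curve_holo (Om : C -> Prop) (Q D : C -> C) : Prop :=
  forall g s v, Om (g s) -> curve_derive g s v -> curve_derive (fun x => Q (g x)) s (D (g s) * v)%C.

Lemma contC_comp {T : UniformSpace} (F : C -> C) (H : T -> C) x :
  contC H x -> contC F (H x) -> contC (fun y => F (H y)) x.
Proof.
  intros [H1 H2] [F1 F2].
  assert (Hpair : forall G : C -> R, continuous G (H x) -> continuous (fun y => G (H y)) x).
  { intros G HG. apply (continuous_ext (fun y => G (fst (H y), snd (H y)))).
    { intros y. rewrite <- surjective_pairing. reflexivity. }
    apply (continuous_comp_2 (fun y => fst (H y)) (fun y => snd (H y)) (fun a b => G (a, b))); auto.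
    rewrite (surjective_pairing (H x)) in HG.
    apply (continuous_ext G); auto. intros y. rewrite <- surjective_pairing. reflexivity. }
  split; [apply (Hpair (fun z => fst (F z)))|apply (Hpair (fun z => snd (F z)))]; auto.
Qed.

Lemma contC_id (z : C) : contC (fun w => w) z.
Proof. destruct z; split; [apply continuous_fst|apply continuous_snd]. Qed.

Lemma curve_derive_cont g s v : curve_derive g s v -> contC g s.
Proof.
  intros [H1 H2]. split; apply (ex_derive_continuous (V := R_NormedModule)); eexists; eauto.
Qed.

Lemma is_derive_mean (f g : R -> R -> R) (s0 eta : R) : 0 < eta ->
  (forall s t, Rabs (s - s0) < eta -> is_derive (fun s => f s t) s (g s t)) ->
  (forall t, continuous (fun p : R * R => g (fst p) (snd p)) (s0, t)) ->
  (forall s t, Rabs (s - s0) < eta -> continuous (f s) t) ->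
  is_derive (fun s => mean (f s)) s0 (mean (g s0)).
Proof.
  intros He Hd Hg Hf. unfold mean.
  assert (Hs0 : Rabs (s0 - s0) < eta) by (rewrite Rminus_diag, Rabs_R0; auto).
  apply (is_derive_scal (fun s => RInt (f s) 0 (2 * PI)) s0 (/ (2 * PI)) (RInt (g s0) 0 (2 * PI))).
  rewrite (RInt_ext (g s0) (fun t => Derive (fun s => f s t) s0)).
  2:{ intros t _. symmetry. apply is_derive_unique. auto. }
  apply is_derive_RInt_param.
  - exists (mkposreal eta He). intros s Hs t _. exists (g s t). apply Hd. apply Hs.
  - intros t _. apply (continuity_2d_pt_ext_loc g).
    + exists (mkposreal eta He). intros u v Hu _. simpl in Hu.
      symmetry. apply is_derive_unique. auto.
    + apply continuity_2d_pt_filterlim. apply Hg.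
  - exists (mkposreal eta He). intros s Hs. apply ex_mean. intros t. apply Hf. apply Hs.
Qed.

Lemma curve_derive_cis (t : R) : curve_derive cis t (Ci * cis t).
Proof.
  split; simpl.
  - apply (is_derive_eq _ _ (- sin t)); [ring|apply is_derive_cos].
  - apply (is_derive_eq _ _ (cos t)); [ring|apply is_derive_sin].
Qed.

Lemma contC_fst_snd (p : R * R) : contC (fun p : R * R => RtoC (fst p)) p /\
  contC (fun p : R * R => cis (snd p)) p.
Proof.
  destruct p as [a b]. split.
  - apply contC_RtoC. apply continuous_fst.
  - apply contC_cis. apply continuous_snd.
Qed.

(** Radial and angular derivatives are linked: [r * g r t] is the [t]-derivative of the imaginary
    part of [Q (r * cis t)], so its mean over a period vanishes, and the mean over the circle of
    radius [r] does not depend on [r]. *)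
Lemma holo_mean_value (Q D : C -> C) (R0 : R) : 1 < R0 ->
  curve_holo (fun z => Cmod z < R0) Q D ->
  (forall z, Cmod z < R0 -> contC D z) ->
  mean (fun t => fst (Q (cis t))) = fst (Q 0).
Proof.
  intros HR HQ HD.
  set (f := fun r t => fst (Q (RtoC r * cis t)%C)).
  set (g := fun r t => fst (D (RtoC r * cis t) * cis t)%C).
  assert (Hmod : forall r t, Cmod (RtoC r * cis t) = Rabs r).
  { intros. rewrite Cmod_mult, Cmod_R, Cmod_cis. ring. }
  assert (Hcr : forall r t, curve_derive (fun r => RtoC r * cis t)%C r (cis t)).
  { intros r t. eapply curve_derive_eq; [|apply curve_derive_mult; [|apply curve_derive_const]].
    2:{ apply curve_derive_RtoC. }
    cbv beta. ring. }
  assert (Hct : forall r t, curve_derive (fun t => RtoC r * cis t)%C t (RtoC r * (Ci * cis t))%C).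
  { intros r t. eapply curve_derive_eq; [|apply curve_derive_mult;
      [apply curve_derive_const|apply curve_derive_cis]]. cbv beta. ring. }
  assert (Hder : forall r, 0 <= r <= 1 -> is_derive (fun r => mean (f r)) r (mean (g r))).
  { intros r Hr. apply (is_derive_mean f g r (R0 - 1)); [lra| | |].
    - intros s t Hs. assert (Cmod (RtoC s * cis t) < R0).
      { rewrite Hmod. apply Rabs_lt_between' in Hs. apply Rabs_lt_between. lra. }
      apply (HQ _ s (cis t) H (Hcr s t)).
    - intros t. destruct (contC_fst_snd (r, t)) as [C1 C2].
      assert (Hr0 : Cmod (RtoC r * cis t) < R0) by (rewrite Hmod, Rabs_pos_eq; lra).
      refine (proj1 (contC_mult (fun p : R * R => D (RtoC (fst p) * cis (snd p)))%C
        (fun p => cis (snd p)) (r, t) _ _)); auto.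
      apply (contC_comp D (fun p : R * R => RtoC (fst p) * cis (snd p))%C); auto.
      apply contC_mult; auto.
    - intros s t Hs. assert (Cmod (RtoC s * cis t) < R0).
      { rewrite Hmod. apply Rabs_lt_between' in Hs. apply Rabs_lt_between. lra. }
      refine (proj1 (curve_derive_cont _ _ _ (HQ _ t _ H (Hct s t)))). }
  assert (Hz : forall r, 0 <= r <= 1 -> mean (g r) = 0).
  { intros r Hr.
    assert (Hr0 : forall t, Cmod (RtoC r * cis t) < R0) by (intros; rewrite Hmod, Rabs_pos_eq; lra).
    assert (Hcg : forall t, contC (fun t => D (RtoC r * cis t) * cis t)%C t).
    { intros t. apply contC_mult; [|apply contC_circle].
      apply (contC_comp D (fun t => RtoC r * cis t)%C); auto.
      apply contC_mult. apply contC_const. apply contC_circle. }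
    (* At [r = 0] the relation [r * mean (g r) = 0] says nothing, and the mean is computed
       directly. *)
    destruct (Req_dec r 0) as [->|Hne].
    - unfold g.
      transitivity (fst (D 0 * meanC (fun t => cis t ^ 1))%C).
      + rewrite <- meanC_scal by (intros; apply contC_pow, contC_circle).
        apply mean_ext. intros t. f_equal.
        replace (0 * cis t)%C with (RtoC 0) by ring. simpl. ring.
      + rewrite meanC_pow by lia. simpl. ring.
    - assert (E : r * mean (g r) = 0).
      { rewrite <- mean_scal by (intros; apply contC_fst, Hcg). unfold mean.
        assert (HI : is_RInt (fun t => r * g r t) 0 (2 * PI)
           (minus (snd (Q (RtoC r * cis (2 * PI)))) (snd (Q (RtoC r * cis 0))))%C).
        { apply (is_RInt_derive (V := R_CompleteNormedModule) (fun t => snd (Q (RtoC r * cis t)%C))).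
          - intros t _. destruct (HQ _ t _ (Hr0 t) (Hct r t)) as [_ H].
            eapply is_derive_eq; [|apply H]. unfold g. set (d := D _). simpl. ring.
          - intros t _. apply cont_mult. apply cont_const. refine (proj1 (Hcg t)). }
        rewrite (is_RInt_unique (V := R_CompleteNormedModule) _ _ _ _ HI).
        replace (cis (2 * PI)) with (cis 0).
        2:{ unfold cis. rewrite cos_2PI, sin_2PI, cos_0, sin_0. reflexivity. }
        unfold minus, plus, opp; simpl. ring. }
      apply Rmult_integral in E. tauto. }
  transitivity (mean (f 1)).
  { apply mean_ext. intros t. unfold f. f_equal. f_equal. ring. }
  transitivity (mean (f 0)).
  - symmetry. apply (eq_is_derive (V := R_NormedModule) (fun r => mean (f r))); [|lra].
    intros r Hr. eapply is_derive_eq; [|apply Hder; auto]. apply Hz; auto.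
  - rewrite <- (mean_const (fst (Q 0))). apply mean_ext. intros t. unfold f.
    f_equal. f_equal. ring.
Qed.

(* The circle of center [(1 - s) * a] and radius [s] shrinks to the point [a] as [s] goes
   to 0; the Poisson mean over it does not depend on [s], because its [s]-derivative is the
   mean of a holomorphic function vanishing at 0. *)
Lemma poisson_formula (u : C -> R) (G D : C -> C) (a : C) (R0 : R) : 1 < R0 -> Cmod a < 1 ->
  (forall g s v, Cmod (g s) < R0 -> curve_derive g s v ->
     is_derive (fun x => u (g x)) s (fst (G (g s) * v)%C)) ->
  curve_holo (fun z => Cmod z < R0) G D ->
  (forall z, Cmod z < R0 -> contC G z) -> (forall z, Cmod z < R0 -> contC D z) ->
  mean (fun t => poisson a t * u (cis t)) = u a.
Proof.
  intros HR Ha Hu HG HGc HD.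
  set (p := fun s z => (a + RtoC s * (z - a))%C).
  assert (Hp0 : forall s z rho, 0 <= s <= 1 -> Cmod z <= rho -> 1 <= rho -> Cmod (p s z) <= rho).
  { intros s z rho Hs Hz Hrho. pose proof (Cmod_ge_0 a). pose proof (Cmod_ge_0 z).
    replace (p s z) with (RtoC (1 - s) * a + RtoC s * z)%C by (unfold p; rewrite RtoC_minus; ring).
    eapply Rle_trans; [apply Cmod_triangle|]. rewrite !Cmod_mult, !Cmod_R, !Rabs_pos_eq by lra.
    nra. }
  assert (Hp1 : forall s0 s t, 0 <= s0 <= 1 -> Rabs (s - s0) < (R0 - 1) / 2 -> Cmod (p s (cis t)) < R0).
  { intros s0 s t Hs0 Hs.
    replace (p s (cis t)) with (p s0 (cis t) + RtoC (s - s0) * (cis t - a))%C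
      by (unfold p; rewrite RtoC_minus; ring).
    eapply Rle_lt_trans; [apply Cmod_triangle|]. rewrite Cmod_mult, Cmod_R.
    assert (Cmod (p s0 (cis t)) <= 1) by (apply Hp0; auto; rewrite ?Cmod_cis; lra).
    assert (Cmod (cis t - a) <= 2).
    { eapply Rle_trans; [apply Cmod_triangle_minus|]. rewrite Cmod_cis; lra. }
    pose proof (Rabs_pos (s - s0)). pose proof (Cmod_ge_0 (cis t - a)). nra. }
  assert (Hcs : forall s z, curve_derive (fun s => p s z) s (z - a)%C).
  { intros s z. unfold p. eapply curve_derive_eq; [|apply curve_derive_plus;
      [apply curve_derive_const|apply curve_derive_mult; [|apply curve_derive_const]]].
    2:{ apply curve_derive_RtoC. }
    cbv beta. ring. }
  assert (Hcz : forall s g x v, curve_derive g x v -> curve_derive (fun y => p s (g y)) x (RtoC s * v)%C).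
  { intros s g x v Hg. unfold p. eapply curve_derive_eq; [|apply curve_derive_plus;
      [apply curve_derive_const|apply curve_derive_mult; [apply curve_derive_const|
       apply curve_derive_plus; [apply Hg|apply curve_derive_const]]]]. cbv beta. ring. }
  set (J := fun s t => poisson a t * u (p s (cis t))).
  set (J' := fun s t => poisson a t * fst (G (p s (cis t)) * (cis t - a))%C).
  assert (Hder : forall s, 0 <= s <= 1 -> is_derive (fun s => mean (J s)) s (mean (J' s))).
  { intros s Hs. apply (is_derive_mean J J' s ((R0 - 1) / 2)); [lra| | |].
    - intros r t Hr. apply (is_derive_scal (fun r => u (p r (cis t)))).
      apply (Hu (fun r => p r (cis t))); auto. apply (Hp1 s); auto.
    - intros t. destruct (contC_fst_snd (s, t)) as [C1 C2].
      assert (Hc0 : Cmod (p s (cis t)) < R0) by (apply (Hp1 s); auto; rewrite Rminus_diag, Rabs_R0; lra).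
      apply (cont_mult (fun q : R * R => poisson a (snd q))
        (fun q => fst (G (p (fst q) (cis (snd q))) * (cis (snd q) - a))%C)).
      + apply (cont_comp (fun q : R * R => snd q) (poisson a)). apply continuous_snd.
        apply cont_poisson; auto.
      + refine (proj1 (contC_mult (fun q : R * R => G (p (fst q) (cis (snd q))))
          (fun q => cis (snd q) - a)%C (s, t) _ _)).
        * apply (contC_comp G (fun q : R * R => p (fst q) (cis (snd q)))); auto.
          unfold p. apply contC_plus. apply contC_const. apply contC_mult; auto.
          apply contC_minus; auto. apply contC_const.
        * apply contC_minus; auto. apply contC_const.
    - intros r t Hr. apply cont_mult. apply cont_poisson; auto.
      apply (ex_derive_continuous (V := R_NormedModule)). eexists.
      apply (Hu (fun t => p r (cis t)) t (RtoC r * (Ci * cis t))%C). apply (Hp1 s); auto.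
      apply Hcz. apply curve_derive_cis. }
  (* Within the radius [2 / (1 + Cmod a)], which still exceeds 1, the factor [1 - Cconj a * z] has
     no zero. *)
  set (R1 := Rmin R0 (2 / (1 + Cmod a))).
  pose proof (Cmod_ge_0 a) as Ha0.
  assert (HR1 : 1 < R1).
  { apply Rmin_glb_lt; auto. apply Rmult_lt_reg_r with (1 + Cmod a); [lra|].
    unfold Rdiv. rewrite Rmult_assoc, Rinv_l; lra. }
  assert (HR1a : forall z, Cmod z < R1 -> (1 - Cconj a * z)%C <> 0).
  { intros z Hz. apply Cmod_lt_neq. rewrite Cmod_mult, Cmod_conj, Cmod_1.
    assert (Hz2 : Cmod z < 2 / (1 + Cmod a)) by (eapply Rlt_le_trans; [apply Hz|apply Rmin_r]).
    apply Rmult_lt_compat_r with (r := 1 + Cmod a) in Hz2; [|lra].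
    unfold Rdiv in Hz2. rewrite Rmult_assoc, Rinv_l in Hz2 by lra. pose proof (Cmod_ge_0 z).
    destruct (Req_dec (Cmod a) 0) as [->|]; nra. }
  assert (HR1p : forall s z, 0 <= s <= 1 -> Cmod z < R1 -> Cmod (p s z) < R0).
  { intros s z Hs Hz. assert (Cmod z < R0) by (eapply Rlt_le_trans; [apply Hz|apply Rmin_l]).
    apply Rle_lt_trans with (Rmax 1 (Cmod z)).
    - apply Hp0; auto. apply Rmax_r. apply Rmax_l.
    - apply Rmax_lub_lt; auto. }
  assert (Hzero : forall s, 0 <= s <= 1 -> mean (J' s) = 0).
  { intros s Hs.
    set (K := fun z => (z * / (1 - Cconj a * z))%C).
    set (K' := fun z => (/ (1 - Cconj a * z) * / (1 - Cconj a * z))%C).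
    (* By [poisson_mul_sub] the integrand of [J'] is the real part of [Q] on the circle, and the
       factor [z] in [K] makes [Q] vanish at 0. *)
    set (Q := fun z => (RtoC (defect a) * (G (p s z) * K z))%C).
    set (Q' := fun z => (RtoC (defect a) * (D (p s z) * RtoC s * K z + G (p s z) * K' z))%C).
    assert (HcK : forall z, Cmod z < R1 -> contC (fun z => / (1 - Cconj a * z))%C z).
    { intros z Hz. apply contC_inv; auto. apply contC_minus. apply contC_const.
      apply contC_mult. apply contC_const. apply contC_id. }
    assert (Hcp : forall z, contC (p s) z).
    { intros z. unfold p. apply contC_plus. apply contC_const. apply contC_mult. apply contC_const.
      apply contC_minus. apply contC_id. apply contC_const. }
    transitivity (mean (fun t => fst (Q (cis t)))).
    - apply mean_ext. intros t. unfold J', Q, K.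
      transitivity (fst (RtoC (poisson a t) * (G (p s (cis t)) * (cis t - a)))%C).
      { simpl. ring. }
      f_equal. transitivity (RtoC (poisson a t) * (cis t - a) * G (p s (cis t)))%C; [ring|].
      rewrite poisson_mul_sub by auto. unfold Cdiv. ring.
    - rewrite (holo_mean_value Q Q' R1); auto.
      + unfold Q, K. rewrite Cmult_0_l, !Cmult_0_r. reflexivity.
      + intros g x v Hg Hgv. unfold Q.
        assert (HgK : curve_derive (fun y => K (g y)) x (K' (g x) * v)%C).
        { unfold K, K'.
          assert (H1 : curve_derive (fun y => 1 - Cconj a * g y)%C x (0 + - (0 * g x + Cconj a * v))%C).
          { apply (curve_derive_plus (fun _ => RtoC 1)). apply curve_derive_const.
            apply curve_derive_opp. apply (curve_derive_mult (fun _ => Cconj a) g); auto.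
            apply curve_derive_const. }
          eapply curve_derive_eq;
            [|apply (curve_derive_mult g _ x _ _ Hgv (curve_derive_inv _ _ _ H1 (HR1a _ Hg)))].
          cbv beta. field. auto. }
        eapply curve_derive_eq; [|apply curve_derive_mult; [apply curve_derive_const|
          apply curve_derive_mult; [|apply HgK]]].
        2:{ apply (HG (fun y => p s (g y)) x (RtoC s * v)%C); auto. }
        unfold Q'. cbv beta. ring.
      + intros z Hz. unfold Q'. apply contC_mult. apply contC_const. apply contC_plus.
        * apply contC_mult; [apply contC_mult; [|apply contC_const]|].
          apply (contC_comp D (p s)); auto.
          apply contC_mult; auto. apply contC_id.
        * apply contC_mult. apply (contC_comp G (p s)); auto. apply contC_mult; auto. }
  transitivity (mean (J 1)).
  { apply mean_ext. intros t. unfold J, p. f_equal. f_equal. ring. }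
  transitivity (mean (J 0)).
  - symmetry. apply (eq_is_derive (V := R_NormedModule) (fun r => mean (J r))); [|lra].
    intros r Hr. eapply is_derive_eq; [|apply Hder; auto]. apply Hzero; auto.
  - transitivity (mean (fun t => u a * poisson a t)).
    + apply mean_ext. intros t. unfold J, p. rewrite Rmult_comm. f_equal. f_equal. ring.
    + rewrite mean_scal, mean_poisson; auto. ring. intros; apply cont_poisson; auto.
Qed.

Definition dx (f : R -> R -> R) (x y : R) : R := Derive (fun z => f z y) x.
Definition dy (f : R -> R -> R) (x y : R) : R := Derive (fun z => f x z) y.

Lemma C1_curve (f : R -> R -> R) (g : R -> C) (s : R) (v : C) :
  (forall x y, in_disc (x, y) -> ex_diff_n f 1 x y) -> in_disc (g s) -> curve_derive g s v ->
  is_derive (fun t => f (fst (g t)) (snd (g t))) s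
    (dx f (fst (g s)) (snd (g s)) * fst v + dy f (fst (g s)) (snd (g s)) * snd v).
Proof.
  intros Hf Hg [G1 G2].
  set (x := fst (g s)) in *. set (y := snd (g s)) in *.
  assert (Hxy : in_disc (x, y)) by (unfold x, y; rewrite <- surjective_pairing; auto).
  destruct (Hf x y Hxy) as (_ & Ex & Ey & [Cx _] & _).
  apply is_derive_Reals.
  apply (derivable_pt_lim_comp_2d f (fun t => fst (g t)) (fun t => snd (g t)));
    [|apply is_derive_Reals; auto|apply is_derive_Reals; auto].
  apply filterdiff_differentiable_pt_lim. fold x y.
  eapply filterdiff_ext_lin.
  - apply (is_derive_filterdiff f x y (dx f) (dy f x y)).
    + apply (locally_2d_locally (fun a b => is_derive (fun z => f z b) a (dx f a b))).
      apply locally_2d_impl with (2 := locally_2d_disc x y Hxy). apply locally_2d_forall.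
      intros a b Hab. apply Derive_correct. apply (Hf a b Hab).
    + apply Derive_correct. auto.
    + apply continuity_2d_pt_filterlim. exact Cx.
  - intros [a b]. reflexivity.
Qed.

Lemma contC_of_2d (f g : R -> R -> R) (z : C) :
  continuity_2d_pt f (fst z) (snd z) -> continuity_2d_pt g (fst z) (snd z) ->
  contC (fun w => (f (fst w) (snd w), g (fst w) (snd w))) z.
Proof.
  intros Hf Hg. rewrite (surjective_pairing z).
  split; apply continuity_2d_pt_filterlim; auto.
Qed.

(** [G = u_x - i * u_y] is holomorphic: Laplace's equation and the symmetry of mixed derivatives are
    its Cauchy-Riemann equations, and [D] is its derivative. The dilation by [r] moves the domain
    out to radius [/ r], beyond the closed disc. *)
Lemma poisson_harmonic (u : C -> R) (r : R) (a : C) : harmonic_on_disc u -> 0 < r < 1 -> in_disc a ->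
  mean (fun t => poisson a t * u (RtoC r * cis t)%C) = u (RtoC r * a)%C.
Proof.
  intros Hu Hr Ha. unfold harmonic_on_disc in Hu. cbv zeta in Hu.
  set (f := fun x y : R => u (x, y)) in *.
  assert (H2 : forall x y, in_disc (x, y) -> ex_diff_n f 2 x y) by (intros; apply Hu; auto).
  assert (H1 : forall x y, in_disc (x, y) -> ex_diff_n f 1 x y).
  { intros x y Hxy. destruct (H2 x y Hxy) as (A & B & C0 & [D0 _] & [E0 _]).
    split; auto. repeat split; auto. }
  assert (Hx1 : forall x y, in_disc (x, y) -> ex_diff_n (dx f) 1 x y) by (intros x y Hxy; apply (H2 x y Hxy)).
  assert (Hy1 : forall x y, in_disc (x, y) -> ex_diff_n (dy f) 1 x y) by (intros x y Hxy; apply (H2 x y Hxy)).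
  assert (Hlap : forall x y, in_disc (x, y) -> dx (dx f) x y + dy (dy f) x y = 0).
  { intros x y Hxy. apply (proj2 (Hu x y Hxy)). }
  assert (Hsch : forall x y, in_disc (x, y) -> dx (dy f) x y = dy (dx f) x y).
  { intros x y Hxy. apply (Schwarz f x y).
    - apply locally_2d_impl with (2 := locally_2d_disc x y Hxy). apply locally_2d_forall.
      intros a0 b0 Hab. pose proof (H1 a0 b0 Hab) as (_ & A1 & A2 & _).
      pose proof (Hx1 a0 b0 Hab) as (_ & B1 & B2 & _). pose proof (Hy1 a0 b0 Hab) as (_ & C1 & C2 & _).
      repeat split; auto.
    - apply (Hy1 x y Hxy).
    - apply (Hx1 x y Hxy). }
  set (G := fun z : C => ((dx f (fst z) (snd z), - dy f (fst z) (snd z)) : C)).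
  set (D := fun z : C => ((dx (dx f) (fst z) (snd z), - dx (dy f) (fst z) (snd z)) : C)).
  assert (Hdisc : forall z : C, Cmod z < / r -> in_disc (RtoC r * z)).
  { intros z Hz. red. rewrite Cmod_mult, Cmod_R, Rabs_pos_eq by lra.
    apply Rmult_lt_compat_l with (r := r) in Hz; [|lra]. rewrite Rinv_r in Hz; lra. }
  assert (Hd2 : forall z : C, in_disc z -> in_disc (fst z, snd z)).
  { intros z Hz. rewrite <- surjective_pairing. auto. }
  assert (Hcr : forall g s v, curve_derive g s v -> curve_derive (fun x => RtoC r * g x)%C s (RtoC r * v)%C).
  { intros g s v Hg. eapply curve_derive_eq; [|apply (curve_derive_mult (fun _ => RtoC r) g);
      [apply curve_derive_const|apply Hg]]. cbv beta. ring. }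
  assert (Hcont : forall z : C, contC (fun w => RtoC r * w)%C z).
  { intros z. apply contC_mult. apply contC_const. apply contC_id. }
  apply (poisson_formula (fun z => u (RtoC r * z)%C) (fun z => RtoC r * G (RtoC r * z))%C
           (fun z => RtoC r * (D (RtoC r * z) * RtoC r))%C a (/ r)).
  - rewrite <- Rinv_1. apply Rinv_lt_contravar; lra.
  - apply Ha.
  - intros g s v Hg Hgv. pose proof (C1_curve f _ s _ H1 (Hdisc _ Hg) (Hcr _ _ _ Hgv)) as H.
    apply (is_derive_ext (fun x => f (fst (RtoC r * g x)%C) (snd (RtoC r * g x)%C))).
    { intros x. unfold f. rewrite <- surjective_pairing. reflexivity. }
    eapply is_derive_eq; [|apply H]. unfold G. set (w := (RtoC r * g s)%C). simpl. ring.
  - intros g s v Hg Hgv.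
    assert (Hw := Hd2 _ (Hdisc _ Hg)).
    pose proof (C1_curve (dx f) _ s _ Hx1 (Hdisc _ Hg) (Hcr _ _ _ Hgv)) as HGx.
    pose proof (C1_curve (dy f) _ s _ Hy1 (Hdisc _ Hg) (Hcr _ _ _ Hgv)) as HGy.
    assert (HG : curve_derive (fun x => G (RtoC r * g x)%C) s (D (RtoC r * g s) * (RtoC r * v))%C).
    { set (w := (RtoC r * v)%C) in *. clearbody w. set (q := (RtoC r * g s)%C) in *. clearbody q. split.
      - eapply is_derive_eq; [|apply HGx]. rewrite <- Hsch by auto. unfold D. simpl. ring.
      - eapply is_derive_eq; [|apply (is_derive_opp (V := R_NormedModule)); apply HGy].
        specialize (Hlap _ _ Hw). unfold opp; simpl. unfold D; simpl.
        replace (dy (dy f) (fst q) (snd q)) with (- dx (dx f) (fst q) (snd q)) by lra. ring. }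
    eapply curve_derive_eq; [|apply (curve_derive_mult (fun _ => RtoC r) _);
      [apply curve_derive_const|apply HG]]. cbv beta. ring.
  - intros z Hz. apply contC_mult. apply contC_const.
    apply (contC_comp G (fun z => RtoC r * z)%C); auto.
    assert (Hw := Hd2 _ (Hdisc _ Hz)).
    apply (contC_of_2d (dx f) (fun a b => - dy f a b)).
    + apply (Hx1 _ _ Hw).
    + apply continuity_2d_pt_opp. apply (Hy1 _ _ Hw).
  - intros z Hz. apply contC_mult. apply contC_const. apply contC_mult; [|apply contC_const].
    apply (contC_comp D (fun z => RtoC r * z)%C); auto.
    assert (Hw := Hd2 _ (Hdisc _ Hz)).
    apply (contC_of_2d (dx (dx f)) (fun a b => - dx (dy f) a b)).
    + apply (Hx1 _ _ Hw).
    + apply continuity_2d_pt_opp. apply (Hy1 _ _ Hw).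
Qed.

Lemma continuous_harmonic (u : C -> R) (z : C) : harmonic_on_disc u -> in_disc z ->
  continuous u z.
Proof.
  intros Hu Hz. unfold harmonic_on_disc in Hu. cbv zeta in Hu.
  rewrite (surjective_pairing z) in *. destruct (Hu _ _ Hz) as [[Hc _] _].
  apply continuity_2d_pt_filterlim in Hc.
  apply (continuous_ext (fun w : R * R => u (fst w, snd w))).
  { intros w. rewrite <- surjective_pairing. reflexivity. }
  exact Hc.
Qed.

(** * Packing of separated points *)

Definition lsum (f : nat -> R) (l : list nat) : R := fold_right (fun i s => f i + s) 0 l.

Lemma lsum_filter (f : nat -> R) (p : nat -> bool) l :
  lsum f l = lsum f (filter p l) + lsum f (filter (fun i => negb (p i)) l).
Proof. induction l as [|a l IH]; simpl. ring. destruct (p a); simpl; rewrite IH; ring. Qed.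

Lemma lsum_le_length (f : nat -> R) (c : R) l : (forall i, In i l -> f i <= c) ->
  lsum f l <= INR (length l) * c.
Proof.
  induction l as [|a l IH]; intros H; cbn [lsum fold_right length]. simpl; lra.
  rewrite S_INR. change (fold_right (fun i s => f i + s) 0 l) with (lsum f l).
  assert (f a <= c) by (apply H; simpl; auto).
  assert (lsum f l <= INR (length l) * c) by (apply IH; intros; apply H; simpl; auto). lra.
Qed.

Lemma lsum_ge_length (f : nat -> R) (c : R) l : (forall i, In i l -> c <= f i) ->
  INR (length l) * c <= lsum f l.
Proof.
  induction l as [|a l IH]; intros H; cbn [lsum fold_right length]. simpl; lra.
  rewrite S_INR. change (fold_right (fun i s => f i + s) 0 l) with (lsum f l).
  assert (c <= f a) by (apply H; simpl; auto).
  assert (INR (length l) * c <= lsum f l) by (apply IH; intros; apply H; simpl; auto). lra.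
Qed.

Lemma lsum_le (f g : nat -> R) l : (forall i, In i l -> f i <= g i) -> lsum f l <= lsum g l.
Proof.
  induction l as [|a l IH]; intros H; simpl; [lra|].
  apply Rplus_le_compat. apply H; simpl; auto. apply IH; intros; apply H; simpl; auto.
Qed.

Lemma lsum_scal c f l : lsum (fun i => c * f i) l = c * lsum f l.
Proof. induction l as [|a l IH]; simpl. ring. rewrite IH; ring. Qed.

Lemma NoDup_map_on {A B : Type} (f : A -> B) (l : list A) : NoDup l ->
  (forall x y, In x l -> In y l -> f x = f y -> x = y) -> NoDup (map f l).
Proof.
  induction 1 as [|a l Ha Hl IH]; intros Hf; simpl; constructor.
  - rewrite in_map_iff. intros (y & E & Hy). apply Hf in E; simpl; auto. subst; auto.
  - apply IH. intros; apply Hf; simpl; auto.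
Qed.

Section Packing.

Variables (x y : nat -> R) (d : R).
Hypothesis d_range : 0 < d < 1.

(** In the right half-plane the pseudo-hyperbolic distance is [|p - q| / |p + conj q|]. Separation
    by [d] implies this inequality, in which the ordinates are dropped from the denominator. *)
Definition apart (l : list nat) : Prop := forall i j, In i l -> In j l -> i <> j ->
  d ^ 2 * (x i + x j) ^ 2 <= (x i - x j) ^ 2 + (y i - y j) ^ 2.

Lemma apart_filter p l : apart l -> apart (filter p l).
Proof. intros H i j Hi Hj. apply filter_In in Hi, Hj. apply H; tauto. Qed.

(* Two points of the same strip whose ordinates have the same integer part in units of
   [d * X] are too close to each other. *)
Lemma strip_count (X Y : R) (l : list nat) : 0 < X -> 0 <= Y -> NoDup l -> apart l ->
  (forall i, In i l -> X < x i <= (1 + d) * X /\ Rabs (y i) <= Y) ->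
  INR (length l) <= 2 * (Y / (d * X)) + 5.
Proof.
  intros HX HY Hnd Hap Hl.
  assert (HdX : 0 < d * X) by nra.
  set (k := fun i => (Int_part (y i / (d * X)))).
  set (K := up (Y / (d * X))).
  assert (HK : Y / (d * X) < IZR K <= Y / (d * X) + 1).
  { pose proof (archimed (Y / (d * X))). fold K in H. lra. }
  assert (HYd : 0 <= Y / (d * X)).
  { apply Rmult_le_pos; auto. left; apply Rinv_0_lt_compat; auto. }
  assert (HK0 : (0 < K)%Z) by (apply lt_IZR; lra).
  assert (Hk : forall i, In i l -> (0 <= k i + K + 1 < 2 * K + 2)%Z).
  { intros i Hi. destruct (Hl i Hi) as [_ Hy]. apply Rabs_le_between in Hy.
    pose proof (base_Int_part (y i / (d * X))) as [B1 B2]. fold (k i) in B1, B2.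
    assert (y i / (d * X) <= Y / (d * X)).
    { apply Rmult_le_compat_r; [left; apply Rinv_0_lt_compat; auto|lra]. }
    assert (- (Y / (d * X)) <= y i / (d * X)).
    { unfold Rdiv. rewrite <- Ropp_mult_distr_l_reverse.
      apply Rmult_le_compat_r; [left; apply Rinv_0_lt_compat; auto|lra]. }
    split.
    - apply le_IZR. rewrite !plus_IZR. simpl. lra.
    - apply lt_IZR. rewrite !plus_IZR, mult_IZR. simpl. lra. }
  assert (Hinj : NoDup (map (fun i => Z.to_nat (k i + K + 1)) l)).
  { apply NoDup_map_on; auto. intros i j Hi Hj E.
    destruct (Nat.eq_dec i j) as [|Hij]; auto. exfalso.
    apply Z2Nat.inj in E; try apply Hk; auto.
    assert (E2 : k i = k j) by lia. clear E.
    pose proof (base_Int_part (y i / (d * X))) as [B1 B2]. fold (k i) in B1, B2.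
    pose proof (base_Int_part (y j / (d * X))) as [B3 B4]. fold (k j) in B3, B4.
    rewrite E2 in B1, B2.
    assert (Hyy : Rabs (y i / (d * X) - y j / (d * X)) < 1) by (apply Rabs_lt_between; lra).
    replace (y i / (d * X) - y j / (d * X)) with ((y i - y j) / (d * X)) in Hyy by (field; lra).
    unfold Rdiv in Hyy. rewrite Rabs_mult, Rabs_inv, (Rabs_pos_eq (d * X)) in Hyy by lra.
    assert (Hy2 : Rabs (y i - y j) < d * X).
    { apply Rmult_lt_compat_r with (r := d * X) in Hyy; auto.
      rewrite Rmult_assoc, Rinv_l in Hyy; lra. }
    pose proof (Hap i j Hi Hj Hij) as H.
    destruct (Hl i Hi) as [[X1 X2] _]. destruct (Hl j Hj) as [[X3 X4] _].
    assert (Hx2 : (x i - x j) ^ 2 <= (d * X) ^ 2).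
    { rewrite <- (pow2_abs (x i - x j)). apply pow_incr. split. apply Rabs_pos.
      apply Rabs_le. lra. }
    assert (Hy3 : (y i - y j) ^ 2 <= (d * X) ^ 2).
    { rewrite <- (pow2_abs (y i - y j)). apply pow_incr. split. apply Rabs_pos. lra. }
    assert ((2 * X) ^ 2 <= (x i + x j) ^ 2) by (apply pow_incr; lra).
    assert (0 < d ^ 2 * X ^ 2) by (apply Rmult_lt_0_compat; apply pow_lt; lra).
    assert (d ^ 2 * (2 * X) ^ 2 <= d ^ 2 * (x i + x j) ^ 2)
      by (apply Rmult_le_compat_l; auto; apply pow2_ge_0).
    nra. }
  assert (Hlen : (length l <= Z.to_nat (2 * K + 2))%nat).
  { rewrite <- (length_map (fun i => Z.to_nat (k i + K + 1))).
    rewrite <- (length_seq (Z.to_nat (2 * K + 2)) 0).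
    apply NoDup_incl_length; auto. intros n Hn. apply in_map_iff in Hn.
    destruct Hn as (i & <- & Hi). apply in_seq. specialize (Hk i Hi). lia. }
  apply le_INR in Hlen. rewrite (INR_IZR_INZ (Z.to_nat _)), Z2Nat.id in Hlen by lia.
  rewrite plus_IZR, mult_IZR in Hlen. lra.
Qed.

(** Cut the region into strips where [x] is about [T / q ^ (2 * I)]. There [|y| <= T / q ^ I], so a
    strip holds of the order of [q ^ I] points, and its sum decays like [T / q ^ I]. *)
Lemma packing_sum (T : R) (l : list nat) : 0 < T -> NoDup l -> apart l ->
  (forall i, In i l -> 0 < x i <= T /\ y i ^ 2 <= T * x i) ->
  lsum x l <= (2 * (1 + d / 3) ^ 2 / d + 5) * / (1 - / (1 + d / 3)) * T.
Proof.
  intros HT Hnd Hap Hl.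
  (* Chosen so that [q ^ 2 <= 1 + d], the strip width allowed by [strip_count]. *)
  set (q := 1 + d / 3). assert (Hq : 1 < q) by (unfold q; lra).
  set (K := 2 * q ^ 2 / d + 5).
  assert (Hq2 : q ^ 2 <= 1 + d) by (unfold q; nra).
  assert (HK : 0 < K).
  { unfold K. pose proof (Rdiv_lt_0_compat (2 * q ^ 2) d ltac:(pose proof (pow_lt q 2); nra) ltac:(lra)). lra. }
  assert (Hqi : 0 < / q < 1).
  { split. apply Rinv_0_lt_compat; lra. rewrite <- Rinv_1. apply Rinv_lt_contravar; lra. }
  assert (Hlev : forall I l, NoDup l -> apart l ->
     (forall i, In i l -> T * / q ^ (2 * I) < x i <= T /\ y i ^ 2 <= T * x i) ->
     lsum x l <= T * K * ((1 - (/ q) ^ I) / (1 - / q))).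
  { clear l Hnd Hap Hl. induction I as [|I IH]; intros l Hnd Hap Hl.
    - destruct l as [|a l]. simpl. replace ((1 - 1) / (1 - / q)) with 0 by (field; lra). lra.
      exfalso. destruct (Hl a) as [[A B] _]. simpl; auto. simpl in A. rewrite Rinv_1 in A. lra.
    - set (p := fun i => if Rlt_dec (T * / q ^ (2 * I)) (x i) then true else false).
      rewrite (lsum_filter x p l).
      assert (H1 : lsum x (filter p l) <= T * K * ((1 - (/ q) ^ I) / (1 - / q))).
      { apply IH. apply NoDup_filter; auto. apply apart_filter; auto.
        intros i Hi. apply filter_In in Hi. destruct Hi as [Hi Hp]. destruct (Hl i Hi) as [[A B] C0].
        unfold p in Hp. destruct (Rlt_dec _ _); [auto|discriminate]. }
      set (X := T * / q ^ (2 * S I)).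
      assert (HQ : 0 < q ^ I) by (apply pow_lt; lra).
      assert (EX : T * / q ^ (2 * I) = q ^ 2 * X).
      { unfold X. replace (2 * S I)%nat with (2 + 2 * I)%nat by lia. rewrite pow_add.
        field. repeat split; try lra; apply pow_nonzero; lra. }
      assert (HX : 0 < X).
      { unfold X. apply Rmult_lt_0_compat; auto. apply Rinv_0_lt_compat, pow_lt; lra. }
      assert (EXi : X = T / (q ^ 2 * (q ^ I * q ^ I))).
      { unfold X. replace (2 * S I)%nat with (2 + (I + I))%nat by lia. rewrite !pow_add. reflexivity. }
      set (r := filter (fun i => negb (p i)) l).
      assert (Hr : forall i, In i r -> X < x i <= q ^ 2 * X /\ Rabs (y i) <= T / q ^ I).
      { intros i Hi. apply filter_In in Hi. destruct Hi as [Hi Hp]. destruct (Hl i Hi) as [[A B] C0].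
        unfold p in Hp. destruct (Rlt_dec _ _) as [|L]; [discriminate|]. rewrite EX in L.
        split; [unfold X in *; lra|].
        apply Rsqr_incr_0_var; [|left; apply Rdiv_lt_0_compat; auto].
        rewrite <- Rsqr_abs, !Rsqr_pow2.
        eapply Rle_trans; [apply C0|]. apply Rle_trans with (T * (q ^ 2 * X)).
        apply Rmult_le_compat_l; lra. right. rewrite EXi. field. split; lra. }
      assert (Hn : INR (length r) <= 2 * (T / q ^ I / (d * X)) + 5).
      { apply strip_count; auto. left; apply Rdiv_lt_0_compat; auto. apply NoDup_filter; auto.
        apply apart_filter; auto. intros i Hi. destruct (Hr i Hi) as [[A B] C0]. split; auto.
        split; auto. eapply Rle_trans; [apply B|]. apply Rmult_le_compat_r; lra. }
      assert (H2 : lsum x r <= T * K * (/ q) ^ I).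
      { eapply Rle_trans; [apply (lsum_le_length x (q ^ 2 * X)); intros i Hi; apply (Hr i Hi)|].
        apply Rle_trans with ((2 * (T / q ^ I / (d * X)) + 5) * (q ^ 2 * X)).
        { apply Rmult_le_compat_r; auto. apply Rmult_le_pos; [apply pow2_ge_0|lra]. }
        rewrite pow_inv, EXi. unfold K.
        replace ((2 * (T / q ^ I / (d * (T / (q ^ 2 * (q ^ I * q ^ I))))) + 5) *
          (q ^ 2 * (T / (q ^ 2 * (q ^ I * q ^ I)))))
          with (T * (2 * q ^ 2 / d) * / q ^ I + T * 5 * (/ q ^ I * / q ^ I)).
        2:{ field. repeat split; lra. }
        assert (0 < / q ^ I <= 1).
        { split. apply Rinv_0_lt_compat; auto. rewrite <- Rinv_1. apply Rinv_le_contravar; [lra|].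
          apply pow_R1_Rle; lra. }
        assert (T * 5 * (/ q ^ I * / q ^ I) <= T * 5 * / q ^ I); [|lra].
        apply Rmult_le_compat_l; nra. }
      eapply Rle_trans; [apply Rplus_le_compat; [apply H1|apply H2]|].
      right. simpl. field. split; [lra|]. nra. }
  (* A finite list stays above a positive abscissa, so finitely many strips cover it. *)
  assert (HI : exists I, forall i, In i l -> T * / q ^ (2 * I) < x i).
  { clear Hnd Hap. induction l as [|a l IH].
    - exists O. intros i [].
    - destruct IH as [I1 HI1]. { intros; apply Hl; simpl; auto. }
      assert (Hxa : 0 < x a) by (apply Hl; simpl; auto).
      destruct (Pow_x_infinity q ltac:(rewrite Rabs_pos_eq; lra) (T / x a + 1)) as [I2 HI2].
      exists (I1 + I2)%nat.
      assert (Hmono : forall m n, (m <= n)%nat -> T * / q ^ n <= T * / q ^ m).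
      { intros m n Hmn. apply Rmult_le_compat_l; [lra|]. apply Rinv_le_contravar.
        apply pow_lt; lra. apply Rle_pow; auto. lra. }
      intros i [->|Hi].
      + eapply Rle_lt_trans; [apply (Hmono I2); lia|].
        specialize (HI2 I2 (le_n I2)). rewrite Rabs_pos_eq in HI2 by (apply pow_le; lra).
        pose proof (pow_lt q I2 ltac:(lra)) as P.
        apply Rmult_lt_reg_r with (q ^ I2); auto. rewrite Rmult_assoc, Rinv_l, Rmult_1_r by lra.
        apply Rle_lt_trans with (x i * (T / x i)). right; field; lra.
        apply Rmult_lt_compat_l; auto. lra.
      + eapply Rle_lt_trans; [apply (Hmono (2 * I1)%nat); lia|]. auto. }
  destruct HI as [I HI].
  eapply Rle_trans; [apply (Hlev I l); auto|].
  { intros i Hi. destruct (Hl i Hi) as [[A B] C0]. auto. }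
  replace (K * / (1 - / q) * T) with (T * K * (1 / (1 - / q))) by (unfold Rdiv; ring).
  apply Rmult_le_compat_l. nra.
  apply Rmult_le_compat_r. left; apply Rinv_0_lt_compat; lra.
  pose proof (pow_le (/ q) I ltac:(lra)). lra.
Qed.

End Packing.

(** * Necessity of the density condition *)

(* The Cayley map sending the disc to the right half-plane and [cis t] to infinity. *)
Definition cayley (t : R) (z : C) : C := ((cis t + z) / (cis t - z))%C.

Lemma cayley_re (t : R) (z : C) : in_disc z -> fst (cayley t z) = poisson z t.
Proof.
  intros Hz. pose proof (circle_sub_neq z t Hz) as Hn. pose proof (circle_sub_pos z t Hz) as Hp.
  assert (E : fst (cayley t z) = (fst (cis t + z)%C * fst (cis t - z)%C +
     snd (cis t + z)%C * snd (cis t - z)%C) / Cmod (cis t - z) ^ 2).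
  { unfold cayley. rewrite Cmod_sqr. set (p := (cis t + z)%C). set (q := (cis t - z)%C) in *.
    clearbody p q. simpl. unfold Rdiv. ring. }
  rewrite E. unfold poisson, defect. f_equal. rewrite Cmod_sqr. simpl.
  pose proof (sin2_cos2 t) as Ht. unfold Rsqr in Ht. nra.
Qed.

Lemma cayley_pseudo_dist (t : R) (z w : C) : in_disc z -> in_disc w ->
  Cmod (cayley t z - cayley t w) = pseudo_dist z w * Cmod (cayley t z + Cconj (cayley t w)).
Proof.
  intros Hz Hw.
  pose proof (circle_sub_neq z t Hz) as Nz. pose proof (circle_sub_neq w t Hw) as Nw.
  pose proof (circle_sub_pos z t Hz) as Pz. pose proof (circle_sub_pos w t Hw) as Pw.
  assert (Nc : (Cconj (cis t) - Cconj w)%C <> 0).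
  { rewrite <- Cminus_conj. intros E. apply Nw, Cmod_eq_0. rewrite <- Cmod_conj, E. apply Cmod_0. }
  assert (E1 : (cayley t z - cayley t w)%C = (2 * cis t * (z - w) / ((cis t - z) * (cis t - w)))%C).
  { unfold cayley. field. auto. }
  assert (E2 : (cayley t z + Cconj (cayley t w))%C =
     (2 * (1 - Cconj w * z) / ((cis t - z) * Cconj (cis t - w)))%C).
  { unfold cayley. rewrite Cdiv_conj by auto. rewrite Cplus_conj, Cminus_conj.
    rewrite <- (circle_conj t). field. auto. }
  assert (N1 : ((cis t - z) * (cis t - w))%C <> 0) by (apply Cmult_neq_0; auto).
  assert (N2 : ((cis t - z) * Cconj (cis t - w))%C <> 0).
  { apply Cmult_neq_0; auto. rewrite Cminus_conj; auto. }
  rewrite E1, E2, !Cmod_div, !Cmod_mult, Cmod_conj, Cmod_cis, pseudo_dist_eq by auto.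
  pose proof (cross_pos z w Hz Hw). field. repeat split; lra.
Qed.

(** In the half-plane with [cis t] at infinity, scaled so that [z n] sits at 1, the abscissa of
    [z j] is the ratio of the Poisson kernels. The condition [hyp_exp <= L] becomes
    [(x + 1) ^ 2 + y ^ 2 <= 4 * L * x], inside the region of [packing_sum] for [T = 4 * L]. *)
Lemma kernel_sum (z : nat -> C) (d : R) : (forall n, in_disc (z n)) -> 0 < d < 1 ->
  (forall n m, n <> m -> d <= pseudo_dist (z n) (z m)) ->
  exists K, 0 < K /\ forall n L J t, 1 <= L -> NoDup J ->
    (forall j, In j J -> hyp_exp (z j) (z n) <= L) ->
    lsum (fun j => poisson (z j) t) J <= K * L * poisson (z n) t.
Proof.
  intros Hz Hd Hsep.
  set (K := (2 * (1 + d / 3) ^ 2 / d + 5) * / (1 - / (1 + d / 3))).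
  assert (HK : 0 < K).
  { assert (/ (1 + d / 3) < 1) by (rewrite <- Rinv_1; apply Rinv_lt_contravar; lra).
    apply Rmult_lt_0_compat; [|apply Rinv_0_lt_compat; lra].
    assert (0 < 2 * (1 + d / 3) ^ 2 / d); [|lra].
    apply Rdiv_lt_0_compat; [|lra]. pose proof (pow_lt (1 + d / 3) 2). lra. }
  exists (K * 4). split; [lra|]. intros n L J t HL Hnd HJ.
  set (P := poisson (z n) t). assert (HP : 0 < P) by (apply poisson_pos, Hz).
  set (x := fun j => poisson (z j) t / P).
  set (y := fun j => (snd (cayley t (z j)) - snd (cayley t (z n))) / P).
  assert (Hmod : forall i j, Cmod (cayley t (z i) - cayley t (z j)) ^ 2 =
      P ^ 2 * ((x i - x j) ^ 2 + (y i - y j) ^ 2) /\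
      Cmod (cayley t (z i) + Cconj (cayley t (z j))) ^ 2 =
      P ^ 2 * ((x i + x j) ^ 2 + (y i - y j) ^ 2)).
  { intros i j. rewrite !Cmod_sqr. unfold Cminus, Cplus, Copp, Cconj. cbn [fst snd].
    rewrite !cayley_re by auto.
    unfold x, y. split; field; lra. }
  assert (HP2 : 0 < P ^ 2) by (apply pow_lt; auto).
  assert (Hx : forall j, 0 < x j) by (intros; apply Rdiv_lt_0_compat; auto; apply poisson_pos, Hz).
  pose proof (packing_sum x y d Hd (4 * L) J ltac:(lra) Hnd) as Hpack. fold K in Hpack.
  assert (E : lsum (fun j => poisson (z j) t) J = P * lsum x J).
  { rewrite <- lsum_scal. assert (Hext : forall f g l, (forall i : nat, f i = g i) -> lsum f l = lsum g l).
    { intros f g l H. induction l as [|a l IH]; simpl; auto. rewrite H, IH; auto. }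
    apply Hext. intros i. unfold x. field. lra. }
  rewrite E. replace (K * 4 * L * P) with (P * (K * (4 * L))) by ring.
  apply Rmult_le_compat_l; [lra|]. apply Hpack.
  - intros i j Hi Hj Hij. destruct (Hmod i j) as [H1 H2].
    rewrite cayley_pseudo_dist, Rpow_mult_distr, H2 in H1 by auto.
    pose proof (Hsep i j Hij) as Hs.
    assert (Hs2 : d ^ 2 <= pseudo_dist (z i) (z j) ^ 2) by (apply pow_incr; lra).
    set (rho := pseudo_dist (z i) (z j) ^ 2) in *.
    apply Rmult_le_reg_l with (P ^ 2); auto. rewrite <- H1.
    replace (rho * (P ^ 2 * ((x i + x j) ^ 2 + (y i - y j) ^ 2)))
      with (P ^ 2 * (rho * ((x i + x j) ^ 2 + (y i - y j) ^ 2))) by ring.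
    apply Rmult_le_compat_l; [lra|]. pose proof (pow2_ge_0 (x i + x j)).
    pose proof (pow2_ge_0 (y i - y j)). pose proof (pow2_ge_0 d).
    apply Rmult_le_compat; lra.
  - intros j Hj. specialize (HJ j Hj). specialize (Hx j).
    assert (Exn : x n = 1) by (unfold x, P; field; unfold P in HP; lra).
    assert (Eyn : y n = 0) by (unfold y; unfold Rminus; rewrite Rplus_opp_r; unfold Rdiv; ring).
    destruct (Hmod j n) as [H1 H2]. rewrite Exn, Eyn in H1, H2.
    rewrite cayley_pseudo_dist, Rpow_mult_distr, H2 in H1 by auto.
    pose proof (hyp_exp_mul_ge (z j) (z n) (Hz j) (Hz n)) as Hg.
    pose proof (pseudo_dist_lt_1 (z j) (z n) (Hz j) (Hz n)) as Hr1.
    pose proof (pseudo_dist_ge_0 (z j) (z n)) as Hr0.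
    set (r := pseudo_dist (z j) (z n)) in *.
    assert (Hlow : 1 <= L * (1 - r ^ 2)).
    { eapply Rle_trans; [apply Hg|]. apply Rmult_le_compat_r; auto. nra. }
    assert (Hq : (1 - r ^ 2) * ((x j + 1) ^ 2 + (y j - 0) ^ 2) = 4 * x j).
    { apply Rmult_eq_reg_l with (P ^ 2); lra. }
    assert (Hmain : (x j + 1) ^ 2 + (y j) ^ 2 <= 4 * L * x j).
    { set (A := (x j + 1) ^ 2 + (y j - 0) ^ 2) in *.
      assert (HA : 0 <= A) by (unfold A; pose proof (pow2_ge_0 (x j + 1)); pose proof (pow2_ge_0 (y j - 0)); lra).
      replace ((x j + 1) ^ 2 + y j ^ 2) with A by (unfold A; ring).
      assert (A * 1 <= A * (L * (1 - r ^ 2))) by (apply Rmult_le_compat_l; auto).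
      replace (4 * L * x j) with (L * (4 * x j)) by ring. rewrite <- Hq. lra. }
    pose proof (pow2_ge_0 (y j)). pose proof (pow2_ge_0 (x j)).
    repeat split; auto.
    + apply Rmult_le_reg_r with (x j); auto. nra.
    + nra.
Qed.

(* [1 - pseudo_dist ^ 2] to a fixed point changes at most by the factor [hyp_exp]; this is
   the triangle inequality in the form needed for the data of the interpolation problem. *)
Lemma pseudo_defect_lipschitz (z w a : C) : in_disc z -> in_disc w -> in_disc a ->
  1 - pseudo_dist w a ^ 2 <= hyp_exp z w * (1 - pseudo_dist z a ^ 2).
Proof.
  intros Hz Hw Ha.
  pose proof (defect_pos z Hz) as Dz. pose proof (defect_pos w Hw) as Dw. pose proof (defect_pos a Ha) as Da.
  pose proof (cross_pos z a Hz Ha) as Pza. pose proof (cross_pos w a Hw Ha) as Pwa.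
  pose proof (cross_pos z w Hz Hw) as Pzw.
  pose proof (pseudo_dist_ge_0 z w) as Hr0.
  assert (H1 : Cmod (1 - Cconj a * z) * defect w <=
    (1 + pseudo_dist z w) * (Cmod (1 - Cconj a * w) * Cmod (1 - Cconj w * z))).
  { assert (E : ((1 - Cconj a * z) * RtoC (defect w))%C =
      ((1 - Cconj a * w) * (1 - Cconj w * z) + (z - w) * (Cconj w - Cconj a))%C).
    { unfold defect. rewrite RtoC_minus, Cmod2_conj. ring. }
    rewrite <- (Rabs_pos_eq (defect w)), <- Cmod_R, <- Cmod_mult, E by lra.
    eapply Rle_trans; [apply Cmod_triangle|]. rewrite !Cmod_mult.
    assert (Hzw : Cmod (z - w) = pseudo_dist z w * Cmod (1 - Cconj w * z)).
    { rewrite pseudo_dist_eq by auto. field. lra. }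
    assert (Hwa : Cmod (Cconj w - Cconj a) <= Cmod (1 - Cconj a * w)).
    { rewrite <- Cminus_conj, Cmod_conj.
      apply Rsqr_incr_0_var; [|lra]. rewrite !Rsqr_pow2.
      pose proof (cross_identity w a). assert (0 < defect w * defect a) by nra. lra. }
    rewrite Hzw.
    assert (pseudo_dist z w * Cmod (1 - Cconj w * z) * Cmod (Cconj w - Cconj a) <=
      pseudo_dist z w * Cmod (1 - Cconj w * z) * Cmod (1 - Cconj a * w)).
    { apply Rmult_le_compat_l; auto. apply Rmult_le_pos; lra. }
    lra. }
  assert (H2 := pow_incr _ _ 2 (conj (Rmult_le_pos _ _ (Rlt_le _ _ Pza) (Rlt_le _ _ Dw)) H1)).
  rewrite !Rpow_mult_distr, <- hyp_exp_mul, !pseudo_dist_sqr in H2 by auto.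
  rewrite !pseudo_dist_sqr by auto.
  set (A := Cmod (1 - Cconj a * z)) in *. set (B := Cmod (1 - Cconj a * w)) in *.
  set (D := Cmod (1 - Cconj w * z)) in *.
  replace (hyp_exp z w * (defect z * defect w / D ^ 2) * (B ^ 2 * D ^ 2))
    with (hyp_exp z w * defect z * B ^ 2 * defect w) in H2 by (field; lra).
  assert (H3 : A ^ 2 * defect w <= hyp_exp z w * defect z * B ^ 2).
  { apply Rmult_le_reg_r with (defect w); auto. lra. }
  apply Rmult_le_reg_r with (A ^ 2 * B ^ 2). apply Rmult_lt_0_compat; apply pow_lt; auto.
  replace (defect w * defect a / B ^ 2 * (A ^ 2 * B ^ 2)) with (defect a * (A ^ 2 * defect w)) by (field; lra).
  replace (hyp_exp z w * (defect z * defect a / A ^ 2) * (A ^ 2 * B ^ 2))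
    with (defect a * (hyp_exp z w * defect z * B ^ 2)) by (field; lra).
  apply Rmult_le_compat_l; lra.
Qed.

(** Positivity of [u] lets the kernel inequality be integrated against [u (r * cis t)], which gives
    the claim at the points [r * z j]; then [r] tends to 1. Smaller circles avoid any boundary
    measure of [u]. *)
Lemma harmonic_kernel_sum (u : C -> R) (z : nat -> C) (J : list nat) (n : nat) (B : R) :
  positive_harmonic u -> (forall n, in_disc (z n)) ->
  (forall t, lsum (fun j => poisson (z j) t) J <= B * poisson (z n) t) ->
  lsum (fun j => u (z j)) J <= B * u (z n).
Proof.
  intros [Hu Hup] Hz HB.
  set (r := fun k => 1 - / INR (k + 2)).
  assert (Hr : forall k, 0 < r k < 1).
  { intros k. unfold r. rewrite plus_INR. simpl. pose proof (pos_INR k).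
    split.
    - assert (/ (INR k + (1 + 1)) < 1); [|lra]. rewrite <- Rinv_1. apply Rinv_lt_contravar; lra.
    - assert (0 < / (INR k + (1 + 1))) by (apply Rinv_0_lt_compat; lra). lra. }
  assert (Hlim1 : is_lim_seq r 1).
  { unfold r. replace (Finite 1) with (Rbar_plus 1 (Rbar_opp 0)) by (simpl; f_equal; ring).
    apply (is_lim_seq_minus' (fun _ => 1) (fun k => / INR (k + 2)) 1 0). apply is_lim_seq_const.
    apply (is_lim_seq_incr_n (fun k => / INR k) 2).
    replace (Finite 0) with (Rbar_inv p_infty) by reflexivity.
    apply is_lim_seq_inv; [apply is_lim_seq_INR|discriminate]. }
  assert (Hlim : forall j, is_lim_seq (fun k => u (RtoC (r k) * z j)%C) (u (z j))).
  { intros j. apply (filterlim_comp _ _ _ (fun k => RtoC (r k) * z j)%C u eventually (locally (z j))).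
    - intros P [eps HP].
      destruct (proj2 (is_lim_seq_spec _ _) Hlim1 eps) as (N & HN). exists N. intros k Hk.
      specialize (HN k Hk). apply HP.
      assert (Hd : Cmod (RtoC (r k) * z j - z j) < eps).
      { replace (RtoC (r k) * z j - z j)%C with (RtoC (r k - 1) * z j)%C
          by (rewrite RtoC_minus; ring).
        rewrite Cmod_mult, Cmod_R. pose proof (Hz j) as Hzj. red in Hzj.
        pose proof (Cmod_ge_0 (z j)). pose proof (Rabs_pos (r k - 1)). nra. }
      split; (eapply Rle_lt_trans; [|apply Hd]).
      + eapply Rle_trans; [|apply fst_le_Cmod]. right. reflexivity.
      + eapply Rle_trans; [|apply snd_le_Cmod]. right. reflexivity.
    - apply (continuous_harmonic u (z j) Hu (Hz j)). }
  assert (Hc : forall k t, continuous (fun t => u (RtoC (r k) * cis t)%C) t).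
  { intros k t.
    assert (Hw : in_disc (RtoC (r k) * cis t)%C).
    { red. rewrite Cmod_mult, Cmod_R, Cmod_cis, Rabs_pos_eq by (left; apply Hr).
      rewrite Rmult_1_r. apply Hr. }
    pose proof (continuous_harmonic u _ Hu Hw) as H.
    refine (proj1 (contC_comp (fun w => RtoC (u w)) (fun t => RtoC (r k) * cis t)%C t _ _)).
    - apply contC_mult. apply contC_const. apply contC_circle.
    - apply contC_RtoC; auto. }
  assert (Hle : forall k, lsum (fun j => u (RtoC (r k) * z j)%C) J <= B * u (RtoC (r k) * z n)%C).
  { intros k. rewrite <- (poisson_harmonic u (r k) (z n)) by auto.
    assert (Hpc : forall j t, continuous (fun t => poisson (z j) t * u (RtoC (r k) * cis t)%C) t).
    { intros; apply cont_mult; auto. apply cont_poisson, Hz. }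
    assert (E : lsum (fun j => u (RtoC (r k) * z j)%C) J =
       mean (fun t => lsum (fun j => poisson (z j) t) J * u (RtoC (r k) * cis t)%C) /\
       forall t, continuous (fun t => lsum (fun j => poisson (z j) t) J * u (RtoC (r k) * cis t)%C) t).
    { clear HB. induction J as [|a l [IH IHc]]; simpl.
      - rewrite (mean_ext _ (fun _ => 0)) by (intros; ring). rewrite mean_const. split; auto.
        intros t. apply cont_mult; auto. apply cont_const.
      - assert (Hs : forall t, continuous (fun t => poisson (z a) t * u (RtoC (r k) * cis t)%C +
           lsum (fun j => poisson (z j) t) l * u (RtoC (r k) * cis t)%C) t).
        { intros; apply cont_plus; auto. }
        split.
        + rewrite (mean_ext _ (fun t => poisson (z a) t * u (RtoC (r k) * cis t)%C +
             lsum (fun j => poisson (z j) t) l * u (RtoC (r k) * cis t)%C)).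
          2:{ intros t. unfold lsum. ring. }
          rewrite mean_plus by auto. rewrite <- IH, poisson_harmonic by auto. reflexivity.
        + intros t. eapply cont_ext; [|apply Hs]. intros t'. unfold lsum. simpl. ring. }
    destruct E as [E Ec]. rewrite E, <- mean_scal by auto.
    apply mean_le; auto.
    - intros; apply cont_mult; auto. apply cont_const.
    - intros t. rewrite <- Rmult_assoc. apply Rmult_le_compat_r; auto.
      left. apply Hup. red. rewrite Cmod_mult, Cmod_R, Cmod_cis, Rabs_pos_eq by (left; apply Hr).
      rewrite Rmult_1_r. apply Hr. }
  assert (L1 : is_lim_seq (fun k => lsum (fun j => u (RtoC (r k) * z j)%C) J) (lsum (fun j => u (z j)) J)).
  { clear HB Hle. induction J as [|a l IH]; simpl. apply is_lim_seq_const.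
    apply is_lim_seq_plus'; auto. }
  assert (L2 : is_lim_seq (fun k => B * u (RtoC (r k) * z n)%C) (B * u (z n))).
  { apply (is_lim_seq_mult' (fun _ => B)); auto. apply is_lim_seq_const. }
  exact (is_lim_seq_le _ _ _ _ Hle L1 L2).
Qed.

(** Turns a uniform bound on the lengths of finite lists into a longest list, which will be a
    complete enumeration of the points to be counted. *)
Lemma maximal_list (P : list nat -> Prop) (B : nat) : P nil -> (forall l, P l -> (length l <= B)%nat) ->
  exists l, P l /\ forall l', P l' -> (length l' <= length l)%nat.
Proof.
  intros H0 HB.
  assert (H : forall k l, P l -> (B - length l <= k)%nat ->
    exists l, P l /\ forall l', P l' -> (length l' <= length l)%nat).
  { induction k as [|k IH]; intros l Hl Hk.
    - exists l. split; auto. intros l' Hl'. specialize (HB l' Hl'). lia.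
    - destruct (classic (exists l', P l' /\ (length l < length l')%nat)) as [(l' & Hl' & Hlt)|Hn].
      + apply (IH l'); auto. specialize (HB l' Hl'). lia.
      + exists l. split; auto. intros l' Hl'. apply Nat.nlt_ge. intros Hlt. apply Hn. eauto. }
  apply (H B nil); auto. lia.
Qed.

Lemma necessity (z : nat -> C) : (forall n, in_disc (z n)) -> separated z -> interpolating z ->
  exists M alpha : R, 0 < M /\ 0 < alpha < 1 /\
    forall n l : nat, (1 <= l)%nat ->
      card_le (fun p : C => exists j : nat, p = z j /\ hyp_dist (z j) (z n) <= INR l)
              (M * Rpower 2 (alpha * INR l)).
Proof.
  intros Hz Hs (eps & Heps & Hint).
  destruct (separated_pseudo_dist z Hz Hs) as (d & Hd & Hsep).
  assert (Hinj : forall n m, z n = z m -> n = m).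
  { intros n m E. destruct (Nat.eq_dec n m) as [|Hne]; auto. exfalso.
    specialize (Hsep n m Hne). rewrite E, pseudo_dist_diag in Hsep by auto. lra. }
  destruct (kernel_sum z d Hz Hd Hsep) as (K & HK & Hker).
  (* [e <= eps] for admissibility of the data; [e <= / 2] for the ratio [3 / 4] in [Hhalf]. *)
  set (e := Rmin eps (/ 2)).
  assert (He : 0 < e <= / 2) by (split; [apply Rmin_pos; lra|apply Rmin_r]).
  assert (Hee : e <= eps) by apply Rmin_l.
  pose proof ln2_pos as L2.
  assert (Hq : forall j n, 0 < 1 - pseudo_dist (z j) (z n) ^ 2 <= 1).
  { intros j n. pose proof (pseudo_dist_lt_1 _ _ (Hz j) (Hz n)). pose proof (pseudo_dist_ge_0 (z j) (z n)).
    split; [nra|]. pose proof (pow2_ge_0 (pseudo_dist (z j) (z n))). lra. }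
  (* The data equal 1 at [z n], so the value of the interpolating function there disappears from the
     bound. *)
  assert (Hsum : forall n L J, 1 <= L -> NoDup J -> (forall j, In j J -> hyp_exp (z j) (z n) <= L) ->
     lsum (fun j => Rpower (/ (1 - pseudo_dist (z j) (z n) ^ 2)) e) J <= K * L).
  { intros n L J HL Hnd HJ.
    set (w := fun j => Rpower (/ (1 - pseudo_dist (z j) (z n) ^ 2)) e).
    assert (Hlw : forall j, log2 (w j) = e * (- ln (1 - pseudo_dist (z j) (z n) ^ 2) / ln 2)).
    { intros j. unfold log2, w, Rpower. rewrite ln_exp, ln_Rinv by apply Hq. field. lra. }
    assert (Hone : forall i j, log2 (w i) - log2 (w j) <= e * hyp_dist (z i) (z j)).
    { intros i j. rewrite !Hlw, hyp_dist_eq.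
      pose proof (pseudo_defect_lipschitz (z i) (z j) (z n) (Hz i) (Hz j) (Hz n)) as H.
      pose proof (hyp_exp_pos _ _ (Hz i) (Hz j)).
      apply ln_le in H; [|apply Hq]. rewrite ln_mult in H; [|auto|apply Hq].
      rewrite <- Rmult_minus_distr_l. apply Rmult_le_compat_l; [lra|].
      unfold Rdiv. rewrite <- Rmult_minus_distr_r.
      apply Rmult_le_compat_r. left; apply Rinv_0_lt_compat; auto. lra. }
    destruct (Hint w) as (u & Hu & Huw).
    - intros; apply Rpower_pos.
    - intros i j. pose proof (hyp_dist_ge_0 (z i) (z j) (Hz i) (Hz j)).
      apply Rle_trans with (e * hyp_dist (z i) (z j)); [|apply Rmult_le_compat_r; auto].
      apply Rabs_le. split; [|apply Hone].
      assert (E : hyp_dist (z i) (z j) = hyp_dist (z j) (z i)).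
      { rewrite !hyp_dist_eq, hyp_exp_sym; auto. }
      rewrite E. pose proof (Hone j i). lra.
    - pose proof (harmonic_kernel_sum u z J n (K * L) Hu Hz) as H.
      rewrite Huw in H. replace (w n) with 1 in H.
      2:{ unfold w. rewrite pseudo_dist_diag by auto. replace (1 - 0 ^ 2) with 1 by ring.
          unfold Rpower. rewrite Rinv_1, ln_1, Rmult_0_r, exp_0. reflexivity. }
      rewrite Rmult_1_r in H.
      eapply Rle_trans; [|apply H; intros; apply Hker; auto].
      apply lsum_le. intros j _. rewrite Huw. unfold w. lra. }
  (* On the shell each value is at least [(L / 8) ^ e], because
     [hyp_exp * (1 - pseudo_dist ^ 2) <= 4]; dividing [K * L] by it gives the exponent [1 - e]. *)
  assert (Hshell : forall n L J, 1 <= L -> NoDup J ->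
     (forall j, In j J -> L / 2 < hyp_exp (z j) (z n) <= L) -> INR (length J) <= 8 * K * Rpower L (1 - e)).
  { intros n L J HL Hnd HJ.
    pose proof (Hsum n L J HL Hnd (fun j Hj => proj2 (HJ j Hj))) as H.
    assert (H2 : INR (length J) * Rpower (L / 8) e <= K * L).
    { eapply Rle_trans; [|apply H]. apply lsum_ge_length. intros j Hj.
      apply Rle_Rpower_l; [lra|]. split; [lra|].
      destruct (HJ j Hj) as [A _]. pose proof (hyp_exp_mul_le _ _ (Hz j) (Hz n)) as B.
      destruct (Hq j n) as [C1 _].
      apply Rmult_le_reg_r with (1 - pseudo_dist (z j) (z n) ^ 2); auto.
      rewrite Rinv_l by lra. nra. }
    rewrite Rpower_div in H2 by lra. unfold Rminus. rewrite Rpower_plus, Rpower_1, Rpower_Ropp by lra.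
    pose proof (Rpower_pos L e) as PL. pose proof (Rpower_pos 8 e) as P8.
    assert (P88 : Rpower 8 e <= 8) by (rewrite <- (Rpower_1 8) at 2 by lra; apply Rle_Rpower; lra).
    apply Rmult_le_reg_r with (Rpower L e); auto.
    replace (8 * K * (L * / Rpower L e) * Rpower L e) with (8 * (K * L)) by (field; lra).
    apply Rle_trans with (Rpower 8 e * (K * L)).
    - apply Rmult_le_reg_r with (/ Rpower 8 e). apply Rinv_0_lt_compat; auto.
      replace (Rpower 8 e * (K * L) * / Rpower 8 e) with (K * L) by (field; lra).
      unfold Rdiv in H2. lra.
    - apply Rmult_le_compat_r; auto. apply Rmult_le_pos; lra. }
  assert (Hhalf : Rpower 2 (- (1 - e)) <= 3 / 4).
  { apply Rle_trans with (Rpower 2 (- / 2)). apply Rle_Rpower; lra.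
    rewrite Rpower_Ropp, Rpower_sqrt by lra.
    assert (4 / 3 <= sqrt 2).
    { rewrite <- (sqrt_pow2 (4 / 3)) by lra. apply sqrt_le_1_alt. lra. }
    replace (3 / 4) with (/ (4 / 3)) by field. apply Rinv_le_contravar; lra. }
  (* The constant 32 reproduces itself: [32 * (3 / 4) + 8 = 32], the 8 coming from the outermost
     shell. *)
  assert (Hcount : forall n l J, NoDup J -> (forall j, In j J -> hyp_exp (z j) (z n) <= 2 ^ l) ->
     INR (length J) <= 32 * K * Rpower 2 ((1 - e) * INR l)).
  { intros n l. induction l as [|l IH]; intros J Hnd HJ.
    - pose proof (Hsum n 1 J (Rle_refl 1) Hnd HJ) as H.
      simpl INR. rewrite Rmult_0_r, Rpower_O by lra.
      assert (INR (length J) * 1 <= K * 1); [|lra].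
      eapply Rle_trans; [|apply H]. apply lsum_ge_length. intros j _.
      apply Rpower_ge_1; [|lra]. rewrite <- Rinv_1 at 1. apply Rinv_le_contravar; apply Hq.
    - set (p := fun j => if Rle_dec (hyp_exp (z j) (z n)) (2 ^ l) then true else false).
      assert (H1 : INR (length (filter p J)) <= 32 * K * Rpower 2 ((1 - e) * INR l)).
      { apply IH. apply NoDup_filter; auto. intros j Hj. apply filter_In in Hj.
        destruct Hj as [_ Hj]. unfold p in Hj. destruct (Rle_dec _ _); [auto|discriminate]. }
      assert (H2 : INR (length (filter (fun j => negb (p j)) J)) <= 8 * K * Rpower (2 ^ S l) (1 - e)).
      { apply (Hshell n). apply pow_R1_Rle; lra. apply NoDup_filter; auto.
        intros j Hj. apply filter_In in Hj. destruct Hj as [Hj Hp]. split; auto.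
        unfold p in Hp. destruct (Rle_dec _ _) as [|L]; [discriminate|]. simpl. lra. }
      assert (E : length J = (length (filter p J) + length (filter (fun j => negb (p j)) J))%nat).
      { rewrite (filter_length p J). reflexivity. }
      rewrite E, plus_INR.
      rewrite <- Rpower_pow, Rpower_mult in H2 by lra. rewrite (Rmult_comm (INR (S l))) in H2.
      set (X := Rpower 2 ((1 - e) * INR (S l))) in *.
      assert (HX : 0 < X) by apply Rpower_pos.
      assert (E3 : Rpower 2 ((1 - e) * INR l) = X * Rpower 2 (- (1 - e))).
      { unfold X. rewrite <- Rpower_plus. f_equal. rewrite S_INR. ring. }
      rewrite E3 in H1.
      assert (X * Rpower 2 (- (1 - e)) <= X * (3 / 4)) by (apply Rmult_le_compat_l; lra).
      assert (K * (X * Rpower 2 (- (1 - e))) <= K * (X * (3 / 4))) by (apply Rmult_le_compat_l; lra).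
      lra. }
  exists (32 * K), (1 - e). split; [lra|]. split; [lra|].
  intros n l Hl.
  assert (Hle : forall j, hyp_dist (z j) (z n) <= INR l <-> hyp_exp (z j) (z n) <= 2 ^ l).
  { intros j. rewrite <- Rpower_pow by lra. apply hyp_dist_le_iff; auto. }
  set (P := fun J => NoDup J /\ forall j, In j J -> hyp_exp (z j) (z n) <= 2 ^ l).
  destruct (INR_unbounded (32 * K * Rpower 2 ((1 - e) * INR l))) as (B & HB).
  destruct (maximal_list P B) as (J & [Hnd HJ] & Hmax).
  - split. constructor. intros j [].
  - intros J [Hnd HJ]. apply INR_le. specialize (Hcount n l J Hnd HJ). lra.
  - exists (map z J). split; [|split].
    + apply NoDup_map_on; auto.
    + intros p. rewrite in_map_iff. split.
      * intros (j & <- & Hj). exists j. split; auto. apply Hle; auto.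
      * intros (j & -> & Hj). exists j. split; auto.
        destruct (in_dec Nat.eq_dec j J) as [|Hn]; auto. exfalso.
        (* A missing index could be added to the longest list. *)
        assert (HP : P (j :: J)).
        { split. constructor; auto. intros i [<-|Hi]; auto. apply Hle; auto. }
        specialize (Hmax _ HP). simpl in Hmax. lia.
    + rewrite length_map. apply (Hcount n l); auto.
Qed.

Theorem theorem1 (z : nat -> C) (z_disc : forall n : nat, in_disc (z n))
    (z_sep : separated z) :
  interpolating z <->
  exists M alpha : R, 0 < M /\ 0 < alpha < 1 /\
    forall n l : nat, (1 <= l)%nat ->
      card_le (fun p : C => exists j : nat, p = z j /\
                              hyp_dist (z j) (z n) <= INR l)
              (M * Rpower 2 (alpha * INR l)).
Proof.
  split.
  - apply necessity; auto.
  - apply sufficiency; auto.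
Qed.
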